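(* Let $G$ be a geometrically rigid, residually finite hyperbolic group. Then there exists a constant $C$ such that for every finite index subgroup $H\le G$, every injective homomorphism $\phi:H\to G$ and every element $g\in G$ we have $$\ell_{\mathrm{Avg}}(\phi,g)\le C\cdot \ell(g).$$
   Context: A hyperbolic (Gromov/word-hyperbolic) group $G$ is geometrically rigid if it is one-ended and its Gromov boundary $\partial G$ contains no cut pair, i.e. no two distinct points $a,b$ such that $\partial G\setminus\{a,b\}$ is disconnected. Fix a finite generating set of $G$, with word norm $\|\cdot\|$. The stable translation length of $g\in G$ is $\ell(g)=\lim_{n\to\infty}\frac1n\|g^n\|$. For a finite index subgroup $H\le G$, an injective homomorphism $\phi:H\to G$ and $g\in G$, let $m\ge 1$ be the minimal positive integer with $g^m\in H$ and set $$\ell(\phi,g)=\tfrac1m\,\ell(\phi(g^m)).$$ Let $\{t_i\}_{1\le i\le [G:H]}$ be a set of representatives of the left cosets $G/H$ and define $$\ell_{\mathrm{Avg}}(\phi,g)=\frac1{[G:H]}\sum_{i=1}^{[G:H]}\ell(\phi,t_i^{-1}gt_i),$$ which does not depend on the choice of representatives. *)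

(* Defs.v *)
From HB Require Import structures.
From mathcomp Require Import all_boot all_order all_algebra all_fingroup finmap.
From mathcomp Require Import all_classical all_reals all_analysis.
Import numFieldNormedType.Exports.
Import Order.TTheory GRing.Theory Num.Theory.

Set Implicit Arguments.
Unset Strict Implicit.
Unset Printing Implicit Defensive.

Local Open Scope classical_set_scope.
Local Open Scope group_scope.

Definition is_word (G : groupType) (S : {fset G}) (w : seq G) : bool :=
  all (fun s => (s \in S) || (s^-1 \in S)) w.

Definition word_of_size (G : groupType) (S : {fset G}) (g : G) (n : nat) :
    Prop :=
  exists w : seq G, [/\ is_word S w, size w = n & \prod_(s <- w) s = g].

Record finite_generating_set (G : groupType) := FiniteGeneratingSet {
  generators :> {fset G};
  generatorsP : forall g : G, exists n, word_of_size generators g n }.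

Section WordMetric.
Variables (G : groupType) (S : finite_generating_set G).
Implicit Types x y z g : G.

Lemma word_norm_subproof g : exists n, `[< word_of_size S g n >].
Proof. by have [n Pn] := generatorsP S g; exists n; apply/asboolP. Qed.

Definition word_norm g : nat := ex_minn (word_norm_subproof g).

Definition word_dist x y : nat := word_norm (x^-1 * y).

Lemma word_norm_word g : word_of_size S g (word_norm g).
Proof. by rewrite /word_norm; case: ex_minnP => n /asboolP. Qed.

Lemma word_norm_le g n : word_of_size S g n -> (word_norm g <= n)%N.
Proof.
by move=> gn; rewrite /word_norm; case: ex_minnP => m _; apply; apply/asboolP.
Qed.

Lemma word_norm1 : word_norm 1 = 0%N.
Proof.
apply/eqP; rewrite -leqn0; apply: word_norm_le; exists [::]; split => //.
by rewrite big_nil.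
Qed.

Lemma word_normM x y : (word_norm (x * y) <= word_norm x + word_norm y)%N.
Proof.
have [v [vS <- vx]] := word_norm_word x.
have [w [wS <- wy]] := word_norm_word y.
apply: word_norm_le; exists (v ++ w); split.
- by rewrite /is_word all_cat; apply/andP.
- by rewrite size_cat.
- by rewrite big_cat vx wy.
Qed.

Lemma prodg_rev_inv (w : seq G) :
  \prod_(s <- rev [seq s^-1 | s <- w]) s = (\prod_(s <- w) s)^-1.
Proof.
elim: w => [|s w IH]; first by rewrite !big_nil invg1.
by rewrite map_cons rev_cons -cats1 big_cat big_seq1 IH big_cons invgM.
Qed.

Lemma word_normV_le x : (word_norm x^-1 <= word_norm x)%N.
Proof.
have [v [vS <- vx]] := word_norm_word x.
apply: word_norm_le; exists (rev [seq s^-1 | s <- v]); split.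
- rewrite /is_word all_rev all_map; apply: sub_all vS => s /=.
  by rewrite invgK orbC.
- by rewrite size_rev size_map.
- by rewrite prodg_rev_inv vx.
Qed.

Lemma word_distxx x : word_dist x x = 0%N.
Proof. by rewrite /word_dist mulVg word_norm1. Qed.

Lemma word_distC_le x y : (word_dist x y <= word_dist y x)%N.
Proof. by have := word_normV_le (y^-1 * x); rewrite invgM invgK. Qed.

Lemma word_dist_triangle y x z :
  (word_dist x z <= word_dist x y + word_dist y z)%N.
Proof.
suff -> : word_dist x z = word_norm ((x^-1 * y) * (y^-1 * z)).
  exact: word_normM.
by rewrite -mulgA mulKVg.
Qed.

Definition gromov_product w x y : rat :=
  (((word_dist x w)%:R + (word_dist y w)%:R - (word_dist x y)%:R) / 2)%R.

Definition hyperbolic_metric : Prop :=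
  exists delta : rat, forall w x y z,
    (Num.min (gromov_product w x y) (gromov_product w y z) - delta
       <= gromov_product w x z)%R.

Definition cayley_adj : rel G :=
  fun x y => (x^-1 * y \in generators S) || (y^-1 * x \in generators S).

(* The vertices that an edge path of the Cayley graph avoiding K joins to x. *)
Definition complement_component (K : {fset G}) x : set G :=
  [set y | exists p : seq G,
     [/\ path cayley_adj x p, last x p = y & all (fun z => z \notin K) (x :: p)]].

Definition one_ended_graph : Prop :=
  forall K : {fset G}, exists! C : set G,
    infinite_set C /\ exists2 x, x \notin K & C = complement_component K x.

(* A geodesic ray of the Cayley graph issuing from the vertex 1 is determined
   by the vertices it visits at integer times. On vertex sequences, uniform
   convergence on compact sets is pointwise convergence for the discrete
   topology of G. *)
Definition geodesic_ray : set {ptws nat -> discrete_topology G} :=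
  [set r | r 0%N = 1 /\
     forall i j : nat, (i <= j)%N -> word_dist (r i) (r j) = (j - i)%N].

Definition asymptotic (r s : geodesic_ray) : bool :=
  `[< exists D : nat, forall i, (word_dist (set_val r i) (set_val s i) <= D)%N >].

Lemma asymptotic_refl : reflexive asymptotic.
Proof. by move=> r; apply/asboolP; exists 0%N => i; rewrite word_distxx. Qed.

Lemma asymptotic_sym : symmetric asymptotic.
Proof.
by move=> r s; apply/asboolP/asboolP => -[D le_D]; exists D => i;
  apply: leq_trans (word_distC_le _ _) (le_D i).
Qed.

Lemma asymptotic_trans : transitive asymptotic.
Proof.
move=> s r t /asboolP[D le_D] /asboolP[E le_E]; apply/asboolP.
exists (D + E)%N => i.
apply: leq_trans (word_dist_triangle (set_val s i) _ _) _.
exact: leq_add.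
Qed.

Canonical asymptotic_equiv : equiv_rel geodesic_ray :=
  EquivRel asymptotic asymptotic_refl asymptotic_sym asymptotic_trans.

Definition gromov_boundary : topologicalType :=
  quotient_topology {eq_quot asymptotic_equiv}%qT.

Definition cut_pair (a b : gromov_boundary) : Prop :=
  a <> b /\ ~ connected (~` [set a; b]).

End WordMetric.

(* Hyperbolicity, one-endedness and the homeomorphism type of the boundary of
   a hyperbolic group do not depend on the generating set. *)
Definition hyperbolic_group (G : groupType) : Prop :=
  exists S : finite_generating_set G, hyperbolic_metric S.

Definition geometrically_rigid (G : groupType) : Prop :=
  exists S : finite_generating_set G,
    one_ended_graph S /\ ~ exists a b : gromov_boundary S, cut_pair a b.

Definition residually_finite (G : groupType) : Prop :=
  forall g : G, g <> 1 ->
    exists (Q : finGroupType) (f : {multiplicative G -> Q}), f g <> 1.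

Record subgroup_type (G : groupType) (H : groupClosed G) := SubgroupElt {
  subgroup_val :> G;
  subgroup_valP : subgroup_val \in H }.

Section SubgroupType.
Variables (G : groupType) (H : groupClosed G).

HB.instance Definition _ := [isSub for @subgroup_val G H].
HB.instance Definition _ := [Choice of subgroup_type H by <:].

Fact subgroup_closed : group_closed (fun x : G => x \in H).
Proof. by split => [|x y xH yH]; [exact: gpred1 | exact: gpredF]. Qed.

HB.instance Definition _ :=
  SubChoice_isSubGroup.Build G (fun x : G => x \in H) (subgroup_type H)
    subgroup_closed.

End SubgroupType.

(* Left cosets: x H = y H iff x^-1 * y \in H. *)
Definition left_coset_representatives (G : groupType) (H : groupClosed G)
    (n : nat) (t : 'I_n -> G) : Prop :=
  forall g : G, exists! i : 'I_n, (t i)^-1 * g \in H.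

(* The value 0 is taken only when no positive power of g lies in H; see
   min_power_inP for H of finite index. *)
Definition min_power_in (G : groupType) (H : groupClosed G) (g : G) : nat :=
  if pselect (exists m, (0 < m)%N && (g ^+ m \in H)) is left ex_m
  then ex_minn ex_m else 0%N.

Lemma min_power_inP (G : groupType) (H : groupClosed G) (n : nat)
    (t : 'I_n -> G) (g : G) : left_coset_representatives H t ->
  (0 < min_power_in H g)%N /\ g ^+ min_power_in H g \in H.
Proof.
move=> tP; rewrite /min_power_in; case: pselect => [h|].
  by case: ex_minnP => m /andP[].
case; pose f (k : 'I_n.+1) := sval (cid (tP (g ^+ k))).
have fP k : (t (f k))^-1 * g ^+ k \in H by rewrite /f; case: cid => i [].
have /injectivePn [a [b nab fab]] : ~~ injectiveb f.
  by apply/negP => /injectiveP /leq_card; rewrite !card_ord ltnn.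
wlog ltab : a b nab fab / (a < b)%N.
  move=> W; case: (ltngtP a b) => [ab|ba|/val_inj e]; first exact: (W a b).
    by apply: (W b a) => //; rewrite eq_sym.
  by rewrite e eqxx in nab.
exists (b - a)%N; rewrite subn_gt0 ltab /=.
have : ((t (f a))^-1 * g ^+ a)^-1 * ((t (f b))^-1 * g ^+ b) \in H.
  by apply: gpredM; [apply: gpredVr; exact: fP | exact: fP].
rewrite fab invgM invgK mulgA mulgK.
by rewrite -{1}(subnKC (ltnW ltab)) expgnDr mulgA mulVg mul1g.
Qed.

Section StableLength.
Variables (R : realType) (G : groupType) (S : finite_generating_set G).

Definition stable_length (g : G) : R :=
  limn (fun n : nat => ((word_norm S (g ^+ n))%:R / n%:R : R)%R).

Variables (H : groupClosed G) (phi : subgroup_type H -> G).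

(* insubd views g ^+ m, which lies in H, as an element of H. *)
Definition stable_length_along (g : G) : R :=
  let m := min_power_in H g in
  let gm := insubd (1 : subgroup_type H) (g ^+ m) in
  (stable_length (phi gm) / m%:R)%R.

Definition average_stable_length (n : nat) (t : 'I_n -> G) (g : G) : R :=
  ((\sum_(i < n) stable_length_along ((t i)^-1 * g * t i)%g) / n%:R)%R.

End StableLength.

(* Main.v *)
(* Let f : G -> G minimise, among the maps equivariant under a monomorphism phi
   of a finite index subgroup H' of G, the energy: the sum over H' \ G and over
   the generators s of d(f(x), f(xs)). If the energy per orbit is huge, then some
   point p of the target lies on so many of the segments [f(x), f(xs)] that the
   set A of the x for which this happens (the leaf of p) has few singular points,
   namely points near which f has three values pairwise separated by p, or from
   which A is seen in three directions at infinity. Elsewhere, p splits the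
   values of f near a point of A into two colours which change only across A. By
   compactness, and because the boundary has no cut pair, one of the two sides is
   thin: it stays in the hull of A, i.e. the points from which A is seen on all
   sides, whose number is at most a constant times |A|. Yu's property A cuts a
   piece of bounded size with small boundary out of the thin side. When no
   element of H' other than 1 is conjugate into a large ball, which residual
   finiteness allows, f can be pushed towards p on the translates of this piece,
   which decreases the energy: contradiction.
   Hence f has bounded energy per orbit. Right multiplication by g^N permutes
   H' \ G, so the average of d(f(x), f(x g^N)) is at most a constant times |g^N|,
   and N -> oo gives the bound on stable lengths. *)

Require Import Defs.
From mathcomp Require Import all_boot all_order all_algebra all_fingroup finmap.
From mathcomp Require Import all_classical all_reals all_analysis.
From mathcomp Require Import zify ring lra.

Set Implicit Arguments.
Unset Strict Implicit.
Unset Printing Implicit Defensive.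

Import Order.TTheory GRing.Theory Num.Theory.
Import numFieldNormedType.Exports.

Local Open Scope quotient_scope.
Local Open Scope classical_set_scope.
Local Open Scope fset_scope.
Local Open Scope group_scope.

(** * Word metrics *)

(** The leaf of [p] grows with the energy, whereas residual finiteness only separates the translates
    of a ball whose radius is fixed before [H], [phi] and [f] are known. Hence [f] cannot be pushed
    on the whole thin side, and a piece of bounded size is needed. The constants are chosen in one
    order: the size [k0] and the weight [T] of the piece come from the group alone, then the depth
    [m] of the push, large against [T], then the separation [M = 2 * m] that defines singular
    points, and last the energy bound. The radius in which singular points are sought must not
    depend on [M]. Compactness yields branching at an uncontrolled scale [k]; so the number [m k] of
    points demanded at scale [k] is prescribed beforehand, growing so fast that the exceptional
    points of all scales form a geometric series. Energies are natural numbers, so minimal maps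
    exist without any limiting process. Hyperbolicity, rigidity and the word norm may come with
    three generating sets; hyperbolicity is moved to the one that carries the boundary, so the
    boundary never changes its model. *)

Section Metric.
Variables (G : groupType) (S : finite_generating_set G).
Local Notation d := (word_dist S).
Implicit Types (x y z g h : G) (r n : nat).

Lemma distC x y : d x y = d y x.
Proof. by apply/eqP; rewrite eqn_leq !word_distC_le. Qed.

Lemma dist_mul2l h x y : d (h * x) (h * y) = d x y.
Proof. by rewrite /word_dist invgM -!mulgA mulKg. Qed.

Lemma dist1g x : d 1 x = word_norm S x.
Proof. by rewrite /word_dist invg1 mul1g. Qed.

Lemma dist_mulr x g : d x (x * g) = word_norm S g.
Proof. by rewrite -{1}(mulg1 x) dist_mul2l dist1g. Qed.

Lemma word_norm_eq0 g : word_norm S g = 0%N -> g = 1.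
Proof.
move=> g0; have [w [_ + <-]] := word_norm_word S g.
by rewrite g0 => /size0nil ->; rewrite big_nil.
Qed.

Lemma dist_eq0 x y : d x y = 0%N -> x = y.
Proof.
by move/word_norm_eq0/(congr1 (fun u => x * u)); rewrite mulKVg mulg1.
Qed.

Definition sgen : {fset G} :=
  (generators S `|` [fset s^-1 | s in generators S])%fset.

Lemma sgenP s : (s \in sgen) = (s \in generators S) || (s^-1 \in generators S).
Proof.
rewrite in_fsetU; congr (_ || _); apply/imfsetP/idP => [[u uS ->]|sS].
  by rewrite invgK.
by exists s^-1 => //; rewrite invgK.
Qed.

Lemma sgenV s : (s^-1 \in sgen) = (s \in sgen).
Proof. by rewrite !sgenP invgK orbC. Qed.

Lemma cayley_adjP x y : cayley_adj S x y = (x^-1 * y \in sgen).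
Proof. by rewrite sgenP /cayley_adj invgM invgK. Qed.

Lemma is_wordP (w : seq G) : is_word S w = all (mem sgen) w.
Proof. by apply: eq_all => s /=; rewrite sgenP. Qed.

Lemma norm_sgen s : s \in sgen -> (word_norm S s <= 1)%N.
Proof.
move=> sS; apply: word_norm_le; exists [:: s]; split=> //.
  by rewrite is_wordP /= andbT.
by rewrite big_seq1.
Qed.

Lemma dist_sgen x s : s \in sgen -> (d x (x * s) <= 1)%N.
Proof. by rewrite dist_mulr; exact: norm_sgen. Qed.

Lemma norm_ltS g n : word_norm S g = n.+1 ->
  exists s h, [/\ s \in sgen, word_norm S h = n & g = s * h].
Proof.
move=> gn; have [[|s w] [wS sw wg]] := word_norm_word S g; first by rewrite gn in sw.
move: wS; rewrite is_wordP /= => /andP[sS wS].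
exists s, (\prod_(u <- w) u); split => //; last by rewrite -wg big_cons.
apply/eqP; rewrite eqn_leq; apply/andP; split.
  apply: word_norm_le; exists w; split=> //; rewrite ?is_wordP //.
  by move: sw; rewrite gn => -[].
rewrite -ltnS -gn -wg big_cons; apply: (leq_trans (word_normM _ _ _)).
by rewrite -add1n leq_add2r norm_sgen.
Qed.

Lemma dist_ltS x y n : d x y = n.+1 -> exists2 s, s \in sgen & d (x * s) y = n.
Proof.
move=> /norm_ltS[s [h [sS hn e]]]; exists s => //.
by rewrite /word_dist invgM -mulgA e mulKg.
Qed.

Lemma dist_between x y n : (n <= d x y)%N ->
  exists z, d x z = n /\ d z y = (d x y - n)%N.
Proof.
elim: n x => [|n IHn] x lenxy.
  by exists x; rewrite word_distxx subn0.
case Em: (d x y) => [|m]; first by rewrite Em in lenxy.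
have [s sS dm] := dist_ltS Em.
have [|z [xz zy]] := IHn (x * s); first by rewrite dm -ltnS -Em.
exists z; split; last by rewrite zy dm subSS.
have h1 := word_dist_triangle S (x * s) x z.
have h2 := word_dist_triangle S z x y.
have h3 := dist_sgen x sS.
lia.
Qed.

Lemma dist_path x y : exists p : nat -> G,
  [/\ p 0%N = x, p (d x y) = y & forall i, (i < d x y)%N ->
     exists2 s, s \in sgen & p i.+1 = p i * s].
Proof.
have [n] := ubnP (d x y); elim: n x => // n IHn x len.
case Em: (d x y) => [|m].
  by exists (fun=> x); split => //; apply: dist_eq0.
have [s sS dm] := dist_ltS Em.
have [|p [p0 pm pS]] := IHn (x * s); first by rewrite dm -ltnS -Em.
exists (fun i => if i is j.+1 then p j else x); split => //.
  by rewrite -dm.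
move=> [|i] lim; first by exists s => //; rewrite p0.
by apply: pS; rewrite dm.
Qed.

Lemma word_normV g : word_norm S g^-1 = word_norm S g.
Proof. by apply/eqP; rewrite eqn_leq word_normV_le -{1}(invgK g) word_normV_le. Qed.

Fixpoint wball1 r : {fset G} :=
  if r is r'.+1 then (wball1 r' `|` [fset a * s | a in wball1 r', s in sgen])%fset
  else [fset 1].

Lemma wball1P r g : (g \in wball1 r) = (word_norm S g <= r)%N.
Proof.
elim: r g => [|r IHr] g.
  rewrite in_fset1 leqn0; apply/eqP/eqP => [->|]; [exact: word_norm1|exact: word_norm_eq0].
rewrite in_fsetU IHr; apply/orP/idP => [[/leqW//|/imfset2P[a ar [s sS ->]]]|].
  apply: (leq_trans (word_normM _ _ _)); rewrite -addn1 leq_add //.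
  - by rewrite -IHr.
  - exact: norm_sgen.
rewrite leq_eqVlt ltnS => /orP[/eqP gr|]; last by left.
right; move: gr; rewrite -word_normV => /norm_ltS[s [h [sS hr gV]]].
rewrite -(invgK g) gV invgM; apply: in_imfset2 => /=; last by rewrite sgenV.
by rewrite IHr word_normV hr.
Qed.

Definition wball x r : {fset G} := [fset x * a | a in wball1 r].

Lemma wballP x r y : (y \in wball x r) = (d x y <= r)%N.
Proof.
apply/imfsetP/idP => [[a ar ->]|xy]; first by rewrite dist_mulr -wball1P.
by exists (x^-1 * y); rewrite /= ?mulKVg // wball1P.
Qed.

Lemma card_wball x r : #|` wball x r| = #|` wball1 r|.
Proof. by rewrite card_imfset //; apply: mulgI. Qed.

Lemma wball1_gt0 r : (0 < #|` wball1 r|)%N.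
Proof.
by rewrite cardfs_gt0; apply/fset0Pn; exists 1; rewrite wball1P word_norm1.
Qed.

(* Twice the Gromov product, so as to stay in nat: the truncated subtraction is
   harmless by the triangle inequality. *)
Definition dgp z x y : nat := (d z x + d z y - d x y)%N.

Lemma gpC z x y : dgp z x y = dgp z y x.
Proof. by rewrite /dgp addnC (distC x). Qed.

Lemma gp_mul2l h z x y : dgp (h * z) (h * x) (h * y) = dgp z x y.
Proof. by rewrite /dgp !dist_mul2l. Qed.

Lemma gpxx z x : dgp z x x = (d z x).*2.
Proof. by rewrite /dgp word_distxx subn0 addnn. Qed.

Definition hyperbolic_with (e : nat) : Prop := forall w x y z,
  (minn (dgp w x y) (dgp w y z) <= dgp w x z + e)%N.

End Metric.

Lemma hyperbolic_metricP (G : groupType) (S : finite_generating_set G) :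
  hyperbolic_metric S -> exists e, hyperbolic_with S e.
Proof.
move=> [delta hd].
pose e := Num.bound `|2 * delta|%R; exists e => w x y z.
have le_e : (2 * delta <= e%:R :> rat)%R.
  exact/ltW/(le_lt_trans (ler_norm _))/(Num.Theory.archi_boundP (normr_ge0 _)).
have gpE a b : (gromov_product S w a b = (dgp S w a b)%:R / 2)%R.
  rewrite /gromov_product /dgp natrB ?natrD ?(distC S a w) ?(distC S b w) //.
  by rewrite (distC S w a); exact: word_dist_triangle.
have := hd w x y z; rewrite !gpE.
have [le1|/ltnW le1] := leqP (dgp S w x y) (dgp S w y z).
  rewrite min_l ?ler_pM2r ?ler_nat // => h.
  by rewrite -(ler_nat rat) natrD; lra.
rewrite min_r ?ler_pM2r ?ler_nat // => h.
by rewrite -(ler_nat rat) natrD; lra.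
Qed.

Ltac pose_sym S a l :=
  lazymatch l with
  | (?l', ?b) => pose proof (distC S a b); pose_sym S a l'
  | ?b => pose proof (distC S a b)
  end.
Ltac pose_tri2 S a b l :=
  lazymatch l with
  | (?l', ?c) => pose proof (word_dist_triangle S a b c);
      pose proof (word_dist_triangle S b a c);
      pose proof (word_dist_triangle S c a b); pose_tri2 S a b l'
  | ?c => pose proof (word_dist_triangle S a b c);
      pose proof (word_dist_triangle S b a c);
      pose proof (word_dist_triangle S c a b)
  end.
Ltac pose_tri1 S a l :=
  lazymatch l with
  | (?l', ?b) => pose_tri2 S a b l'; pose_tri1 S a l'
  | _ => idtac
  end.
(* Adds the symmetry and triangle relations among the listed points. *)
Ltac metric S l :=
  lazymatch l with
  | (?l', ?a) => pose_sym S a l'; pose_tri1 S a l'; metric S l'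
  | _ => idtac
  end.

(** * Gromov products and geodesics *)

Section Hyperbolic.
Variables (G : groupType) (S : finite_generating_set G) (e : nat).
Hypothesis hypS : hyperbolic_with S e.
Local Notation d := (word_dist S).
Local Notation gp := (dgp S).

Lemma four_point w x y z :
  (d w y + d x z <= maxn (d w z + d x y) (d w x + d y z) + e)%N.
Proof.
have := hypS w x y z; rewrite /dgp; metric S (w, x, y, z); lia.
Qed.

(** Each halving of the chain costs one [e], so the loss is only logarithmic in the number of
    points. *)
Lemma gp_chain k n (c : nat -> G) p i : (0 < n <= 2 ^ k)%N -> exists2 j,
  (i <= j < i + n)%N & (gp p (c j) (c j.+1) <= gp p (c i) (c (i + n)) + k * e)%N.
Proof.
elim: k n i => [|k IHk] n i nk.
  have -> : n = 1%N by move: nk; rewrite expn0; lia.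
  by exists i; rewrite ?addn1 ?leqnn ?mul0n ?addn0 //.
have [le_n|lt_n] := leqP n (2 ^ k).
  have [|j ij jk] := IHk n i; first by lia.
  by exists j => //; apply: (leq_trans jk); rewrite leq_add2l leq_mul2r leqnSn orbT.
have e2 : (2 ^ k.+1 = 2 * 2 ^ k)%N by rewrite expnS.
have := hypS p (c i) (c (i + 2 ^ k)%N) (c (i + n)%N).
rewrite geq_min => /orP[le1|le2].
  have [|j ij jk] := IHk (2 ^ k)%N i; first by lia.
  by exists j; lia.
have [|j ij jk] := IHk (n - 2 ^ k)%N (i + 2 ^ k)%N; first by lia.
exists j; first by lia.
by move: jk le2; rewrite -addnA subnKC; lia.
Qed.

Lemma near_geodesic c x y m : (gp m x y <= c)%N ->
  exists2 m', (d x m' + d m' y = d x y)%N & (d m m' <= c + e)%N.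
Proof.
move=> mc; have [m' [m'1 m'2]] := dist_between (geq_minr (d x m) (d x y)).
exists m'; first by rewrite m'1 m'2 subnKC // geq_minr.
by have := four_point m x m' y; move: mc; rewrite /dgp; metric S (x, y, m, m'); lia.
Qed.

(** The coarse centre of a triangle: the point of a geodesic from [x] to [z] at distance the Gromov
    product of [w] and [z] from [x]. The 2 absorbs the rounding of this half-integer. *)
Lemma center w x z : exists m, [/\ (gp m w x <= e + 2)%N,
  (gp m w z <= e + 2)%N & (gp m x z = 0)%N].
Proof.
have lej : (gp x w z %/ 2 <= d x z)%N by rewrite /dgp; metric S (w, x, z); lia.
have [m [m1 m2]] := dist_between lej.
exists m; have := four_point w x m z; move: m1 m2; rewrite /dgp.
by metric S (w, x, z, m); split; lia.
Qed.

End Hyperbolic.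

Lemma dist_geodesic (G : groupType) (S : finite_generating_set G) (x y : G) :
  exists p : nat -> G, [/\ p 0%N = x, p (word_dist S x y) = y &
    forall i j, (i <= j <= word_dist S x y)%N -> word_dist S (p i) (p j) = (j - i)%N].
Proof.
have [p [p0 pn pS]] := dist_path S x y; exists p; split => //.
set n := word_dist S x y in pn pS *.
have le_p i k : (i + k <= n)%N -> (word_dist S (p i) (p (i + k)) <= k)%N.
  elim: k => [|k IHk] ik; first by rewrite addn0 word_distxx.
  have := IHk ltac:(lia); have [|s sS ps] := pS (i + k)%N; first by lia.
  rewrite addnS ps; have := dist_sgen (p (i + k)%N) sS.
  have := word_dist_triangle S (p (i + k)%N) (p i) (p (i + k)%N * s); lia.
move=> i j ijn.
have h1 := le_p 0%N i ltac:(lia); rewrite add0n p0 in h1.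
have h2 := le_p i (j - i)%N ltac:(lia); rewrite subnKC in h2; last by lia.
have h3 := le_p j (n - j)%N ltac:(lia); rewrite subnKC ?pn in h3; last by lia.
have := word_dist_triangle S (p i) x y; have := word_dist_triangle S (p j) (p i) y.
rewrite -/n; lia.
Qed.

Lemma dist_lipschitz (G : groupType) (S T : finite_generating_set G) :
  exists l, forall x y, (word_dist S x y <= l * word_dist T x y)%N.
Proof.
(* The sum is a crude substitute for the largest norm. *)
pose l := (\sum_(s <- enum_fset (sgen T)) word_norm S s)%N; exists l => x y.
have le_l s : s \in sgen T -> (word_norm S s <= l)%N.
  move=> sT; rewrite /l (big_rem s) //=; exact: leq_addr.
have [n En] : exists n, n = word_dist T x y by eexists.
rewrite -En; elim: n x En => [|n IHn] x En.
  by rewrite (dist_eq0 (esym En)) word_distxx.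
have [s sT sn] := dist_ltS (esym En).
have := IHn _ (esym sn); have := le_l _ sT; rewrite -(dist_mulr S x).
have := word_dist_triangle S (x * s) x y; lia.
Qed.

Lemma linear_le_exp c : exists q0, forall q, (q0 <= q)%N -> (c * q.+1 <= 2 ^ q)%N.
Proof.
exists (4 * c)%N => q; elim: q => [|q IHq]; first by lia.
rewrite leq_eqVlt ltnS => /orP[/eqP <-|/IHq]; last by rewrite expnS; lia.
have [->|c0] := posnP c; first by rewrite mul0n.
have lt_exp k : (k < 2 ^ k)%N by exact: ltn_expl.
have : (2 ^ (4 * c) = 2 ^ (2 * c) * 2 ^ (2 * c))%N by rewrite -expnD; congr expn; lia.
have := lt_exp (2 * c)%N; move: (2 ^ (2 * c))%N => u u1 ->.
by nia.
Qed.

(** Linear growth beats logarithmic growth. The choice [k = D %/ c.+1] keeps [k * c] below [D],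
    while [2 ^ k] exceeds [a * D] once [D] is large. *)
Lemma log_bound a b c : exists D0, forall D,
  (forall k, (a * D <= 2 ^ k)%N -> (2 * D <= b + k * c)%N) -> (D <= D0)%N.
Proof.
have [q0 q0P] := linear_le_exp (a * c.+1)%N.
exists (b + q0 * c.+1)%N => D DP; rewrite leqNgt; apply/negP => ltD.
have Dq : (D = D %/ c.+1 * c.+1 + D %% c.+1)%N := divn_eq D c.+1.
have mod_lt : (D %% c.+1 < c.+1)%N by rewrite ltn_mod.
have leqq : (q0 <= D %/ c.+1)%N by rewrite leq_divRL //; lia.
have h1 := q0P _ leqq; have := DP (D %/ c.+1)%N; move: h1 Dq mod_lt leqq.
set q := (D %/ c.+1)%N; set r := (D %% c.+1)%N => h1 h2 h3 h4 h5.
have : (a * D <= 2 ^ q)%N by apply: leq_trans h1; rewrite -mulnA leq_mul2l h2; nia.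
by move/h5; nia.
Qed.

(** * Quasi-geodesics and change of generating set *)

Section TwoGenerators.
Variables (G : groupType) (S T : finite_generating_set G) (e : nat).
Hypothesis hypS : hyperbolic_with S e.
Local Notation d1 := (word_dist S).
Local Notation d2 := (word_dist T).

(* The half of the Morse lemma saying that a geodesic lies close to every
   quasi-geodesic with the same ends. *)
Lemma geodesic_near_quasigeodesic : exists D, forall x y m (p : nat -> G),
    (d1 x m + d1 m y = d1 x y)%N -> p 0%N = x -> p (d2 x y) = y ->
    (forall i j, (i <= j <= d2 x y)%N -> d2 (p i) (p j) = (j - i)%N) ->
  exists2 i, (i <= d2 x y)%N & (d1 m (p i) <= D)%N.
Proof.
have [l1 l1P] := dist_lipschitz S T; have [l2 l2P] := dist_lipschitz T S.
have [D0 D0P] := log_bound (6 * l2)%N (l1 + 2 * e)%N e.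
(* The extra [e] guarantees [2 * e < 2 * D] in the contradictory case, which lets the hyperbolic
   inequalities at [u] be resolved. *)
exists (D0 + e)%N => x y m p mxy p0 pn pG; set n := d2 x y in pn pG *.
(* The largest [D] with [P D] is the worst distance to the path, over all points of all geodesics
   from [x] to [y]; it is attained at [u]. *)
pose P D := `[< exists2 u, (d1 x u + d1 u y = d1 x y)%N &
                 forall i, (i <= n)%N -> (D <= d1 u (p i))%N >].
have P0 : exists D, P D by exists 0%N; apply/asboolP; exists m.
have PM D : P D -> (D <= d1 x y)%N.
  move=> /asboolP[u uxy /(_ 0%N (leq0n _))]; rewrite p0.
  by have := distC S x u; lia.
case: (ex_maxnP P0 PM) => D /asboolP[u uxy uD] Dmax.
have nearP v : (d1 x v + d1 v y = d1 x y)%N ->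
    exists2 i, (i <= n)%N & (d1 v (p i) <= D)%N.
  move=> vxy; apply: contrapT => N.
  suff /Dmax : P D.+1 by rewrite ltnn.
  apply/asboolP; exists v => // i lein; rewrite ltnNge; apply/negP => leD.
  by apply: N; exists i.
suff leD : (D <= D0 + e)%N.
  by have [i lein le] := nearP m mxy; exists i => //; apply: leq_trans leD.
rewrite leqNgt; apply/negP => ltD.
have uD0 := uD 0%N (leq0n _); have uDn := uD n (leqnn _).
rewrite p0 in uD0; rewrite pn in uDn.
(* Go back from [u] by [2 * D] along a geodesic, or to its end, then jump to the path; [z'] and [j]
   are the same on the other side. The path from [p i] to [p j] has length linear in [D] and stays
   at distance at least [D] from [u], although [u] lies almost between its ends: this detour should
   be exponentially long. *)
have [y' [i [lei y'x uy' y'i gy']]] : exists y' i, [/\ (i <= n)%N,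
    (d1 x y' + d1 y' u = d1 x u)%N, (d1 y' u <= 2 * D)%N,
    (d1 y' (p i) <= D)%N & (2 * D <= dgp S u y' (p i))%N].
  have [lea|lta] := leqP (d1 x u) (2 * D).
    exists x, 0%N; rewrite word_distxx p0 word_distxx gpxx; split=> //.
    by lia.
  have [y' [y'1 y'2]] := dist_between (leq_subr (2 * D)%N (d1 x u)).
  have [|i lei ley] := nearP y'.
    by move: y'1 y'2; metric S (x, y, u, y'); lia.
  exists y', i; have := uD i lei; rewrite /dgp.
  by metric S (x, y, u, y', p i); split; lia.
have [z' [j [lej z'x uz' z'j gz']]] : exists z' j, [/\ (j <= n)%N,
    (d1 u z' + d1 z' y = d1 u y)%N, (d1 z' u <= 2 * D)%N,
    (d1 z' (p j) <= D)%N & (2 * D <= dgp S u z' (p j))%N].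
  have [lea|lta] := leqP (d1 u y) (2 * D).
    exists y, n; rewrite word_distxx pn word_distxx gpxx addn0 (distC S y); split=> //.
    by lia.
  have leU : (2 * D <= d1 u y)%N by lia.
  have [z' [z'1 z'2]] := dist_between leU.
  have [|j lej lez] := nearP z'.
    by move: z'1 z'2; metric S (x, y, u, z'); lia.
  exists z', j; have := uD j lej; rewrite /dgp.
  by metric S (x, y, u, z', p j); split; lia.
have gij : (dgp S u (p i) (p j) <= 2 * e)%N.
  have g0 : (dgp S u y' z' = 0)%N.
    by rewrite /dgp; move: y'x z'x uxy; metric S (x, y, u, y', z'); lia.
  have h1 := hypS u y' (p i) z'; have h2 := hypS u (p i) (p j) z'.
  by move: gz' h1 h2; rewrite (gpC S u z') g0; lia.
have lenij : (d2 (p i) (p j) <= 6 * l2 * D)%N.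
  apply: leq_trans (l2P _ _) _; rewrite (mulnC 6) -mulnA leq_mul2l.
  apply/orP; right; metric S (p i, p j, y', z', u); lia.
have step q : (q < n)%N -> (d1 (p q) (p q.+1) <= l1)%N.
  move=> ltq; apply: leq_trans (l1P _ _) _.
  by rewrite pG ?leqnSn //= subSnn muln1.
have key k : (6 * l2 * D <= 2 ^ k)%N -> (2 * D <= l1 + 2 * e + k * e)%N.
  move=> lek.
  wlog leij : i j lei lej gij lenij {y'x uy' y'i gy' z'x uz' z'j gz' y' z'} / (i <= j)%N.
    move=> W; have [le|/ltnW le] := leqP i j; first exact: (W i j).
    by apply: (W j i) => //; rewrite 1?gpC 1?distC.
  rewrite pG in lenij; last by lia.
  have [eij|nij] := eqVneq i j.
    by move: gij (uD _ lei); rewrite eij gpxx; lia.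
  have [|q qij] := @gp_chain _ _ _ hypS k (j - i)%N p u i; first by lia.
  rewrite subnKC // => gq.
  have := uD q ltac:(lia); have := uD q.+1 ltac:(lia); have := step q ltac:(lia).
  by move: gq gij; rewrite /dgp; lia.
by have := D0P _ key; lia.
Qed.

(** Gromov products are distorted by a change of metric, but smallness of [dgp S m x y], that is,
    [m] being almost between [x] and [y], is inherited by [T]. A coarse centre [m] of [w], [x], [z]
    is almost between [x] and [y] or between [y] and [z], and these betweenness relations suffice
    for the inequality in [T]. *)
Lemma hyp_change_generators : exists e', hyperbolic_with T e'.
Proof.
have [D DP] := geodesic_near_quasigeodesic.
have [l lP] := dist_lipschitz T S.
have tr c x y m : (dgp S m x y <= c)%N -> (dgp T m x y <= 2 * (l * (c + e + D)))%N.
  move=> mc; have [m' m'xy mm'] := near_geodesic hypS mc.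
  have [p [p0 pn pG]] := dist_geodesic T x y.
  have [i lei ler] := DP x y m' p m'xy p0 pn pG.
  have e1 : (d2 x (p i) + d2 (p i) y = d2 x y)%N.
    by rewrite -{1}p0 -{1}pn !pG ?lei ?leqnn //; lia.
  have : (d1 m (p i) <= c + e + D)%N by metric S (m, m', p i); lia.
  move=> le; have := lP m (p i); rewrite /dgp.
  have : (l * d1 m (p i) <= l * (c + e + D))%N by rewrite leq_mul2l le orbT.
  by metric T (x, y, m, p i); lia.
pose c1 := (2 * (l * (e + 2 + e + D)))%N; pose c2 := (2 * (l * (e + e + D)))%N.
exists (2 * c1 + c2)%N => w x y z.
have [m [mwx mwz mxz]] := center hypS w x z.
have h1 := tr _ _ _ _ mwx; have h2 := tr _ _ _ _ mwz; rewrite -/c1 in h1 h2.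
have := hypS m x y z; rewrite mxz add0n geq_min => /orP[/tr h|/tr h];
  rewrite -/c2 in h; move: h h1 h2; rewrite /dgp; metric T (w, x, y, z, m); lia.
Qed.

End TwoGenerators.

(** * Counting branch points *)

Lemma fset_le_seq (T : choiceType) (F : {fset T}) (s : seq T) :
  {subset F <= s} -> (#|` F| <= size s)%N.
Proof. by move=> sub; apply: uniq_leq_size => //; apply: fset_uniq. Qed.

Lemma seq_le_fset (T : choiceType) (F : {fset T}) (s : seq T) :
  uniq s -> {subset s <= F} -> (size s <= #|` F|)%N.
Proof. by move=> us sub; apply: uniq_leq_size. Qed.

Section Branching.
Variables (G : groupType) (S : finite_generating_set G) (e : nat).
Hypothesis hypS : hyperbolic_with S e.
Local Notation d := (word_dist S).
Local Notation gp := (dgp S).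

Lemma separated_net r (F : {fset G}) : exists B : seq G,
  [/\ uniq B, {subset B <= F}, {in B &, forall x y, x != y -> (r <= d x y)%N}
    & (#|` F| <= #|` wball1 S r| * size B)%N].
Proof.
have [n] := ubnP #|` F|; elim: n F => // n IHn F ltF.
have [->|[x xF]] := fset_0Vmem F; first by exists [::]; rewrite cardfs0.
have [|B [uB sB rB cB]] := IHn (F `\` wball S x r).
  rewrite ltnS in ltF; apply: leq_trans ltF; apply: fproper_ltn_card.
  rewrite fproperE fsubsetDl /=; apply/fsubsetPn; exists x => //.
  by rewrite in_fsetD wballP word_distxx.
exists (x :: B); split.
- rewrite /= uB andbT; apply/negP => /sB; rewrite in_fsetD wballP word_distxx //.
- by move=> y; rewrite inE => /orP[/eqP->//|/sB]; rewrite in_fsetD => /andP[].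
- move=> y z; rewrite !inE => /orP[/eqP->|yB] /orP[/eqP->|zB].
  + by rewrite eqxx.
  + by move: zB => /sB; rewrite in_fsetD wballP; lia.
  + by move: yB => /sB; rewrite in_fsetD wballP (distC S y); lia.
  + exact: rB.
- have := cardfsID (wball S x r) F.
  have : (#|` F `&` wball S x r| <= #|` wball1 S r|)%N.
    by rewrite -(card_wball S x); apply/fsubset_leq_card/fsubsetIr.
  by rewrite /= mulnS => h <-; exact: leq_add.
Qed.

Section Outward.
Variables (t : nat) (o : G).
Let t1 := (t + e)%N.
Let t2 := (t1 + e)%N.
Let sep := (t2 + e + e + 1)%N.

(** The points [a] and [a1] lie beyond [y] as seen from [o]. Since [z] is not farther from [o] than
    [y] and is well apart from it, [z] sees both of them in the direction of [y]. *)
Lemma outward_through y z a1 a :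
    (d o z <= d o y)%N -> (sep <= d y z)%N ->
    (gp y o a <= t2)%N -> (gp y o a1 <= t2)%N ->
  (t2 < gp z a1 a)%N /\ ((gp z o a1 <= t1)%N -> (gp z o a <= t2)%N).
Proof.
move=> oz yz ga ga1.
have h1 := hypS y o z a; have h2 := hypS y o z a1; have h3 := hypS z a1 y a.
have big : (t2 < gp z a1 a)%N.
  move: h1 h2 h3 ga ga1; rewrite /sep /t2 /t1 /dgp in yz *.
  by metric S (o, y, z, a, a1); lia.
split=> // g1; have := hypS z o a a1; rewrite (gpC _ z a a1).
by move: big g1; rewrite /t2; lia.
Qed.

(* Merging step of the counting argument: the classes of K stay disjoint. *)
Lemma absorb (A : {fset G}) m q (R C : seq G) (K : seq (seq G)) :
    uniq (R ++ flatten K) -> {subset R ++ flatten K <= A} ->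
    uniq C -> {subset C <= A} -> (m <= size C)%N -> {in C, forall c, c \notin R} ->
    (0 < m)%N ->
    (m * (size K + q) <= size (R ++ flatten K))%N ->
  exists k K', [/\ uniq (R ++ k ++ flatten K'),
    {subset R ++ k ++ flatten K' <= A},
    (m * ((size K').+1 + q) <= size (R ++ k ++ flatten K'))%N,
    exists2 c, c \in C & c \in k & {subset K' <= K} /\ (k \in K \/ k = C)].
Proof.
move=> uK sK uC sC mC CR m0 cnt.
have [|nmeet] := boolP (has (mem (flatten K)) C).
  move=> /hasP[c cC /flattenP[k kK ck]].
  have pK : perm_eq (R ++ flatten K) (R ++ k ++ flatten (rem k K)).
    rewrite perm_cat2l -[k ++ _]/(flatten (k :: rem k K)).
    exact/perm_flatten/perm_to_rem.
  exists k, (rem k K); split.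
  - by rewrite -(perm_uniq pK).
  - by move=> a; rewrite -(perm_mem pK); exact: sK.
  - by rewrite -(perm_size pK) size_rem // prednK //; case: (K) kK.
  - by exists c.
  - by split; [exact: mem_rem|left].
exists C, K; split.
- move: uK; rewrite !cat_uniq uC => /and3P[-> nh ->] /=; rewrite andbT.
  apply/andP; split.
    apply/negP => /hasP[a]; rewrite mem_cat => /orP[aC aR|aK aR].
      by have := CR _ aC; rewrite aR.
    by move/negP: nh; apply; apply/hasP; exists a.
  apply/negP => /hasP[a aK aC]; move/negP: nmeet; apply; apply/hasP.
  by exists a.
- move=> a; rewrite !mem_cat => /or3P[aR|/sC//|aK]; apply: sK; rewrite mem_cat.
    by rewrite aR.
  by rewrite aK orbT.
- by move: cnt; rewrite !size_cat; nia.
- by case: (C) mC => [|c s]; [rewrite leqNgt m0|exists c; rewrite mem_head].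
- by split=> //; right.
Qed.

Definition outward_pair (A : {fset G}) m z (C1 C2 : seq G) : Prop :=
  [/\ [/\ uniq C1, {subset C1 <= A} & (m <= size C1)%N],
      [/\ uniq C2, {subset C2 <= A} & (m <= size C2)%N],
      forall a, a \in C1 ++ C2 -> (gp z o a <= t1)%N &
      forall a b, a \in C1 -> b \in C2 -> a != b /\ (gp z a b <= t)%N].

Lemma outward_classes (A : {fset G}) m (B : seq G) : (0 < m)%N -> uniq B ->
    {in B &, forall x y, x != y -> (sep <= d x y)%N} ->
    pairwise (fun x y => d o x <= d o y)%N B ->
    (forall z, z \in B -> exists C1 C2, outward_pair A m z C1 C2) ->
  exists K : seq (seq G), [/\ uniq (flatten K), {subset flatten K <= A},
    (m * (size K + size B) <= size (flatten K))%N &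
    forall k, k \in K -> forall a b, a \in k -> b \in k ->
      exists2 y, y \in B & (gp y o a <= t2)%N /\ (gp y o b <= t2)%N].
Proof.
move=> m0; elim: B => [|z B IHB]; first by exists [::]; split => //; rewrite muln0.
move=> /= /andP[zB uB] sepB /andP[oz oB] out.
have [|||K [uK sK cK iK]] := IHB uB.
- by move=> x y xB yB; apply: sepB; rewrite inE ?xB ?yB orbT.
- by [].
- by move=> x xB; apply: out; rewrite inE xB orbT.
have [C1 [C2 [[u1 s1 m1] [u2 s2 m2] outC cross]]] := out z (mem_head _ _).
have zy y : y \in B -> (d o z <= d o y)%N /\ (sep <= d y z)%N.
  move=> yB; split; first exact: (allP oz).
  apply: sepB; rewrite ?inE ?eqxx ?yB ?orbT //.
  by apply: contraNneq zB => <-.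
(* A class meeting an outward set of z consists of points outward from z, and
   meets only one of the two outward sets. *)
have old k a1 : k \in K -> a1 \in k ->
    forall a, a \in k -> (t2 < gp z a1 a)%N \/ a = a1.
  move=> kK a1k a ak; have [y yB [g1 g2]] := iK k kK _ _ a1k ak.
  have [oy yz] := zy y yB.
  by left; have [] := @outward_through y z a1 a oy yz g2 g1.
have oldout k a1 : k \in K -> a1 \in k -> (gp z o a1 <= t1)%N ->
    forall a, a \in k -> (gp z o a <= t2)%N.
  move=> kK a1k ga1 a ak; have [y yB [g1 g2]] := iK k kK _ _ a1k ak.
  have [oy yz] := zy y yB.
  by have [_ ->] := @outward_through y z a1 a oy yz g2 g1.
have out1 C k c : {subset C <= C1 ++ C2} -> c \in C -> c \in k ->
    (k \in K \/ k = C) -> forall a, a \in k -> (gp z o a <= t2)%N.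
  move=> sC cC ck [kK|->] a ak; first by apply: (oldout k c kK) => //; exact/outC/sC.
  by apply: (leq_trans (outC _ (sC _ ak))); exact: leq_addr.
have [k1 [K1 [uk1 sk1 ck1 [c1 c1C c1k] [sK1 k1or]]]] :=
  @absorb A m (size B) [::] C1 K uK sK u1 s1 m1 (fun _ _ => isT) m0 cK.
(* An old class lies in a single direction from [z], so it cannot meet both [C1] and [C2]. *)
have C2k1 : {in C2, forall c, c \notin k1}.
  move=> c cC2; apply/negP => ck; case: k1or => [k1K|ek].
    have [ne le] := cross _ _ c1C cC2.
    case: (old k1 c1 k1K c1k c ck) => [lt|ec]; last by rewrite ec eqxx in ne.
    by move: lt le; rewrite /t2 /t1; clear; lia.
  by rewrite ek in ck; have [] := cross _ _ ck cC2; rewrite eqxx.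
have uk1' : uniq (k1 ++ flatten K1) by [].
have ck1' : (m * (size K1 + (1 + size B)) <= size (k1 ++ flatten K1))%N.
  by move: ck1; rewrite /= addnA addn1.
have [k2 [K2 [uk2 sk2 ck2 [c2 c2C c2k] [sK2 k2or]]]] :=
  @absorb A m (1 + size B) k1 C2 K1 uk1' sk1 u2 s2 m2 C2k1 m0 ck1'.
exists ((k1 ++ k2) :: K2); split.
- by rewrite /= -catA.
- by move=> a; rewrite /= -catA; exact: sk2.
- by move: ck2; rewrite /= -catA add1n.
move=> k; rewrite inE => /orP[/eqP-> a b|kK2 a b ak bk]; last first.
  have [y yB gy] := iK k (sK1 _ (sK2 _ kK2)) a b ak bk.
  by exists y => //; rewrite inE yB orbT.
have k2or' : k2 \in K \/ k2 = C2 by case: k2or => [/sK1|]; [left|right].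
have outk a' : a' \in k1 ++ k2 -> (gp z o a' <= t2)%N.
  rewrite mem_cat => /orP[]; [apply: (out1 C1 k1 c1)|apply: (out1 C2 k2 c2)] => //.
    by move=> x; rewrite mem_cat => ->.
  by move=> x; rewrite mem_cat => ->; rewrite orbT.
by move=> /outk ga /outk gb; exists z; rewrite ?mem_head.
Qed.

End Outward.

Definition branching t m (A : set G) z : Prop := exists C : 'I_3 -> seq G,
  (forall i, [/\ uniq (C i), forall a, a \in C i -> A a & (m <= size (C i))%N]) /\
  forall i j a b, i != j -> a \in C i -> b \in C j -> a != b /\ (gp z a b <= t)%N.

(** At most one of the three directions at [z] faces [o]; the other two point away from it. *)
Lemma branching_outward t o m (A : {fset G}) z : branching t m [set` A] z ->
  exists C1 C2, outward_pair t o A m z C1 C2.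
Proof.
move=> [C [CA cross]].
have [i0 out] : exists i0, forall i a, i != i0 -> a \in C i -> (gp z o a <= t + e)%N.
  have [[i0 [a0 [a0C /negP gt]]]|N] := pselect (exists i0 a0,
      a0 \in C i0 /\ ~~ (gp z o a0 <= t + e)%N).
    exists i0 => i a ni aC; have [_ le] := cross _ _ _ _ ni aC a0C.
    by have := hypS z a o a0; rewrite (gpC _ z a); lia.
  exists ord0 => i a _ aC; apply: contrapT => /negP nle.
  by apply: N; exists i, a.
have [i1 [i2 [n1 n2 n12]]] : exists i1 i2, [/\ i1 != i0, i2 != i0 & i1 != i2].
  exists (i0 + 1)%R, (i0 + 2)%R.
  by case: i0 {out} => [[|[|[]]]] //.
exists (C i1), (C i2); split=> //.
  by move=> a; rewrite mem_cat => /orP[]; exact: out.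
by move=> a b; exact: cross.
Qed.

Lemma card_branching t : exists c, forall (A F : {fset G}) m, (0 < m)%N ->
  (forall z, z \in F -> branching t m [set` A] z) -> (#|` F| * m <= c * #|` A|)%N.
Proof.
(* This is the separation required by [outward_classes]; passing to a net costs the volume of a ball
   of this radius. *)
pose s := (t + e + e + e + e + 1)%N.
exists #|` wball1 S s| => A F m m0 FP.
have [B [uB sB sepB cB]] := separated_net s F.
pose r := fun x y => (d 1 x <= d 1 y)%N.
have rtot : total r by move=> x y; exact: leq_total.
have rtr : transitive r by move=> x y z; exact: leq_trans.
have pB := perm_sort r B.
have [||||K [uK sK cK _]] := @outward_classes t 1 A m (sort r B) m0.
- by rewrite sort_uniq.
- by move=> x y; rewrite !mem_sort; exact: sepB.
- by rewrite -sorted_pairwise // sort_sorted.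
- by move=> z; rewrite mem_sort => /sB /FP; exact: branching_outward.
have : (m * size B <= #|` A|)%N.
  apply: leq_trans (seq_le_fset uK sK); apply: leq_trans cK.
  by rewrite size_sort leq_mul2l leq_addl orbT.
nia.
Qed.

End Branching.

(** * Rays, boundary and cut pairs *)

Lemma ultra_limit (T : eqType) (F : set_system nat) (UF : UltraFilter F)
    (s : seq T) (u : nat -> T) :
  (forall n, u n \in s) -> exists t, F [set n | u n = t].
Proof.
move=> us; suff : F [set n | u n \in s] -> exists t, F [set n | u n = t].
  by apply; apply: filterS filterT => n _; exact: us.
elim: s {us} => [|t s IHs] Fs.
  by exfalso; apply: (filter_not_empty F); apply: filterS Fs.
have [Ft|Fnt] := in_ultra_setVsetC [set n | u n = t] UF; first by exists t.
apply: IHs; apply: filterS (filterI Fs Fnt) => n /= [].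
by rewrite inE => /orP[/eqP|].
Qed.

Lemma free_ultrafilter : exists2 F : set_system nat, UltraFilter F &
  forall m, F [set n | (m <= n)%N].
Proof.
have [F [UF sF]] := @ultraFilterLemma nat \oo _; exists F => // m.
by apply: sF; exists m.
Qed.

Section Boundary.
Variables (G : groupType) (S : finite_generating_set G) (e : nat).
Hypothesis hypS : hyperbolic_with S e.
Local Notation d := (word_dist S).
Local Notation gp := (dgp S).

Definition is_ray v (r : nat -> G) : Prop :=
  r 0%N = v /\ forall i j, (i <= j)%N -> d (r i) (r j) = (j - i)%N.

Lemma is_ray_dist v r i : is_ray v r -> d v (r i) = i.
Proof. by move=> [<- rG]; rewrite rG ?subn0. Qed.

Lemma is_ray_mul h v r : is_ray v r -> is_ray (h * v) (fun i => h * r i).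
Proof. by move=> [r0 rG]; split; [rewrite r0|move=> i j; rewrite dist_mul2l; exact: rG]. Qed.

(** Arzela-Ascoli by an ultrafilter: [r j] is the vertex visited at time [j] by almost all geodesics
    from [v] to [u n]. Geodesics too short to have a time [j] get the default [v]; they form a
    negligible set because [u] goes to infinity. *)
Lemma ray_limit (F : set_system nat) (UF : UltraFilter F) v (u : nat -> G) c :
    (forall m, F [set n | (m <= n)%N]) -> (forall n, (n <= d v (u n) + c)%N) ->
  exists2 r, is_ray v r &
    forall j, F [set n | (d v (r j) + d (r j) (u n) = d v (u n))%N].
Proof.
move=> Foo uc.
have /choice[p pP] : forall n, exists p : nat -> G, [/\ p 0%N = v, p (d v (u n)) = u n &
    forall i j, (i <= j <= d v (u n))%N -> d (p i) (p j) = (j - i)%N].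
  by move=> n; exact: dist_geodesic.
pose q j n := if (j <= d v (u n))%N then p n j else v.
have qb j n : q j n \in enum_fset (wball S v j).
  rewrite /q; case: ifP => [le|_]; rewrite wballP ?word_distxx //.
  have [p0 _ pG] := pP n; have := pG 0%N j; rewrite p0 subn0 leq0n /= le; by move=> ->.
have /choice[r rP] : forall j, exists t, F [set n | q j n = t].
  by move=> j; exact: ultra_limit (qb j).
have ok j : F [set n | q j n = r j /\ (j <= d v (u n))%N].
  apply: filterS (filterI (rP j) (Foo (j + c)%N)) => n [/= -> h]; split=> //.
  by have := uc n; lia.
have qE j n : (j <= d v (u n))%N -> q j n = p n j by move=> h; rewrite /q h.
exists r.
  split.
    have [n [<- h]] := filter_ex (ok 0%N); rewrite qE //.
    by have [-> _ _] := pP n.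
  move=> i j ij; have [n [[<- h1] [<- h2]]] := filter_ex (filterI (ok i) (ok j)).
  by rewrite !qE //; have [_ _ pG] := pP n; rewrite pG ?ij.
move=> j; apply: filterS (ok j) => n /= [<- h]; rewrite qE //.
have [p0 pn pG] := pP n; have := pG 0%N j; have := pG j (d v (u n)).
by rewrite p0 pn subn0 leqnn andbT leq0n /= => /(_ h) -> /(_ h) ->; rewrite subnKC.
Qed.

Lemma gp_between v p q a b : (d v p + d p a = d v a)%N -> (d v q + d q b = d v b)%N ->
  (gp v p q <= gp v a b)%N.
Proof. by move=> pa qb; rewrite /dgp; metric S (v, p, q, a, b); lia. Qed.

Lemma gp_ray v r i a : is_ray v r -> forall j, (i <= j)%N -> (gp v a (r i) <= gp v a (r j))%N.
Proof.
move=> rr j ij; apply: gp_between; rewrite ?word_distxx ?addn0 //.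
by rewrite !(is_ray_dist _ rr); have [_ ->] := rr; rewrite ?subnKC.
Qed.

Definition asym (r s : nat -> G) : Prop := exists D, forall i, (d (r i) (s i) <= D)%N.

Lemma asym_sym r s : asym r s -> asym s r.
Proof. by move=> [D rs]; exists D => i; rewrite distC. Qed.

Lemma asym_trans r s t : asym r s -> asym s t -> asym r t.
Proof.
move=> [D rs] [E st]; exists (D + E)%N => i.
exact: leq_trans (word_dist_triangle S _ _ _) (leq_add (rs i) (st i)).
Qed.

Lemma ray_change_base v s : is_ray v s -> exists2 r, is_ray 1 r & asym r s.
Proof.
move=> rs; have [F UF Foo] := free_ultrafilter.
have [|r rr rF] := @ray_limit F UF 1 s (d 1 v) Foo.
  by move=> n; have := is_ray_dist n rs; metric S (1 : G, v, s n); lia.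
exists r => //; exists (d 1%g v + 2 * e)%N => j.
have [n [/= bet jn]] := filter_ex (filterI (rF j) (Foo (j + d 1%g v)%N)).
have := is_ray_dist j rr; have := is_ray_dist n rs; have := is_ray_dist j rs.
have [_ sG] := rs; have sjn := sG j n ltac:(lia).
have h1 := hypS (s n) (r j) 1 v; have h2 := hypS (s n) (r j) v (s j).
move: bet h1 h2; rewrite /dgp; metric S (1 : G, v, r j, s j, s n); lia.
Qed.

(** Rays from 1 with unbounded Gromov products stay within [2 * e] of each other forever. *)
Lemma not_asym r s : is_ray 1 r -> is_ray 1 s -> ~ asym r s ->
  exists t, forall i j, (gp 1 (r i) (s j) <= t)%N.
Proof.
move=> rr rs nrs; apply: contrapT => N; apply: nrs; exists (2 * e)%N => n.
have [i [j ij]] : exists i j, (2 * n + 2 * e < gp 1%g (r i) (s j))%N.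
  apply: contrapT => M; apply: N; exists (2 * n + 2 * e)%N => i j.
  by rewrite leqNgt; apply/negP => lt; apply: M; exists i, j.
have leni : (n <= i)%N.
  move: ij; rewrite /dgp; have := is_ray_dist i rr; have := is_ray_dist j rs.
  by metric S (1 : G, r i, s j); lia.
have lenj : (n <= j)%N.
  move: ij; rewrite /dgp; have := is_ray_dist i rr; have := is_ray_dist j rs.
  by metric S (1 : G, r i, s j); lia.
have h1 := hypS 1 (r n) (r i) (s j); have h2 := hypS 1 (r n) (s j) (s n).
have [_ rG] := rr; have [_ sG] := rs.
have := rG _ _ leni; have := sG _ _ lenj.
have := is_ray_dist n rr; have := is_ray_dist n rs.
have := is_ray_dist i rr; have := is_ray_dist j rs.
by move: ij h1 h2; rewrite /dgp; metric S (1 : G, r n, r i, s j, s n); lia.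
Qed.

Lemma bounded_not_asym r s t : is_ray 1 r -> is_ray 1 s ->
  (forall n, (gp 1 (r n) (s n) <= t)%N) -> ~ asym r s.
Proof.
move=> rr rs bd [D rsD]; have := bd (D + t).+1; have := rsD (D + t).+1.
have := is_ray_dist (D + t).+1 rr; have := is_ray_dist (D + t).+1 rs.
by rewrite /dgp; lia.
Qed.

(** The endpoint of [r] is not a limit point of [A] in the boundary. *)
Definition escapes (A : set G) (r : nat -> G) : Prop :=
  exists N, forall a n, A a -> (gp 1 a (r n) <= N)%N.

(** Escaping is an open condition: agreement at one late time is enough. This makes the colour
    classes on the boundary open. *)
Lemma free_perturb (A : set G) r r' N j : is_ray 1 r -> is_ray 1 r' ->
    (forall a n, A a -> (gp 1 a (r n) <= N)%N) -> (N + e < j)%N -> r' j = r j ->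
  forall a n, A a -> (gp 1 a (r' n) <= N + e)%N.
Proof.
move=> rr rr' rN ltj ej a n Aa.
have aj := rN a j Aa.
have [le|lt] := leqP n j.
  by have := gp_ray a rr' le; rewrite ej; lia.
have := hypS 1 a (r' n) (r j); have [_ rG] := rr'.
have := rG _ _ (ltnW lt); have := is_ray_dist n rr'; have := is_ray_dist j rr'.
rewrite ej (distC S (r j)); move: aj; rewrite /dgp; metric S (1 : G, a, r' n, r j); lia.
Qed.

Section Colouring.
Variables (A : set G) (col : G -> bool).
Hypothesis colA : forall u s, s \in sgen S -> col u != col (u * s) -> A u.

Lemma col_path x y : (forall z, (d x z <= d x y)%N -> ~ A z) -> col x = col y.
Proof.
have [n] := ubnP (d x y); elim: n y => // n IHn y lt nA.
case Em: (d x y) => [|m]; first by rewrite (dist_eq0 Em).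
have [s sS ys] : exists2 s, s \in sgen S & d (y * s) x = m.
  by apply: dist_ltS; rewrite distC.
rewrite (IHn (y * s)).
- apply/eqP; apply: contrapT => /negP ne; rewrite eq_sym in ne.
  by apply: (nA y (leqnn _)); exact: colA sS ne.
- by rewrite distC ys -ltnS -Em.
- by move=> z; rewrite [d x (y * s)]distC ys => le; apply: nA; rewrite Em ltnW.
Qed.

Definition eventually_col (c : bool) (r : nat -> G) : Prop :=
  exists n0, forall n, (n0 <= n)%N -> col (r n) = c.

Lemma free_col r N n0 : is_ray 1 r -> (forall a n, A a -> (gp 1 a (r n) <= N)%N) ->
  (N < n0)%N -> forall n, (n0 < n)%N -> col (r n) = col (r n0.+1).
Proof.
move=> rr rN ltN; elim=> // n IHn; rewrite ltnS leq_eqVlt => /orP[/eqP->//|lt].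
rewrite -(IHn lt); apply/esym/col_path => z.
have [_ rG] := rr; rewrite rG ?leqnSn // subSnn => zn Az.
have := rN z n Az; have := is_ray_dist n rr.
by rewrite /dgp; metric S (1 : G, z, r n); lia.
Qed.

Lemma free_eventually r : is_ray 1 r -> escapes A r -> exists c, eventually_col c r.
Proof.
move=> rr [N rN]; exists (col (r N.+2)), N.+2 => n lt.
exact: (free_col rr rN (ltnSn N)).
Qed.

Lemma eventually_col_asym r s c : is_ray 1 r -> is_ray 1 s -> escapes A r -> asym r s ->
  eventually_col c r -> eventually_col c s.
Proof.
move=> rr rs [N rN] [D rsD] [n0 rc]; exists (n0 + N + D).+1 => n ltn.
rewrite -(rc n); last by lia.
apply/esym/col_path => z zn Az; have := rN z n Az; have := rsD n.
have := is_ray_dist n rr; move: zn; rewrite /dgp; metric S (1 : G, z, r n, s n); lia.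
Qed.

End Colouring.

(** In the quotient topology it suffices that the preimage of [U] among rays is a union of
    cylinders, each prescribing one value [r j]. *)
Lemma open_boundary (U : set (gromov_boundary S)) :
  (forall r : geodesic_ray S, U (\pi_(gromov_boundary S) r) -> exists j,
     forall r' : geodesic_ray S, set_val r' j = set_val r j ->
       U (\pi_(gromov_boundary S) r')) -> open U.
Proof.
move=> UP.
pose V : set (geodesic_ray S) := \pi_(gromov_boundary S) @^-1` U.
suff : open V by [].
have -> : V = set_val @^-1` (\bigcup_(jg in [set jg : nat * G |
    forall r' : geodesic_ray S, set_val r' jg.1 = jg.2 -> V r'])
    [set f : {ptws nat -> discrete_topology G} | f jg.1 = jg.2]).
  apply/seteqP; split=> [r Vr|r [[j g] /= jgP e1]]; last exact: jgP.
  by have [j jP] := UP r Vr; exists (j, set_val r j) => //= r' /jP.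
apply: open_comp => [r _|]; first exact: initial_continuous.
apply: bigcup_open => -[j g] _ /=.
rewrite (_ : [set f | _] = @proj nat (fun=> discrete_topology G) j @^-1` [set g]) //.
apply: open_comp => [f _|]; first exact: proj_continuous.
exact: discrete_open.
Qed.

Lemma asymptoticP (r s : geodesic_ray S) :
  \pi_(gromov_boundary S) r = \pi_(gromov_boundary S) s <-> asym (set_val r) (set_val s).
Proof.
split=> [/eqquotP/asboolP//|rs]; apply/eqquotP/asboolP; exact: rs.
Qed.

Lemma is_ray_geodesic r : is_ray 1 r -> exists r' : geodesic_ray S, set_val r' = r.
Proof.
move=> rr; have rin : r \in (geodesic_ray S : set {ptws nat -> discrete_topology G}).
  by rewrite inE.
by exists (SigSub rin).
Qed.

Lemma geodesic_isray (r : geodesic_ray S) : is_ray 1 (set_val r).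
Proof. exact: set_valP. Qed.

(** Away from the ends of [a] and [b] every ray has an eventual colour, and the two colours define
    disjoint open sets of the boundary, made nonempty by [r0] and [r1]. *)
Lemma cut_pair_of_colouring (A : set G) (col : G -> bool) (a b r0 r1 : nat -> G) :
    (forall u s, s \in sgen S -> col u != col (u * s) -> A u) ->
    is_ray 1 a -> is_ray 1 b -> is_ray 1 r0 -> is_ray 1 r1 -> ~ asym a b ->
    (forall r, is_ray 1 r -> ~ asym a r -> ~ asym b r -> escapes A r) ->
    [/\ ~ asym a r0, ~ asym b r0, ~ asym a r1 & ~ asym b r1] ->
    eventually_col col false r0 -> eventually_col col true r1 ->
  exists a' b' : gromov_boundary S, cut_pair a' b'.
Proof.
move=> colA ra rb rr0 rr1 nab freeA [na0 nb0 na1 nb1] c0 c1.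
have [a' a'E] := is_ray_geodesic ra; have [b' b'E] := is_ray_geodesic rb.
pose pi := \pi_(gromov_boundary S).
exists (pi a'), (pi b'); split.
  by move/asymptoticP; rewrite a'E b'E.
pose O c : set (gromov_boundary S) := [set q | exists r : geodesic_ray S,
  [/\ q = pi r, ~ asym a (set_val r), ~ asym b (set_val r) & eventually_col col c (set_val r)]].
have OP c (r : geodesic_ray S) : O c (pi r) <->
    [/\ ~ asym a (set_val r), ~ asym b (set_val r) & eventually_col col c (set_val r)].
  split=> [[r' [/asymptoticP rr' nar nbr cr]]|[nar nbr cr]]; last by exists r.
  have nar' : ~ asym a (set_val r) by move/asym_trans => /(_ _ rr').
  have nbr' : ~ asym b (set_val r) by move/asym_trans => /(_ _ rr').
  split=> //; apply: (eventually_col_asym colA _ _ _ (asym_sym rr') cr).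
  - exact: geodesic_isray.
  - exact: geodesic_isray.
  - by apply: freeA => //; exact: geodesic_isray.
have openO c : open (O c).
  apply: open_boundary => r /OP[nar nbr cr].
  have rr := geodesic_isray r.
  (* With [a] and [b] adjoined, a single perturbation argument keeps nearby rays both escaping from
     [A] and non-asymptotic to [a] and [b]. *)
  pose A' : set G := (A `|` (range a `|` range b))%classic.
  have [N rN] : escapes A' (set_val r).
    have [N1 rN1] := freeA _ rr nar nbr.
    have [N2 rN2] := not_asym ra rr nar; have [N3 rN3] := not_asym rb rr nbr.
    exists (N1 + N2 + N3)%N => x n [/(rN1 _ n)|[[i _ <-]|[i _ <-]]].
    + by lia.
    + by have := rN2 i n; lia.
    + by have := rN3 i n; lia.
  have [n0 rc] := cr; pose j := (N + e + n0).+2.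
  exists j => r' rj; have rr' := geodesic_isray r'.
  have ltj : (N + e < j)%N by rewrite /j; lia.
  have rN' := free_perturb rr rr' rN ltj rj.
  apply/OP; split.
  - by apply: (bounded_not_asym (t := (N + e)%N) ra rr') => n; apply: rN'; right; left; exists n.
  - by apply: (bounded_not_asym (t := (N + e)%N) rb rr') => n; apply: rN'; right; right; exists n.
  - exists j => n jn.
    have f1 := @free_col A col colA (set_val r') (N + e) (N + e + n0).+1 rr' _ (leq_addr _ _).
    rewrite (f1 (fun x m Ax => rN' x m (or_introl Ax)) n) //.
    by rewrite -/j rj; apply: rc; rewrite /j; lia.
have Ocover : (~` [set pi a'; pi b'] = O false `|` O true)%classic.
  apply/seteqP; split=> q.
    have [r ->] : exists r, q = pi r by elim/quotW: q => r; exists r.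
    move=> nq; have rr := geodesic_isray r.
    have nar : ~ asym a (set_val r).
      by move=> ar; apply: nq; left; apply/asymptoticP/asym_sym; rewrite a'E.
    have nbr : ~ asym b (set_val r).
      by move=> ar; apply: nq; right; apply/asymptoticP/asym_sym; rewrite b'E.
    have [[] rc] := free_eventually colA rr (freeA _ rr nar nbr); [right|left]; exact/OP.
  by case=> -[r [-> nar nbr _]] [] /asymptoticP /asym_sym; rewrite ?a'E ?b'E.
have disj q : O false q -> O true q -> False.
  move=> [r [-> nar nbr [n0 r0c]]] /OP[_ _ [n1 r1c]].
  by have := r0c (n0 + n1)%N (leq_addr _ _); rewrite r1c ?leq_addl.
move=> /(_ (O false)) conn.
have [r0' r0'E] := is_ray_geodesic rr0; have [r1' r1'E] := is_ray_geodesic rr1.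
have O0 : O false (pi r0') by apply/OP; rewrite r0'E.
have O1 : O true (pi r1') by apply/OP; rewrite r1'E.
have : O false = ~` [set pi a'; pi b'].
  apply: conn; first by exists (pi r0').
    by exists (O false) => //; rewrite Ocover; apply/seteqP; split=> q; [split=> //; left|case].
  exists (~` (O true)); first exact: open_closedC.
  rewrite Ocover; apply/seteqP; split=> q; first by move=> Oq; split; [left|move/(disj _ Oq)].
  by case=> -[].
rewrite Ocover => E; apply: (disj (pi r1')) => //.
by rewrite E; right.
Qed.

End Boundary.

Lemma filter_forall_seq (T : eqType) (F : set_system nat) (FF : Filter F)
    (s : seq T) (P : T -> nat -> Prop) :
  (forall a, a \in s -> F [set n | P a n]) ->
  F [set n | forall a, a \in s -> P a n].
Proof.
elim: s => [|b s IHs] Ps; first by apply: filterS filterT.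
have Fs : F [set n | forall a, a \in s -> P a n].
  by apply: IHs => a ains; apply: Ps; rewrite inE ains orbT.
apply: filterS (filterI (Ps b (mem_head _ _)) Fs) => n [/= Pb Pn] a.
by rewrite inE => /orP[/eqP->|/Pn].
Qed.

Lemma path_switch (T : eqType) (R : rel T) (P Q : T -> Prop) x p :
    path R x p -> P x -> ~ P (last x p) -> (forall z, z \in x :: p -> Q z) ->
  exists w w', [/\ R w w', Q w, Q w', P w & ~ P w'].
Proof.
elim: p x => [|y p IHp] x //= /andP[Rxy pp] Px nP Qxp.
have [Py|nPy] := pselect (P y).
  by apply: (IHp y) => // z zp; apply: Qxp; rewrite inE zp orbT.
by exists x, y; split=> //; apply: Qxp; rewrite !inE eqxx ?orbT.
Qed.

(** * Rays of a one-ended hyperbolic group *)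

Section Rays.
Variables (G : groupType) (S : finite_generating_set G) (e : nat).
Hypothesis hypS : hyperbolic_with S e.
Local Notation d := (word_dist S).
Local Notation gp := (dgp S).

Lemma infinite_unbounded (C : set G) :
  infinite_set C <-> forall n, exists2 g, C g & (n < d 1 g)%N.
Proof.
split=> [infC n|unb /finite_seqP[s Cs]].
  apply: contrapT => N; apply: infC.
  apply: (@sub_finite_set _ _ [set` wball S 1 n]); last exact: finite_fset.
  move=> g Cg /=; rewrite wballP leqNgt; apply/negP => lt; apply: N.
  by exists g.
have [g] := unb (\sum_(h <- s) d 1%g h)%N; rewrite Cs /= => gs.
by rewrite (big_rem g) //= ltnNge leq_addr.
Qed.

Lemma unbounded_seq (Q : set G) : (forall n, exists2 g, Q g & (n < d 1 g)%N) ->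
  forall m, exists s : seq G, [/\ uniq s, size s = m & forall a, a \in s -> Q a].
Proof.
move=> unb; elim=> [|m [s [us sm sQ]]]; first by exists [::].
have [g Qg lt] := unb (\sum_(h <- s) d 1%g h)%N; exists (g :: s); split.
- rewrite /= us andbT; apply/negP => gs; move: lt.
  by rewrite (big_rem g) //= ltnNge leq_addr.
- by rewrite /= sm.
- by move=> a; rewrite inE => /orP[/eqP->|/sQ].
Qed.

Section OneEnded.
Hypothesis one_ended : one_ended_graph S.

Lemma opposite_rays : exists a b, [/\ is_ray S 1 a, is_ray S 1 b &
  forall i j, gp 1 (a i) (b j) = 0%N].
Proof.
have infG : infinite_set [set: G].
  have [C [[infC _] _]] := one_ended fset0.
  by move/(@sub_finite_set _ C setT (fun _ _ => I)).
have /choice[p pP] : forall n, exists ab : G * G,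
    [/\ d 1 ab.1 = n, d 1 ab.2 = n & d ab.1 ab.2 = (n + n)%N].
  move=> n; have [g _ lt] := (infinite_unbounded _).1 infG (n + n)%N.
  have [q [q0 qn qG]] := dist_geodesic S 1 g.
  (* A geodesic of length [n + n] is translated so that its midpoint becomes 1. *)
  exists ((q n)^-1 * q 0%N, (q n)^-1 * q (n + n)%N) => /=.
  rewrite -(mulVg (q n)) !dist_mul2l (distC S (q n) (q 0%N)).
  by split; rewrite qG; lia.
have [F UF Foo] := free_ultrafilter.
have [|a ra aF] := @ray_limit _ S F UF 1 (fun n => (p n).1) 0 Foo.
  by move=> n; have [-> _ _] := pP n; rewrite addn0.
have [|b rb bF] := @ray_limit _ S F UF 1 (fun n => (p n).2) 0 Foo.
  by move=> n; have [_ -> _] := pP n; rewrite addn0.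
exists a, b; split=> // i j.
have [n [/= ai bj]] := filter_ex (filterI (aF i) (bF j)).
have := gp_between ai bj; have [p1 p2 p12] := pP n.
by rewrite {2}/dgp p1 p2 p12 subnn leqn0 => /eqP.
Qed.

Lemma ray_component r n : is_ray S 1 r ->
  infinite_set (complement_component S (wball S 1 n) (r n.+1)).
Proof.
move=> rr; apply/infinite_unbounded => N.
exists (r (n.+1 + N)%N); last by rewrite (is_ray_dist _ rr); lia.
exists [seq r i | i <- iota n.+2 N]; split.
- elim: N (n.+1) => [|N IHN] k //=; rewrite IHN andbT cayley_adjP.
  have [_ rG] := rr; have /norm_ltS[s [h [sS /word_norm_eq0-> ->]]] :
    word_norm S ((r k)^-1 * r k.+1) = 1%N.
    by have := rG k k.+1 (leqnSn _); rewrite subSnn.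
  by rewrite mulg1.
- elim: N (n.+1) => [|N IHN] k /=; first by rewrite addn0.
  by rewrite IHN addSnnS.
- rewrite -[_ :: _]/[seq r i | i <- iota n.+1 N.+1].
  apply/allP => z /mapP[i]; rewrite mem_iota => /andP[lti _] ->.
  by rewrite wballP (is_ray_dist _ rr) -ltnNge.
Qed.

(** With only two directions, all far points would be on the side of [a] or on the side of [b].
    One-endedness joins these sides by a path outside a large ball; one of its edges would then
    change side, although its far away endpoints are seen from 1 in the same direction. *)
Lemma three_far_points n : exists u : 'I_3 -> G,
  (forall i, (n <= d 1 (u i))%N) /\
  forall i j, i != j -> (gp 1 (u i) (u j) <= 2 * e + 2)%N.
Proof.
apply: contrapT => N.
have no3 x y z : (n <= d 1 x)%N -> (n <= d 1 y)%N -> (n <= d 1 z)%N ->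
    (gp 1 x y <= 2 * e + 2)%N -> (gp 1 y z <= 2 * e + 2)%N ->
    (2 * e + 2 < gp 1 x z)%N.
  move=> nx ny nz xy yz; rewrite ltnNge; apply/negP => xz; apply: N.
  exists (fun i : 'I_3 => nth x [:: x; y; z] i); split.
    by case=> [[|[|[]]]].
  by case=> [[|[|[]]]] //= ? [[|[|[]]]] //= ? _; rewrite // gpC.
have [a [b [ra rb gab]]] := opposite_rays.
pose n1 := (n + 2 * e + 4)%N.
have [C [_ uniqC]] := one_ended (wball S 1 n1).
have inC r : is_ray S 1 r -> C = complement_component S (wball S 1 n1) (r n1.+1).
  move=> rr; apply: uniqC; split; first exact: ray_component.
  by exists (r n1.+1) => //; rewrite wballP (is_ray_dist _ rr) -ltnNge.
have : complement_component S (wball S 1 n1) (a n1.+1) (b n1.+1).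
  rewrite -(inC a ra) (inC b rb); exists [::]; split=> //=.
  by rewrite wballP (is_ray_dist _ rb) -ltnNge ltnSn.
move=> [p [pp lp /allP Kp]].
have da := is_ray_dist n1.+1 ra; have db := is_ray_dist n1.+1 rb.
have [|||w [w' [ww' nw nw' Pw Pw']]] := @path_switch G (cayley_adj S)
    (fun w => (2 * e + 2 < gp 1 w (a n1.+1))%N) (fun w => (n1 < d 1%g w)%N)
    (a n1.+1) p pp.
- by rewrite gpxx da /n1; lia.
- by rewrite lp gpC gab.
- by move=> z /Kp; rewrite wballP ltnNge.
have dw : (d w w' <= 1)%N.
  by move: ww'; rewrite cayley_adjP => /(dist_sgen w); rewrite mulKVg.
have : (2 * e + 2 < gp 1 w' (b n1.+1))%N.
  apply: (no3 w' (a n1.+1) (b n1.+1)); rewrite ?da ?db ?gab //.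
  - by move: nw'; rewrite /n1; lia.
  - by rewrite /n1; lia.
  - by rewrite /n1; lia.
  - by rewrite leqNgt; apply/negP.
move=> gw'b; have h1 := hypS 1 (a n1.+1) w w'; have h2 := hypS 1 (a n1.+1) w' (b n1.+1).
rewrite gab (gpC S _ (a n1.+1) w) in h1 h2.
have gww' : (2 * n1 - 1 <= gp 1 w w')%N by rewrite /dgp; lia.
by move: gww' h1 h2 Pw gw'b; rewrite /n1; lia.
Qed.

Lemma three_rays : exists r : 'I_3 -> nat -> G, (forall i, is_ray S 1 (r i)) /\
  forall i j, i != j -> forall n m, (gp 1 (r i n) (r j m) <= 2 * e + 2)%N.
Proof.
have /choice[u uP] := three_far_points.
have [F UF Foo] := free_ultrafilter.
have /choice[r rP] : forall i, exists r, is_ray S 1 r /\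
    forall j, F [set n | (d 1 (r j) + d (r j) (u n i) = d 1 (u n i))%N].
  move=> i; have [|r rr rF] := @ray_limit _ S F UF 1 (fun n => u n i) 0 Foo.
    by move=> n; rewrite addn0; exact: (uP n).1.
  by exists r.
exists r; split=> [i|i j ij n m]; first by have [] := rP i.
have [k [/= h1 h2]] := filter_ex (filterI ((rP i).2 n) ((rP j).2 m)).
exact: leq_trans (gp_between h1 h2) ((uP k).2 i j ij).
Qed.

Lemma far_not_asym (r s : nat -> G) c : (forall n, (n <= d 1 (r n) + c)%N) ->
  (forall n, (n <= d 1 (s n) + c)%N) ->
  (forall n, (gp 1 (r n) (s n) <= c)%N) -> ~ asym S r s.
Proof.
move=> rc sc rs [D rsD].
have := rc (2 * c + D + c).+1; have := sc (2 * c + D + c).+1.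
by have := rs (2 * c + D + c).+1; have := rsD (2 * c + D + c).+1; rewrite /dgp; lia.
Qed.

(** A second copy of the three rays is planted at [v], far out on the ray [r ord0]. Two of its rays
    point away from 1, and they are new with respect to the other two rays at 1. *)
Lemma four_rays : exists r : 'I_4 -> nat -> G, (forall i, is_ray S 1 (r i)) /\
  forall i j, i != j -> ~ asym S (r i) (r j).
Proof.
have [r [rr rij]] := three_rays; pose t := (2 * e + 2)%N.
pose n := (t + e + t + e)%N; pose v := r ord0 n.
pose s i k := v * r i k.
have sv i : is_ray S v (s i) by have := is_ray_mul v (rr i); rewrite mulg1.
have dv : d 1 v = n by exact: is_ray_dist.
have sij i j : i != j -> forall k l, (gp v (s i k) (s j l) <= t)%N.
  by move=> ij k l; rewrite -{1}(mulg1 v) gp_mul2l; exact: rij.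
have [i0 out] : exists i0, forall i k, i != i0 -> (gp v 1 (s i k) <= t + e)%N.
  have [[i0 [k0 /negP gt]]|N] := pselect (exists i0 k0, ~~ (gp v 1 (s i0 k0) <= t + e)%N).
    exists i0 => i k ni; have le := sij _ _ ni k k0.
    by have := hypS v (s i k) 1 (s i0 k0); rewrite (gpC _ v _ 1); lia.
  exists ord0 => i k _; apply: contrapT => /negP nle.
  by apply: N; exists i, k.
have far i k : (k <= d 1 (s i k) + (2 * n + t + e))%N.
  by have := is_ray_dist k (sv i); metric S (1 : G, v, s i k); lia.
have farr i k : (k <= d 1 (r i k) + (2 * n + t + e))%N.
  by have := is_ray_dist k (rr i); lia.
have nas i j : i != i0 -> j != ord0 -> ~ asym S (s i) (r j).
  move=> ii0 j0; apply: (far_not_asym (far i) (farr j)) => k.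
  have := out i k ii0; have := rij ord0 j; rewrite eq_sym => /(_ j0 n k) h1.
  have := hypS 1 v (s i k) (r j k).
  by move: h1; rewrite -/v -/t /dgp; move: dv; rewrite /n; metric S (1 : G, v, s i k, r j k); lia.
have nss i j : i != j -> ~ asym S (s i) (s j).
  move=> ij; apply: (far_not_asym (far i) (far j)) => k.
  have := sij i j ij k k; move: dv; rewrite /dgp.
  by metric S (1 : G, v, s i k, s j k); lia.
have /choice[s' s'P] : forall i, exists s', is_ray S 1 s' /\ asym S s' (s i).
  by move=> i; have [s' rs' as'] := ray_change_base hypS (sv i); exists s'.
have [i1 [i2 [n1 n2 n12]]] : exists i1 i2, [/\ i1 != i0, i2 != i0 & i1 != i2].
  exists (i0 + 1)%R, (i0 + 2)%R.
  by case: (i0) => [[|[|[]]]] //.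
have s's' : ~ asym S (s' i1) (s' i2).
  move=> as12; apply: (nss i1 i2 n12).
  by apply: asym_trans (asym_sym (s'P i1).2) (asym_trans as12 (s'P i2).2).
have s'r i j : i != i0 -> j != ord0 -> ~ asym S (s' i) (r j).
  by move=> ii0 j0 /(asym_trans (asym_sym (s'P i).2)); exact: nas.
pose j1 : 'I_3 := inord 1; pose j2 : 'I_3 := inord 2.
have j10 : j1 != ord0 by rewrite -val_eqE /= inordK.
have j20 : j2 != ord0 by rewrite -val_eqE /= inordK.
have j12 : j1 != j2 by rewrite -val_eqE /= !inordK.
have rr12 : ~ asym S (r j1) (r j2).
  by apply: (far_not_asym (farr j1) (farr j2)) => k; have := rij _ _ j12 k k; lia.
exists (fun i : 'I_4 => nth (r j1) [:: s' i1; s' i2; r j1; r j2] i); split.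
  by case=> [[|[|[|[]]]]] //= _; (exact: rr || exact: (s'P _).1).
have sy x y : ~ asym S x y -> ~ asym S y x by move=> h /asym_sym.
by case=> [[|[|[|[]]]]] //= ? [[|[|[|[]]]]] //= ? _; auto.
Qed.

Lemma ray_avoiding (w : 'I_3 -> nat -> G) : exists2 r, is_ray S 1 r &
  forall k, ~ asym S r (w k).
Proof.
have [r [rr rij]] := four_rays; apply: contrapT => N.
have /choice[f fP] : forall i, exists k, asym S (r i) (w k).
  move=> i; apply: contrapT => M; apply: N; exists (r i) => // k ak.
  by apply: M; exists k.
have /injectivePn[i [j ij fij]] : ~~ injectiveb f.
  by apply/negP => /injectiveP /leq_card; rewrite !card_ord.
by apply: (rij i j ij); apply: asym_trans (fP i) (asym_sym _); rewrite fij.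
Qed.

End OneEnded.
End Rays.

(** * Colourings with a small frontier *)

Section NoLocalCut.
Variables (G : groupType) (S : finite_generating_set G) (e : nat).
Hypothesis hypS : hyperbolic_with S e.
Local Notation d := (word_dist S).
Local Notation gp := (dgp S).

(* Seen from z, the set A has points in three directions, or is close to z. *)
Definition central t (A : set G) z : Prop := exists a b c,
  [/\ A a, A b & A c] /\ [/\ (gp z a b <= t)%N, (gp z b c <= t)%N & (gp z a c <= t)%N].

Lemma free_asym (A : set G) r s : is_ray S 1 r -> is_ray S 1 s -> asym S r s ->
  escapes S A r -> escapes S A s.
Proof.
move=> rr rs [D rsD] [N rN]; exists (N + 2 * D)%N => a n Aa.
have := rN a n Aa; have := rsD n; have := is_ray_dist n rr; have := is_ray_dist n rs.
by rewrite /dgp; metric S (1 : G, a, r n, s n); lia.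
Qed.

Lemma not_free_gp (A : set G) r N : ~ escapes S A r ->
  exists2 a, A a & exists n, (N < gp 1 a (r n))%N.
Proof.
move=> nf; apply: contrapT => M; apply: nf; exists N => a n Aa.
by rewrite leqNgt; apply/negP => lt; apply: M; exists a => //; exists n.
Qed.

(** Three limit points of [A] are separated at a scale [k] that depends on them; near each of them
    [A] is infinite, so any number [m k] of points is available, even though [m] was fixed before
    [k]. *)
Lemma limit_points (A : set G) (m : nat -> nat) (r : 'I_3 -> nat -> G) :
  (forall i, is_ray S 1 (r i)) -> (forall i j, i != j -> ~ asym S (r i) (r j)) ->
  (forall i, ~ escapes S A (r i)) -> exists k, branching S k (m k) A 1.
Proof.
move=> rr nas nf.
have /choice[t' t'P] : forall ij : 'I_3 * 'I_3, exists t, ij.1 != ij.2 ->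
    forall n n', (gp 1 (r ij.1 n) (r ij.2 n') <= t)%N.
  move=> [i j] /=; have [->|ij] := eqVneq i j; first by exists 0%N.
  by have [t tP] := not_asym hypS (rr i) (rr j) (nas i j ij); exists t.
pose t := (\sum_(ij : 'I_3 * 'I_3) t' ij)%N.
have tP i j n n' : i != j -> (gp 1 (r i n) (r j n') <= t)%N.
  move=> ij; apply: leq_trans (t'P (i, j) ij n n') _.
  by rewrite /t (bigD1 (i, j)) //= leq_addr.
pose k := (t + 2 * e)%N; exists k.
pose Q i : set G := [set a | A a /\ exists n, (k < gp 1 a (r i n))%N].
have /choice[C CP] : forall i, exists s : seq G,
    [/\ uniq s, size s = m k & forall a, a \in s -> Q i a].
  move=> i; apply: (unbounded_seq (S := S)) => N.
  have [a Aa [n lt]] := not_free_gp (2 * N + k) (nf i).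
  exists a; first by split=> //; exists n; lia.
  by move: lt; rewrite /dgp; metric S (1 : G, a, r i n); lia.
exists C; split=> [i|i j a b ij aC bC].
  have [uC -> CQ] := CP i; split=> // a /CQ[] //.
have [_ _ /(_ a aC)[_ [n an]]] := CP i; have [_ _ /(_ b bC)[_ [n' bn]]] := CP j.
have h0 := tP i j n n' ij.
have h1 := hypS 1 (r i n) a (r j n'); have h2 := hypS 1 a b (r j n').
have le : (gp 1 a b <= k)%N by move: h1 h2; rewrite (gpC S _ (r i n) a) /k in an bn *; lia.
split=> //; apply/eqP => eab; move: le; rewrite -eab gpxx.
by move: an; rewrite /dgp; metric S (1 : G, a, r i n); lia.
Qed.

Hypothesis one_ended : one_ended_graph S.
Hypothesis no_cut_pair : ~ exists a b : gromov_boundary S, cut_pair a b.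

(** The products between the rays of [three_rays] are at most [2 * e + 2]; replacing both rays by
    points of [A] costs [e] each. *)
Definition central_bound := (2 * e + 2 + 2 * e)%N.

(** Translate [three_rays] to [x]: if [A] followed all three rays, [x] would be central. *)
Lemma escaping_ray (A : set G) x : ~ central central_bound A x ->
  exists2 r, is_ray S x r & forall a n, A a -> (gp x a (r n) <= central_bound)%N.
Proof.
move=> nc; have [r [rr rij]] := three_rays hypS one_ended.
apply: contrapT => N; apply: nc.
have /choice[a aP] : forall i, exists a, A a /\
    exists n, (central_bound < gp x a (x * r i n))%N.
  move=> i; apply: contrapT => M; apply: N; exists (fun n => x * r i n).
    by have := is_ray_mul x (rr i); rewrite mulg1.
  move=> a n Aa; rewrite leqNgt; apply/negP => lt.
  by apply: M; exists a; split=> //; exists n.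
have aij i j : i != j -> (gp x (a i) (a j) <= central_bound)%N.
  move=> ij; have [_ [n an]] := aP i; have [_ [n' an']] := aP j.
  have h0 : (gp x (x * r i n) (x * r j n') <= 2 * e + 2)%N.
    by rewrite -{1}(mulg1 x) gp_mul2l; exact: rij.
  have h1 := hypS x (x * r i n) (a i) (x * r j n').
  have h2 := hypS x (a i) (a j) (x * r j n').
  by move: h1 h2; rewrite (gpC S _ (x * r i n)) /central_bound in an an' *; lia.
pose j1 : 'I_3 := inord 1; pose j2 : 'I_3 := inord 2.
have j10 : ord0 != j1 by rewrite -val_eqE /= inordK.
have j20 : ord0 != j2 by rewrite -val_eqE /= inordK.
have j12 : j1 != j2 by rewrite -val_eqE /= !inordK.
exists (a ord0), (a j1), (a j2); split; split; try exact: aij; exact: (aP _).1.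
Qed.

(** The escaping ray never meets [A], hence carries the colour of [x] to infinity. *)
Lemma escaping_colour (A : set G) (col : G -> bool) x :
    (forall u s, s \in sgen S -> col u != col (u * s) -> A u) ->
    ~ central central_bound A x ->
  exists r, [/\ is_ray S 1 r, escapes S A r & eventually_col col (col x) r].
Proof.
move=> colA ncx; have [s rs sA] := escaping_ray ncx.
(* A point of [A] on the ray, taken three times, would make [x] central. *)
have sout n : ~ A (s n).
  move=> As; have le := sA _ n As; apply: ncx; exists (s n), (s n), (s n).
  by split=> //; rewrite !gpxx; move: le; rewrite gpxx.
have colC u v : v \in sgen S -> col u != col (u * v) -> A (u * v).
  move=> vS ne; apply: (colA _ v^-1); first by rewrite sgenV.
  by rewrite mulgK eq_sym.
have scol n : col (s n) = col x.
  elim: n => [|n <-]; first by have [->] := rs.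
  have [_ sG] := rs.
  have /norm_ltS[v [h [vS /word_norm_eq0-> ev]]] :
    word_norm S ((s n)^-1 * s n.+1) = 1%N.
    by have := sG n n.+1 (leqnSn _); rewrite subSnn.
  apply/eqP; apply: contrapT => /negP ne; apply: (sout n); apply: (colA _ _ vS).
  by rewrite -[v]mulg1 -ev mulKVg eq_sym.
have [r rr [D rsD]] := ray_change_base hypS rs.
have ds n := is_ray_dist n rs; have dr n := is_ray_dist n rr.
exists r; split=> //.
  exists (central_bound + 2 * D + 2 * d 1%g x)%N => a n Aa.
  have := sA a n Aa; have := rsD n; have := ds n; have := dr n; rewrite /dgp.
  by metric S (1 : G, x, a, r n, s n); lia.
exists (central_bound + 2 * D).+1 => n ltn; rewrite -(scol n); apply/(col_path colA) => z zn Az.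
have := sA z n Az; have := rsD n; have := ds n.
by move: zn; rewrite /dgp; metric S (x, z, r n, s n); lia.
Qed.

(** Without branching at 1, [A] has at most two limit points. Completed if necessary by boundary
    points other than the ends of [r0] and [r1], they form a pair whose complement is disconnected
    by the colours. *)
Lemma colour_limit (A : set G) (col : G -> bool) (m : nat -> nat) x y :
    (forall u s, s \in sgen S -> col u != col (u * s) -> A u) ->
    ~ central central_bound A x -> ~ central central_bound A y -> col x != col y ->
  exists k, branching S k (m k) A 1.
Proof.
move=> colA ncx ncy cxy.
wlog [cx cy] : x y ncx ncy {cxy} / col x = false /\ col y = true.
  move=> W; case Ex: (col x); case Ey: (col y); rewrite ?Ex ?Ey // in cxy.
    exact: (W y x).
  exact: (W x y).
have [r0 [rr0 f0 c0]] := escaping_colour colA ncx; rewrite cx in c0.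
have [r1 [rr1 f1 c1]] := escaping_colour colA ncy; rewrite cy in c1.
apply: contrapT => nbr; apply: no_cut_pair.
have sy r s : ~ asym S r s -> ~ asym S s r by move=> h /asym_sym.
have nfree r s : is_ray S 1 r -> is_ray S 1 s -> ~ escapes S A r -> escapes S A s -> ~ asym S r s.
  by move=> rr rs nf fs /asym_sym as1; apply: nf; exact: free_asym fs.
have pick3 (u v w : nat -> G) : exists r, [/\ is_ray S 1 r, ~ asym S r u, ~ asym S r v & ~ asym S r w].
  have [r rr rw] := ray_avoiding hypS one_ended (fun i : 'I_3 => nth u [:: u; v; w] i).
  exists r; split=> //.
  - exact: (rw ord0).
  - by have := rw (inord 1); rewrite inordK.
  - by have := rw (inord 2); rewrite inordK.
suff [a [b [ra rb nab cover [na0 nb0 na1 nb1]]]] : exists a b, [/\ is_ray S 1 a,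
    is_ray S 1 b, ~ asym S a b,
    (forall r, is_ray S 1 r -> ~ asym S a r -> ~ asym S b r -> escapes S A r) &
    [/\ ~ asym S a r0, ~ asym S b r0, ~ asym S a r1 & ~ asym S b r1]].
  exact: (cut_pair_of_colouring hypS colA ra rb rr0 rr1 nab cover).
have [[a [ra nfa]]|allfree] := pselect (exists a, is_ray S 1 a /\ ~ escapes S A a); last first.
  have [a [ra a0 a1 _]] := pick3 r0 r1 r1.
  have [b [rb b0 b1 ba]] := pick3 r0 r1 a.
  exists a, b; split=> //; first exact: sy.
  by move=> r rr _ _; apply: contrapT => nf; apply: allfree; exists r.
have [[b [rb nfb nab]]|onefree] := pselect (exists b, [/\ is_ray S 1 b, ~ escapes S A b & ~ asym S a b]).
  exists a, b; split=> //; last by split; exact: nfree.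
  move=> r rr nar nbr'; apply: contrapT => nfr; apply: nbr.
  apply: (@limit_points A m (fun i : 'I_3 => nth a [:: a; b; r] i)).
  - by case=> [[|[|[|]]]].
  - by case=> [[|[|[|]]]] //= ? [[|[|[|]]]] //= ? _; auto.
  - by case=> [[|[|[|]]]].
have [b [rb b0 b1 ba]] := pick3 r0 r1 a.
exists a, b; split=> //; first exact: sy.
  move=> r rr nar _; apply: contrapT => nfr; apply: onefree.
  by exists r.
by split=> //; exact: nfree.
Qed.

(* Compactness: an ultralimit of counterexamples of growing size is a colouring
   of the whole group, contradicting [colour_limit]. *)
Lemma no_local_cut (J : nat) (m : nat -> nat) : exists n,
  forall (A : set G) (col : G -> bool) x y, (d 1 x <= J)%N -> (d 1 y <= J)%N ->
    (forall u s, (d 1 u <= n)%N -> s \in sgen S -> col u != col (u * s) -> A u) ->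
    ~ central central_bound A x -> ~ central central_bound A y -> col x != col y ->
  exists2 k, (k < n)%N & branching S k (m k) A 1.
Proof.
apply: contrapT => N.
have /choice[w wP] : forall n, exists w : (set G * (G -> bool)) * (G * G),
    [/\ (d 1%g w.2.1 <= J)%N /\ (d 1%g w.2.2 <= J)%N,
     forall u s, (d 1 u <= n)%N -> s \in sgen S -> w.1.2 u != w.1.2 (u * s) -> w.1.1 u,
     ~ central central_bound w.1.1 w.2.1 /\ ~ central central_bound w.1.1 w.2.2,
     w.1.2 w.2.1 != w.1.2 w.2.2 & forall k, (k < n)%N -> ~ branching S k (m k) w.1.1 1].
  move=> n; apply: contrapT => M; apply: N; exists n => A col x y xJ yJ colA ncx ncy cxy.
  apply: contrapT => nb; apply: M; exists ((A, col), (x, y)); split=> //.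
  by move=> k kn br; apply: nb; exists k.
have [F UF Foo] := free_ultrafilter.
have inJ (f : nat -> G) : (forall n, d 1 (f n) <= J)%N -> exists x, F [set n | f n = x].
  by move=> fJ; apply: (@ultra_limit _ F UF (enum_fset (wball S 1 J))) => n; rewrite wballP.
have [x Fx] : exists x, F [set n | (w n).2.1 = x].
  by apply: inJ => n; have [[]] := wP n.
have [y Fy] : exists y, F [set n | (w n).2.2 = y].
  by apply: inJ => n; have [[]] := wP n.
pose A : set G := [set u | F [set n | (w n).1.1 u]].
pose col u := `[< F [set n | (w n).1.2 u] >].
have colF u : F [set n | (w n).1.2 u = col u].
  have [Fu|Fu] := in_ultra_setVsetC [set n | (w n).1.2 u] UF.
    have -> : col u = true by apply/asboolP.
    by apply: filterS Fu => n.
  have -> : col u = false.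
    apply/asboolP => Fu'; apply: (filter_not_empty F).
    by apply: filterS (filterI Fu Fu') => n [].
  by apply: filterS Fu => n /negP/negbTE.
have colA u s : s \in sgen S -> col u != col (u * s) -> A u.
  move=> sS ne; apply: filterS (filterI (Foo (d 1 u)) (filterI (colF u) (colF (u * s)))).
  move=> n [/= un [cu cs]]; have [_ wA _ _ _] := wP n; apply: (wA u s) => //.
  by rewrite cu cs.
have ncent (f : nat -> G) z : F [set n | f n = z] ->
    (forall n, ~ central central_bound (w n).1.1 (f n)) -> ~ central central_bound A z.
  move=> Fz nc [a [b [c [[Aa Ab Ac] abc]]]].
  have [n [/= fn [wa [wb wc]]]] := filter_ex (filterI Fz (filterI Aa (filterI Ab Ac))).
  by apply: (nc n); rewrite fn; exists a, b, c.
have ncx : ~ central central_bound A x by apply: ncent Fx _ => n; have [_ _ []] := wP n.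
have ncy : ~ central central_bound A y by apply: ncent Fy _ => n; have [_ _ []] := wP n.
have cxy : col x != col y.
  have [n [/= ex [ey [cx cy]]]] :=
    filter_ex (filterI Fx (filterI Fy (filterI (colF x) (colF y)))).
  by have [_ _ _ + _] := wP n; rewrite ex ey cx cy.
have [k [C [CA Ccross]]] := colour_limit m colA ncx ncy cxy.
(* Branching has finitely many witnesses, so it passes from the limit back to almost every
   counterexample, in particular to one with [k < n]. *)
have FC : F [set n | forall i : 'I_3, forall a, a \in C i -> (w n).1.1 a].
  have FF : Filter F by exact: filter_filter.
  have := @filter_forall_seq 'I_3 F FF (enum 'I_3) (fun i n => forall a, a \in C i -> (w n).1.1 a).
  have h i : F [set n | forall a, a \in C i -> (w n).1.1 a].
    apply: (@filter_forall_seq G F FF (C i) (fun a n => (w n).1.1 a)) => a aC.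
    by have [_ CiA _] := CA i; exact: CiA.
  move=> /(_ (fun i _ => h i)).
  by apply: filterS => n hn i; apply: hn; rewrite mem_enum.
have [n [/= Cn kn]] := filter_ex (filterI FC (Foo k.+1)).
have [_ _ _ _ nb] := wP n; apply: (nb k kn); exists C; split=> // i.
by have [uC _ mC] := CA i; split=> // a; exact: Cn.
Qed.

End NoLocalCut.

(** * Property A *)

Lemma count_le_size (T : eqType) (a : pred T) (s t : seq T) : uniq s ->
  (forall x, x \in s -> a x -> x \in t) -> (count a s <= size t)%N.
Proof.
move=> us sub; rewrite -size_filter; apply: uniq_leq_size; first exact: filter_uniq.
by move=> x; rewrite mem_filter => /andP[ax xs]; exact: sub.
Qed.

Lemma count_sum (T : Type) (a : pred T) (s : seq T) :
  count a s = (\sum_(z <- s) (a z : nat))%N.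
Proof. by elim: s => [|z s IHs]; rewrite ?big_nil // big_cons /= IHs. Qed.

Section Localize.
Variables (G : groupType) (S : finite_generating_set G) (e : nat).
Hypothesis hypS : hyperbolic_with S e.
Hypothesis unbounded : forall n, exists g : G, (n < word_dist S 1 g)%N.
Local Notation d := (word_dist S).
Local Notation gp := (dgp S).

Let c0 := #|` wball1 S (2 * e)|.

Section Shadows.
Variables (n K : nat) (o : G).
Hypothesis K2n : (2 * K <= n)%N.

(* The sets [ahead v k], averaged over k, are the almost invariant measures of
   Yu's property A. *)
Definition ahead v k z : bool := `[< (d o v <= d o z + 2 * n)%N /\ (d o z + n < d o v)%N /\
  exists2 x, (d v x <= k)%N & (d o z + d z x = d o x)%N >].

Lemma ahead_dist v k z : (k <= K)%N -> ahead v k z -> (d v z <= 4 * n)%N.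
Proof.
move=> kK /asboolP[h1 [h2 [x vx zx]]].
by move: h1 h2 vx zx; metric S (o, v, x, z); lia.
Qed.

(** Geodesics from [o] to points within [k] of [v] fellow-travel up to [n] before [v], since
    [2 * k <= n]. Thus one level of [ahead v k] has boundedly many points, independently of [k]. *)
Lemma ahead_close v k z z' : (k <= K)%N -> ahead v k z -> ahead v k z' ->
  d o z = d o z' -> (d z z' <= 2 * e)%N.
Proof.
move=> kK /asboolP[h1 [h2 [x vx zx]]] /asboolP[h1' [h2' [x' vx' zx']]] ez.
have h3 := hypS o z x x'; have h4 := hypS o z x' z'.
move: h1 h2 vx zx vx' zx' ez h3 h4; rewrite /dgp.
by metric S (o, v, x, x', z, z'); lia.
Qed.

Lemma ahead_exists v k l : (d o v <= l + 2 * n)%N -> (l + n < d o v)%N ->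
  exists2 z, d o z = l & ahead v k z.
Proof.
move=> h1 h2; have lel : (l <= d o v)%N by lia.
have [z [ez zv]] := dist_between lel.
exists z => //; apply/asboolP; rewrite ez; split=> //; split=> //.
by exists v; rewrite ?word_distxx // zv subnKC.
Qed.

Lemma count_ahead_level v k l (s : seq G) : uniq s -> (k <= K)%N ->
  (count (fun z => ahead v k z && (d o z == l)) s <= c0)%N.
Proof.
move=> us kK; have [[z [az /eqP zl]]|N] := pselect (exists z, ahead v k z /\ d o z == l).
  rewrite /c0 -(card_wball S z); apply: count_le_size => // z' _ /andP[az' /eqP zl'].
  by rewrite wballP; apply: (ahead_close kK az az'); rewrite zl.
rewrite (eq_count (a2 := pred0)) ?count_pred0 // => z /=.
by apply/negbTE/negP => /andP[az zl]; apply: N; exists z.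
Qed.

Lemma count_ahead_le v k (s : seq G) : uniq s -> (k <= K)%N -> (2 * n <= d o v)%N ->
  (count (ahead v k) s <= n * c0)%N.
Proof.
move=> us kK dv.
have : (count (ahead v k) s <=
    \sum_(l <- iota (d o v - 2 * n) n) count (fun z => ahead v k z && (d o z == l)) s)%N.
  under eq_bigr do rewrite count_sum.
  rewrite count_sum exchange_big /=; apply: leq_sum => z _.
  case: (boolP (ahead v k z)) => //= /asboolP[h1 [h2 _]].
  by rewrite (big_rem (d o z)) /= ?eqxx // mem_iota; lia.
move=> h; apply: (leq_trans h).
apply: (@leq_trans (\sum_(l <- iota (d o v - 2 * n) n) c0)%N).
  by apply: leq_sum => l _; exact: count_ahead_level.
by rewrite big_const_seq count_predT size_iota iter_addn_0 mulnC.
Qed.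

Lemma count_ahead_ge v k (s : seq G) : (k <= K)%N -> (2 * n <= d o v)%N ->
  {subset wball S v (4 * n) <= s} -> (n <= count (ahead v k) s)%N.
Proof.
move=> kK dv vs; pose l0 := (d o v - 2 * n)%N.
have /choice[z zP] : forall l, exists z, (l0 <= l < l0 + n)%N -> d o z = l /\ ahead v k z.
  move=> l; have [ll|] := boolP (l0 <= l < l0 + n)%N; last by exists 1.
  have [||z zl az] := @ahead_exists v k l; rewrite /l0 in ll; try lia.
  by exists z.
rewrite -(size_iota l0 n) -(size_map z) -size_filter; apply: uniq_leq_size.
  rewrite map_inj_in_uniq ?iota_uniq // => l l'; rewrite !mem_iota => ll ll' ezz.
  by rewrite -(zP l ll).1 -(zP l' ll').1 ezz.
move=> _ /mapP[l + ->]; rewrite mem_iota => ll; rewrite mem_filter.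
have [_ az] := zP l ll; rewrite az /=; apply: vs; rewrite wballP.
exact: ahead_dist az.
Qed.

Lemma ahead_leave v w k z : (d v w <= 1)%N -> ahead v k z -> ~~ ahead w k z ->
  ahead w k.+1 z \/ (d o z = d o v - 2 * n)%N \/ (d o z = d o v - n.+1)%N.
Proof.
move=> vw /asboolP[h1 [h2 [x vx zx]]] /asboolP na.
have [lvl|nlvl] := boolP ((d o w <= d o z + 2 * n) && (d o z + n < d o w))%N.
  left; apply/asboolP; move/andP: lvl => [l1 l2]; split=> //; split=> //.
  by exists x => //; metric S (v, w, x); lia.
right; move: nlvl; rewrite negb_and -!leqNgt -ltnNge => /orP[]; move: vw h1 h2.
  by metric S (o, v, w); lia.
by metric S (o, v, w); lia.
Qed.

(** Up to two extreme levels, the points lost in passing from [v] to [w] are gained by enlarging [k]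
    to [k.+1] at [w]. As [ahead w k] increases with [k], these gains telescope to at most one full
    size [n * c0]; this is the benefit of averaging over [k]. *)
Lemma sum_leave v w (s : seq G) : uniq s -> (d v w <= 1)%N -> (2 * n <= d o w)%N ->
  (\sum_(k < K) count (fun z => ahead v k z && ~~ ahead w k z) s <= 2 * K * c0 + n * c0)%N.
Proof.
move=> us vw dw.
have step (k : 'I_K) : (count (fun z => ahead v k z && ~~ ahead w k z) s
    <= c0 + c0 + (count (ahead w k.+1) s - count (ahead w k) s))%N.
  have mon : subpred (ahead w k) (ahead w k.+1).
    move=> z /asboolP[h1 [h2 [x wx zx]]]; apply/asboolP; split=> //; split=> //.
    by exists x => //; lia.
  have h1 := count_ahead_level v (d o v - 2 * n) us (ltnW (ltn_ord k)).
  have h2 := count_ahead_level v (d o v - n.+1) us (ltnW (ltn_ord k)).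
  have h3 : (count (ahead w k) s + count (fun z => ahead w k.+1 z && ~~ ahead w k z) s
      = count (ahead w k.+1) s)%N.
    rewrite !count_sum -big_split /=; apply: eq_bigr => z _.
    by case: (boolP (ahead w k z)) => [/mon ->|_] //=; rewrite ?andbT ?add0n.
  apply: leq_trans (leq_add (leq_add h1 h2) (leqnn _)).
  rewrite -h3 addKn !count_sum -!big_split /=; apply: leq_sum => z _.
  case: (boolP (ahead v k z)) => //= av; case: (boolP (ahead w k z)) => //= aw.
  by have [->|[->|->]] := ahead_leave vw av aw; rewrite ?eqxx ?addn1 ?add1n ?addnS.
apply: leq_trans (leq_sum _ (fun k _ => step k)) _.
rewrite big_split /= sum_nat_const card_ord.
have tele : (\sum_(k < K) (count (ahead w k.+1) s - count (ahead w k) s) <= count (ahead w K) s)%N.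
  have up (k : nat) : (count (ahead w k) s <= count (ahead w k.+1) s)%N.
    apply: sub_count => z /asboolP[h1 [h2 [x wx zx]]]; apply/asboolP.
    by split=> //; split=> //; exists x => //; lia.
  elim: (K) => [|m IHm]; first by rewrite big_ord0.
  rewrite big_ord_recr /=; apply: leq_trans (leq_add IHm (leqnn _)) _.
  by rewrite subnKC.
apply: leq_trans (leq_add (leqnn _) (leq_trans tele (count_ahead_le us (leqnn K) dw))) _.
by rewrite leq_add2r; lia.
Qed.

End Shadows.

Lemma big_fset_filter (V U : {fset G}) (P : pred G) (F : G -> nat) :
  (forall v, (v \in U) = (v \in V) && P v) ->
  (\sum_(u <- U) F u = \sum_(v <- V) P v * F v)%N.
Proof.
move=> UP; have pU : perm_eq U [seq v <- V | P v].
  apply: uniq_perm; rewrite ?filter_uniq ?fset_uniq // => v.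
  by rewrite mem_filter UP andbC.
rewrite (perm_big _ pU) big_filter big_mkcond; apply: eq_bigr => v _.
by case: (P v); rewrite ?mul1n ?mul0n.
Qed.

(* Yu's property A for hyperbolic groups, in dual form: a finite set V contains
   a piece of bounded size whose boundary in V is relatively small. *)
Lemma localize Q : exists k0, forall (V : {fset G}) (a c : G -> nat),
    (c0 * \sum_(v <- V) c v + #|` V| < \sum_(v <- V) a v)%N ->
  exists z (U : {fset G}), [/\ {subset U <= V}, forall u, u \in U -> (d u z <= k0)%N &
    (\sum_(u <- U) (c u + Q * has (fun s => ((u * s)%g \in V) && ((u * s)%g \notin U)) (sgen S))
       < \sum_(u <- U) a u)%N].
Proof.
(* With this [K], the boundary cost [Q * g * (2 * K * c0 + n * c0)] per vertex is at most [K * n],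
   the least total weight of a vertex; this is step [e1]. *)
pose g := #|` sgen S|; pose K := (2 * c0 * Q * g).+1; pose n := (2 * K)%N.
exists (4 * n)%N => V a c lt; apply: contrapT => N.
(* The viewpoint lies far outside [V], so that no level is cut off at 0. *)
have [ o oV] : exists o, forall v, v \in V -> (2 * n <= d o v)%N.
  have [ o ov] := unbounded (2 * n + \sum_(v <- V) d 1%g v); exists o => v vV.
  have : (d 1%g v <= \sum_(v <- V) d 1%g v)%N by rewrite (big_rem v) //= leq_addr.
  by move: ov; metric S (1 : G, o, v); lia.
pose Z := undup (flatten [seq enum_fset (wball S v (4 * n)) | v <- enum_fset V]).
have uZ : uniq Z by exact: undup_uniq.
have VZ v : v \in V -> {subset wball S v (4 * n) <= Z}.
  move=> vV z zv; rewrite mem_undup; apply/flattenP.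
  by exists (enum_fset (wball S v (4 * n))) => //; apply: map_f.
have K2n : (2 * K <= n)%N by [].
pose ah := ahead n o.
(* The candidates are the sets of [v] in [V] with [ah v k z], for varying [k] and [z]. If all
   failed, adding the failures would contradict [lt], because each vertex lies in at least [K * n]
   and at most [K * n * c0] candidates. *)
have fail (k : 'I_K) z : (\sum_(v <- V) ah v k z * a v <= \sum_(v <- V) ah v k z * c v +
    Q * \sum_(v <- V) \sum_(s <- sgen S) (((v * s)%g \in V) * (ah v k z && ~~ ah (v * s)%g k z)))%N.
  rewrite leqNgt; apply/negP => ltU; apply: N.
  pose U := [fset v in V | ah v k z]; exists z, U.
  have UP v : (v \in U) = (v \in V) && ah v k z by rewrite !inE.
  split=> [v|v|]; first by rewrite UP => /andP[].
    rewrite UP => /andP[_]; exact: (ahead_dist K2n (ltnW (ltn_ord k))).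
  rewrite !(big_fset_filter _ UP); apply: leq_ltn_trans ltU.
  rewrite big_distrr -big_split /= big_seq [leqRHS]big_seq; apply: leq_sum => v vV.
  case: (boolP (ah v k z)) => av; rewrite ?mul1n //= leq_add2l leq_mul2l.
  apply/orP; right; case: hasP => //= -[s sS /andP[vsV vsU]].
  by rewrite (big_rem s) //= vsV mul1n; move: vsU; rewrite UP vsV /= => ->.
have sumk (F : G -> nat) : (\sum_(k < K) \sum_(z <- Z) \sum_(v <- V) ah v k z * F v =
    \sum_(v <- V) (\sum_(k < K) count (ah v k) Z) * F v)%N.
  rewrite (eq_bigr (fun k : 'I_K => \sum_(v <- V) \sum_(z <- Z) ah v k z * F v)%N); last first.
    by move=> k _; rewrite exchange_big.
  rewrite exchange_big /=; apply: eq_bigr => v _; rewrite big_distrl /=.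
  by apply: eq_bigr => k _; rewrite count_sum big_distrl.
have total : (\sum_(k < K) \sum_(z <- Z) \sum_(v <- V) ah v k z * a v <=
    \sum_(k < K) \sum_(z <- Z) \sum_(v <- V) ah v k z * c v +
    Q * \sum_(v <- V) \sum_(s <- sgen S) ((v * s)%g \in V) *
       \sum_(k < K) count (fun z => ah v k z && ~~ ah (v * s)%g k z) Z)%N.
  have -> : (\sum_(v <- V) \sum_(s <- sgen S) ((v * s)%g \in V) *
       \sum_(k < K) count (fun z => ah v k z && ~~ ah (v * s)%g k z) Z =
     \sum_(k < K) \sum_(z <- Z) \sum_(v <- V) \sum_(s <- sgen S)
       (((v * s)%g \in V) * (ah v k z && ~~ ah (v * s)%g k z)))%N.
    rewrite [RHS](eq_bigr (fun k : 'I_K => \sum_(v <- V) \sum_(s <- sgen S) ((v * s)%g \in V) *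
       count (fun z => ah v k z && ~~ ah (v * s)%g k z) Z)%N); last first.
      move=> k _; rewrite [LHS]exchange_big /=; apply: eq_bigr => v _.
      rewrite [LHS]exchange_big /=; apply: eq_bigr => s _.
      by rewrite count_sum big_distrr.
    rewrite [RHS]exchange_big /=; apply: eq_bigr => v _.
    by rewrite [RHS]exchange_big /=; apply: eq_bigr => s _; rewrite big_distrr.
  rewrite big_distrr -big_split /=; apply: leq_sum => k _.
  by rewrite big_distrr -big_split /=; apply: leq_sum => z _; exact: fail.
rewrite !sumk in total.
have low : (K * n * \sum_(v <- V) a v <=
    \sum_(v <- V) (\sum_(k < K) count (ah v k) Z) * a v)%N.
  rewrite big_distrr /= big_seq [leqRHS]big_seq; apply: leq_sum => v vV.
  rewrite leq_mul2r; apply/orP; right.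
  have -> : (K * n = \sum_(k < K) n)%N by rewrite sum_nat_const card_ord.
  apply: leq_sum => k _.
  by apply: (count_ahead_ge K2n (ltnW (ltn_ord k))); [exact: oV|exact: VZ].
have upc : (\sum_(v <- V) (\sum_(k < K) count (ah v k) Z) * c v <=
    K * (n * c0) * \sum_(v <- V) c v)%N.
  rewrite big_distrr /= big_seq [leqRHS]big_seq; apply: leq_sum => v vV.
  rewrite leq_mul2r; apply/orP; right.
  have -> : (K * (n * c0) = \sum_(k < K) n * c0)%N by rewrite sum_nat_const card_ord.
  apply: leq_sum => k _.
  by apply: (count_ahead_le K2n uZ (ltnW (ltn_ord k))); exact: oV.
have upb : (\sum_(v <- V) \sum_(s <- sgen S) ((v * s)%g \in V) *
       \sum_(k < K) count (fun z => ah v k z && ~~ ah (v * s)%g k z) Z <=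
     #|` V| * (g * (2 * K * c0 + n * c0)))%N.
  have -> : (#|` V| * (g * (2 * K * c0 + n * c0)) =
      \sum_(v <- V) \sum_(s <- sgen S) (2 * K * c0 + n * c0))%N.
    by rewrite !big_const_seq !count_predT !iter_addn_0 mulnC [(g * _)%N]mulnC.
  apply: leq_sum => v _; rewrite big_seq [leqRHS]big_seq; apply: leq_sum => s sS.
  case: (boolP ((v * s)%g \in V)) => [vsV|]; rewrite ?mul0n ?mul1n //.
  exact: (sum_leave K2n uZ (dist_sgen v sS) (oV _ vsV)).
have e1 : (Q * (#|` V| * (g * (2 * K * c0 + n * c0))) <= K * n * #|` V|)%N.
  rewrite /n (_ : Q * _ = (2 * c0 * Q * g) * (2 * K * #|` V|))%N; last by nia.
  rewrite -[(K * _ * _)%N]mulnA leq_mul2r; apply/orP; right; exact: leqnSn.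
have e2 : (Q * (\sum_(v <- V) \sum_(s <- sgen S) ((v * s)%g \in V) *
       \sum_(k < K) count (fun z => ah v k z && ~~ ah (v * s)%g k z) Z) <= K * n * #|` V|)%N.
  by apply: leq_trans e1; rewrite leq_mul2l upb orbT.
have := leq_trans low (leq_trans total (leq_add upc e2)).
rewrite (_ : K * (n * c0) * _ = K * n * (c0 * \sum_(v <- V) c v))%N; last by rewrite !mulnA.
by rewrite -mulnDr leq_pmul2l ?muln_gt0 //= leqNgt lt.
Qed.

End Localize.

(** * Mass transport over a finite index subgroup *)

(* Junk value 0 on infinite sets. *)
Definition setcard (T : choiceType) (A : set T) : nat := #|` fset_set A|.

Lemma setcard_le_seq (T : choiceType) (A : set T) (s : seq T) :
  (forall a, A a -> a \in s) -> finite_set A /\ (setcard A <= size s)%N.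
Proof.
move=> As; have finA : finite_set A.
  by apply: (@sub_finite_set _ _ [set` s]) => //; exact: finite_seq.
by split=> //; apply: fset_le_seq => a; rewrite in_fset_set // inE; exact: As.
Qed.

Lemma seq_le_setcard (T : choiceType) (A : set T) (s : seq T) : finite_set A ->
  uniq s -> (forall a, a \in s -> A a) -> (size s <= setcard A)%N.
Proof.
move=> finA us sA; apply: seq_le_fset => // a /sA Aa.
by rewrite in_fset_set // inE.
Qed.

Section Cover.
Variables (G : groupType) (S : finite_generating_set G).
Local Notation d := (word_dist S).

Lemma setcard_cover (A : set G) r (s : seq G) :
    (forall a, A a -> exists2 c, c \in s & (d c a <= r)%N) ->
  finite_set A /\ (setcard A <= size s * #|` wball1 S r|)%N.
Proof.
move=> As; have [|fA le] := @setcard_le_seq _ A (flatten [seq enum_fset (wball S c r) | c <- s]).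
  move=> a /As[c cs ca]; apply/flattenP; exists (enum_fset (wball S c r)).
    exact: map_f.
  by rewrite wballP.
split=> //; apply: (leq_trans le); rewrite size_flatten /shape -map_comp.
have sz : all (fun n => n == #|` wball1 S r|) [seq size (enum_fset (wball S c r)) | c <- s].
  by apply/allP => _ /mapP[c _ ->]; rewrite (card_wball S c r).
rewrite [map _ _](_ : _ = nseq (size s) #|` wball1 S r|); last first.
  by move/all_pred1P: sz; rewrite size_map.
by rewrite sumn_nseq mulnC.
Qed.

End Cover.

Section Transport.
Variables (G : groupType) (H : set G) (phi : G -> G) (I : finType) (x : I -> G).
Hypothesis HM : forall h h', H h -> H h' -> H (h * h').
Hypothesis HV : forall h, H h -> H h^-1.
Hypothesis phiM : forall h h', H h -> H h' -> phi (h * h') = phi h * phi h'.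
Hypothesis phiI : forall h h', H h -> H h' -> phi h = phi h' -> h = h'.
Hypothesis xP : forall g, exists! i, H (g * (x i)^-1).

Lemma subgroup1 : H 1.
Proof.
have [i [Hi _]] := xP 1.
by have := HM Hi (HV Hi); rewrite mulgV.
Qed.

Lemma phi1 : phi 1 = 1.
Proof.
by have := phiM subgroup1 subgroup1; rewrite mulg1 => /(congr1 (fun g => g * (phi 1)^-1)); rewrite mulgK mulgV.
Qed.

Lemma phiV h : H h -> phi h^-1 = (phi h)^-1.
Proof.
move=> Hh; have := phiM Hh (HV Hh); rewrite mulgV phi1 => e1.
by apply: (mulgI (phi h)); rewrite -e1 mulgV.
Qed.

Definition idx g : I := projT1 (cid (xP g)).

Lemma idxP g : H (g * (x (idx g))^-1).
Proof. by rewrite /idx; case: cid => i []. Qed.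

Lemma idx_uniq g i : H (g * (x i)^-1) -> idx g = i.
Proof. by rewrite /idx; case: cid => j [] /= Hj uj Hi; exact: uj. Qed.

Lemma idx_mul h g : H h -> idx (h * g) = idx g.
Proof. by move=> Hh; apply: idx_uniq; rewrite -mulgA; apply: HM => //; exact: idxP. Qed.

Lemma idx_x i : idx (x i) = i.
Proof. by apply: idx_uniq; rewrite mulgV; exact: subgroup1. Qed.

Definition hpart g := g * (x (idx g))^-1.

Lemma hpartP g : H (hpart g). Proof. exact: idxP. Qed.

Lemma hpartK g : hpart g * x (idx g) = g. Proof. by rewrite /hpart mulgVK. Qed.

Lemma sum_invariant (F : G -> nat) g : (forall h y, H h -> F (h * y) = F y) ->
  (\sum_i F (x i * g)%g = \sum_i F (x i))%N.
Proof.
move=> FH; pose s i := idx (x i * g); pose s' i := idx (x i * g^-1).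
have sK u : cancel (fun i => idx (x i * u)) (fun i => idx (x i * u^-1)).
  move=> i; apply: idx_uniq.
  by have := HV (idxP (x i * u)); rewrite invgM invgK invgM mulgA.
rewrite [RHS](reindex s) /=; last first.
  exists s' => i _; first exact: sK.
  by have := sK g^-1 i; rewrite invgK.
apply: eq_bigr => i _; rewrite -[RHS](FH (hpart (x i * g))); last exact: hpartP.
by rewrite hpartK.
Qed.

Section Relation.
Variable P : G -> G -> Prop.
Hypothesis PH : forall h y p, H h -> P y p -> P (h * y) (phi h * p).
Hypothesis Pfin : forall i, finite_set (P (x i)).

Lemma P_part y p : P y p -> P (x (idx y)) ((phi (hpart y))^-1 * p).
Proof.
move=> /(PH (HV (hpartP y))); rewrite (phiV (hpartP y)).
by rewrite -{2}(hpartK y) mulKg.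
Qed.

Lemma P_fiber_inj y y' p : idx y = idx y' ->
  (phi (hpart y))^-1 * p = (phi (hpart y'))^-1 * p -> y = y'.
Proof.
move=> ei /mulIg/invg_inj/(phiI (hpartP y) (hpartP y')) eh.
by rewrite -(hpartK y) -(hpartK y') eh ei.
Qed.

Let pairs : seq (I * G) := [seq (i, q) | i <- enum I, q <- fset_set (P (x i))].

Lemma pairsP i q : ((i, q) \in pairs) <-> P (x i) q.
Proof.
split=> [/allpairsPdep[j [p [_ + [-> ->]]]]|Pq].
  by rewrite in_fset_set // inE.
apply/allpairsPdep; exists i, q; split=> //; first by rewrite mem_enum.
by rewrite in_fset_set // inE.
Qed.

Lemma size_pairs : size pairs = (\sum_i setcard (P (x i)))%N.
Proof. by rewrite size_allpairs_dep sumnE big_map big_enum. Qed.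

Lemma uniq_pairs : uniq pairs.
Proof.
apply: allpairs_uniq_dep => [|i _|]; rewrite ?enum_uniq ?fset_uniq //.
by move=> [i q] [j r] _ _ /= [-> ->].
Qed.

Lemma fiber_finite p : finite_set (P^~ p).
Proof.
have /choice[k kP] : forall iq : I * G, exists y, (exists2 y', P y' p &
    idx y' = iq.1 /\ (phi (hpart y'))^-1 * p = iq.2) ->
    P y p /\ idx y = iq.1 /\ (phi (hpart y))^-1 * p = iq.2.
  move=> iq; have [[y Py e1]|n] := pselect (exists2 y', P y' p &
    idx y' = iq.1 /\ (phi (hpart y'))^-1 * p = iq.2); first by exists y.
  by exists 1.
have [|//] := @setcard_le_seq _ (P^~ p) [seq k iq | iq <- pairs].
move=> y Py; apply/mapP; exists (idx y, (phi (hpart y))^-1 * p).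
  exact/pairsP/P_part.
have [|_ [/= e1 e2]] := kP (idx y, (phi (hpart y))^-1 * p); first by exists y.
by apply: (@P_fiber_inj _ _ p); rewrite ?e1 ?e2.
Qed.

(** [H] acts freely on the pairs related by [P]. The right side counts orbits of pairs through
    representatives of the first coordinate; the left side counts, through the second, those orbits
    that meet [Ps]. *)
Lemma transport_le (Ps : seq G) : uniq Ps ->
    {in Ps &, forall p q, (exists2 h, H h & p = phi h * q) -> p = q} ->
  (\sum_(p <- Ps) setcard (P^~ p) <= \sum_i setcard (P (x i)))%N.
Proof.
move=> uP inj; rewrite -size_pairs.
pose L := [seq (p, y) | p <- Ps, y <- fset_set (P^~ p)].
have sL : size L = (\sum_(p <- Ps) setcard (P^~ p))%N.
  by rewrite size_allpairs_dep sumnE big_map.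
have LP p y : (p, y) \in L -> p \in Ps /\ P y p.
  move=> /allpairsPdep[p' [y' [pP + [-> ->]]]]; rewrite in_fset_set ?inE //.
  exact: fiber_finite.
pose k (py : G * G) := (idx py.2, (phi (hpart py.2))^-1 * py.1).
rewrite -sL -(size_map k); apply: uniq_leq_size.
  rewrite map_inj_in_uniq.
    apply: allpairs_uniq_dep => [//|p _|]; first exact: fset_uniq.
    by move=> [i q] [j r] _ _ /= [-> ->].
  move=> [p y] [p' y'] /LP[pP Py] /LP[pP' Py'] [ei eq].
  have epp : p = p'.
    apply: inj => //; exists (hpart y * (hpart y')^-1).
      by apply: HM; [|apply: HV]; exact: hpartP.
    rewrite phiM ?phiV; try (exact: hpartP || exact/HV/hpartP).
    by rewrite -mulgA -eq mulKVg.
  by rewrite epp in eq *; rewrite (P_fiber_inj ei eq).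
move=> iq /mapP[[p y] /LP[_ Py] ->]; exact/pairsP/P_part.
Qed.

Lemma transport_ge (Ps : seq G) : uniq Ps ->
    (forall i q, P (x i) q -> exists p h, [/\ p \in Ps, H h & p = phi h * q]) ->
  (\sum_i setcard (P (x i)) <= \sum_(p <- Ps) setcard (P^~ p))%N.
Proof.
move=> uP cover; rewrite -size_pairs.
pose L := [seq (p, y) | p <- Ps, y <- fset_set (P^~ p)].
have -> : (\sum_(p <- Ps) setcard (P^~ p))%N = size L.
  by rewrite size_allpairs_dep sumnE big_map.
have /choice[k kP] : forall iq : I * G, exists ph : G * G, P (x iq.1) iq.2 ->
    [/\ ph.1 \in Ps, H ph.2 & ph.1 = phi ph.2 * iq.2].
  move=> [i q] /=; have [Pq|n] := pselect (P (x i) q); last by exists (1, 1).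
  by have [p [h [pP Hh e1]]] := cover i q Pq; exists (p, h).
pose m (iq : I * G) := ((k iq).1, (k iq).2 * x iq.1).
rewrite -(size_map m); apply: uniq_leq_size.
  rewrite map_inj_in_uniq ?uniq_pairs // => -[i q] [i' q'] /pairsP Pq /pairsP Pq' [ep eh].
  have [_ Hh e1] := kP (i, q) Pq; have [_ Hh' e2] := kP (i', q') Pq'.
  move: Hh e1 Hh' e2 ep eh; case: (k (i, q)) => p h; case: (k (i', q')) => p' h' /=.
  move=> Hh e1 Hh' e2 ep eh.
  have ei : i = i' by rewrite -(idx_x i) -(idx_x i') -(idx_mul (x i) Hh) eh idx_mul.
  rewrite -ei in eh *; move/mulIg: eh => eh.
  by move: ep; rewrite e1 e2 eh => /mulgI ->.
move=> _ /mapP[[i q] /pairsP Pq ->]; have [pP Hh e1] := kP (i, q) Pq.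
apply/allpairsPdep; exists (k (i, q)).1, ((k (i, q)).2 * x i); split=> //.
by rewrite in_fset_set ?inE; [rewrite e1; exact: PH|exact: fiber_finite].
Qed.

End Relation.

(* Mass transport: averages over H \ G of counts in the target are compared
   with counts in the source at a single point of the target. *)
Lemma mass_transport (P0 P1 P2 : G -> G -> Prop) a b c :
    (forall h y p, H h -> P0 y p -> P0 (h * y) (phi h * p)) ->
    (forall h y p, H h -> P1 y p -> P1 (h * y) (phi h * p)) ->
    (forall h y p, H h -> P2 y p -> P2 (h * y) (phi h * p)) ->
    (forall i, finite_set (P0 (x i))) -> (forall i, finite_set (P1 (x i))) ->
    (forall i, finite_set (P2 (x i))) ->
    (forall p, (a * setcard (P0^~ p) <= b * setcard (P1^~ p) + c * setcard (P2^~ p))%N) ->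
  (a * \sum_i setcard (P0 (x i)) <=
   b * \sum_i setcard (P1 (x i)) + c * \sum_i setcard (P2 (x i)))%N.
Proof.
move=> H0 subgroup1' H2 f0 f1 f2 le.
(* The chosen representative of the orbit of [q] under the image of [H]. *)
pose rp q := xget 1 [set p | exists2 h, H h & p = phi h * q].
have rpP q : exists2 h, H h & rp q = phi h * q.
  suff : [set p | exists2 h, H h & p = phi h * q] (rp q) by [].
  by apply: (@xgetPex _ 1); exists q, 1; rewrite ?phi1 ?mul1g //; exact: subgroup1.
have rp_eq q q' : (exists2 h, H h & q = phi h * q') -> rp q = rp q'.
  move=> [h Hh e1]; rewrite /rp; congr xget; apply/seteqP; split=> p [k Hk ->].
    by exists (k * h); [exact: HM|rewrite phiM // -mulgA -e1].
  exists (k * h^-1); first by apply: HM => //; exact: HV.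
  by rewrite phiM ?phiV // ?e1 -?mulgA ?mulKg //; exact: HV.
pose Ps := undup [seq rp q | q <- flatten [seq enum_fset (fset_set (P0 (x i))) | i <- enum I]].
have uPs : uniq Ps by exact: undup_uniq.
have Psinj : {in Ps &, forall p q, (exists2 h, H h & p = phi h * q) -> p = q}.
  move=> p q; rewrite !mem_undup => /mapP[p' _ ->] /mapP[q' _ ->] eqv.
  have rr q0 : rp (rp q0) = rp q0 by apply: rp_eq; exact: rpP.
  by rewrite -rr -(rr q'); exact: rp_eq.
have cover i q : P0 (x i) q -> exists p h, [/\ p \in Ps, H h & p = phi h * q].
  move=> Pq; have [h Hh e1] := rpP q; exists (rp q), h; split=> //.
  rewrite mem_undup; apply: map_f; apply/flattenP.
  exists (enum_fset (fset_set (P0 (x i)))); first by apply: map_f; rewrite mem_enum.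
  by rewrite in_fset_set // inE.
apply: (@leq_trans (a * \sum_(p <- Ps) setcard (P0^~ p))).
  by rewrite leq_mul2l transport_ge ?orbT.
apply: (@leq_trans (b * \sum_(p <- Ps) setcard (P1^~ p) + c * \sum_(p <- Ps) setcard (P2^~ p))).
  by rewrite !big_distrr -big_split /=; apply: leq_sum => p _; exact: le.
by apply: leq_add; rewrite leq_mul2l transport_le ?orbT.
Qed.

End Transport.

(** * Points crossed by edges, and tripods *)

Section Crossing.
Variables (G : groupType) (S : finite_generating_set G) (e : nat).
Hypothesis hypS : hyperbolic_with S e.
Local Notation d := (word_dist S).
Local Notation gp := (dgp S).

Section Counts.
Variable f : G -> G.

Definition crosses D y p : Prop :=
  exists2 s, s \in sgen S & (gp p (f y) (f (y * s)) <= D)%N.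

Definition tripod r M y p : Prop := exists u v w,
  [/\ (d y u <= r)%N, (d y v <= r)%N & (d y w <= r)%N] /\
  [/\ (gp p (f u) (f v) <= M)%N, (gp p (f v) (f w) <= M)%N & (gp p (f u) (f w) <= M)%N].

Lemma finite_crosses D y : finite_set (crosses D y).
Proof.
pose R := (\sum_(s <- sgen S) d (f y) (f (y * s)%g) + D)%N.
have [|//] := @setcard_cover _ S (crosses D y) R [:: f y].
move=> p [s sS ps]; exists (f y); rewrite ?mem_head // /R (big_rem s) //=.
by move: ps; rewrite /dgp; metric S (p, f y, f (y * s)); lia.
Qed.

Lemma crosses_ge y s : s \in sgen S -> (d (f y) (f (y * s)) < setcard (crosses 0 y))%N.
Proof.
move=> sS; have [p [p0 pn pG]] := dist_geodesic S (f y) (f (y * s)).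
set n := d _ _ in pn pG *.
rewrite -[n.+1](size_iota 0) -(size_map p); apply: seq_le_setcard.
- exact: finite_crosses.
- rewrite map_inj_in_uniq ?iota_uniq // => i j; rewrite !mem_iota => /andP[_ ii] /andP[_ jj] eij.
  wlog le : i j ii jj eij / (i <= j)%N.
    by move=> W; have [le|/ltnW le] := leqP i j; [exact: W|apply/esym/W].
  by have := pG i j; rewrite eij word_distxx; lia.
- move=> _ /mapP[i + ->]; rewrite mem_iota => /andP[_ ii]; exists s => //.
  have h1 := pG 0%N i; have h2 := pG i n; rewrite p0 in h1; rewrite pn in h2.
  by move: h1 h2; rewrite /dgp -/n (distC S (p i) (f y)); lia.
Qed.

Lemma crosses_le D y : (setcard (crosses D y) <= setcard (crosses 0 y) * #|` wball1 S (D + e)|)%N.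
Proof.
have [|_ //] := @setcard_cover _ S (crosses D y) (D + e) (fset_set (crosses 0 y)).
move=> p [s sS ps]; have [m mb pm] := near_geodesic hypS ps.
exists m; last by rewrite distC.
rewrite in_fset_set; last exact: finite_crosses.
by rewrite inE; exists s => //; rewrite /dgp -mb (distC S m) subnn.
Qed.

Lemma tripod_close M a b c p q :
  [/\ (gp p a b <= M)%N, (gp p b c <= M)%N & (gp p a c <= M)%N] ->
  [/\ (gp q a b <= M)%N, (gp q b c <= M)%N & (gp q a c <= M)%N] ->
  (d p q <= M + e)%N.
Proof.
move=> [p1 p2 p3] [q1 q2 q3].
have h1 := hypS p a q b; have h2 := hypS p b q c; have h3 := hypS p a q c.
have k1 := hypS q a p b; have k2 := hypS q b p c; have k3 := hypS q a p c.
move: h1 h2 h3 k1 k2 k3; rewrite !(gpC S p q) !(gpC S q p).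
have s u : (gp p u q + gp q u p = 2 * d p q)%N by rewrite /dgp; metric S (p, q, u); lia.
have := s a; have := s b; have := s c; lia.
Qed.

(** A triple of values has one coarse centre and [y] has boundedly many triples nearby. The bound
    does not involve [f], so singular points become rare when the energy grows. *)
Lemma tripod_count r M y : finite_set (tripod r M y) /\
  (setcard (tripod r M y) <= #|` wball1 S r| ^ 3 * #|` wball1 S (M + e)|)%N.
Proof.
pose tri (uvw : G * G * G) p :=
  [/\ (gp p (f uvw.1.1) (f uvw.1.2) <= M)%N, (gp p (f uvw.1.2) (f uvw.2) <= M)%N
    & (gp p (f uvw.1.1) (f uvw.2) <= M)%N].
pose cen uvw := xget 1 (tri uvw).
pose B := enum_fset (wball S y r).
have sB : size B = #|` wball1 S r| by exact: (card_wball S y r).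
pose L := [seq cen (uv, w) | uv <- [seq (u, v) | u <- B, v <- B], w <- B].
have [|finA le] := @setcard_cover _ S (tripod r M y) (M + e) L.
  move=> p [u [v [w [[yu yv yw] t]]]]; exists (cen (u, v, w)).
    apply/allpairsP; exists ((u, v), w); split; rewrite ?wballP //.
    by apply/allpairsP; exists (u, v); split; rewrite ?wballP.
  apply: (tripod_close (a := f u) (b := f v) (c := f w)) => //.
  suff : tri (u, v, w) (cen (u, v, w)) by [].
  by apply: (@xgetPex _ 1); exists p.
split=> //; apply: (leq_trans le); rewrite !size_allpairs sB.
by rewrite leq_mul2r; apply/orP; right; rewrite !expnS expn0 muln1 mulnA.
Qed.

End Counts.

Section FindPoint.
Variables (H : set G) (phi : G -> G) (I : finType) (x : I -> G) (f : G -> G).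
Hypothesis HM : forall h h', H h -> H h' -> H (h * h').
Hypothesis HV : forall h, H h -> H h^-1.
Hypothesis phiM : forall h h', H h -> H h' -> phi (h * h') = phi h * phi h'.
Hypothesis phiI : forall h h', H h -> H h' -> phi h = phi h' -> h = h'.
Hypothesis xP : forall g, exists! i, H (g * (x i)^-1).
Hypothesis fH : forall h y, H h -> f (h * y) = phi h * f y.

Lemma crosses_mul D h y p : H h -> crosses f D y p -> crosses f D (h * y) (phi h * p).
Proof.
by move=> Hh [s sS ps]; exists s => //; rewrite -mulgA !(fH _ Hh) gp_mul2l.
Qed.

Lemma tripod_mul r M h y p : H h -> tripod f r M y p -> tripod f r M (h * y) (phi h * p).
Proof.
move=> Hh [u [v [w [dist t]]]]; exists (h * u), (h * v), (h * w).
by rewrite !dist_mul2l !(fH _ Hh) !gp_mul2l.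
Qed.

Lemma finite_fiber_crosses D p : finite_set ((crosses f D)^~ p).
Proof.
apply: (fiber_finite HM HV phiM phiI xP); first exact: crosses_mul.
by move=> i; exact: finite_crosses.
Qed.

Lemma finite_fiber_tripod r M p : finite_set ((tripod f r M)^~ p).
Proof.
apply: (fiber_finite HM HV phiM phiI xP); first exact: tripod_mul.
by move=> i; have [] := tripod_count f r M (x i).
Qed.

(** On average over the orbits, thick crossings exceed exact ones by a factor at most [CD] and
    tripods are bounded, while exact crossings grow with the energy. One half of the factor 2 pays
    for the thick crossings, the other for the weighted tripods. *)
Lemma find_point D r M B :
    (2 * #|` sgen S| * B * (#|` wball1 S r| ^ 3 * #|` wball1 S (M + e)|) * #|I| <
      \sum_i \sum_(s <- sgen S) d (f (x i)) (f (x i * s)%g))%N ->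
  exists p, let CD := #|` wball1 S (D + e)| in
    (setcard ((crosses f D)^~ p) + 2 * CD * B * setcard ((tripod f r M)^~ p) <
     2 * CD * setcard ((crosses f 0)^~ p))%N.
Proof.
set g := #|` sgen S|; set c2 := (_ ^ 3 * _)%N; set E := (\sum_i _)%N.
set CD := #|` wball1 S (D + e)| => ltE; apply: contrapT => N.
have CD0 : (0 < CD)%N by exact: wball1_gt0.
have := @mass_transport G H phi I x HM HV phiM phiI xP (crosses f 0) (crosses f D)
  (tripod f r M) (2 * CD) 1 (2 * CD * B).
move=> /(_ (@crosses_mul 0) (@crosses_mul D) (@tripod_mul r M)).
move=> /(_ (fun i => finite_crosses f 0 (x i)) (fun i => finite_crosses f D (x i))
  (fun i => (tripod_count f r M (x i)).1)).
move=> /(_ _)/wrap[p|].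
  rewrite mul1n leqNgt; apply/negP => lt; apply: N; exists p => /=.
  exact: lt.
rewrite mul1n; set n0 := (\sum_i setcard _)%N; set n1 := (\sum_i setcard _)%N.
set n2 := (\sum_i setcard _)%N => le.
have l1 : (n1 <= n0 * CD)%N.
  by rewrite /n0 big_distrl /=; apply: leq_sum => i _; exact: crosses_le.
have l2 : (n2 <= #|I| * c2)%N.
  by rewrite -sum_nat_const; apply: leq_sum => i _; have [] := tripod_count f r M (x i).
have l0 : (E <= g * n0)%N.
  rewrite /n0 big_distrr /=; apply: leq_sum => i _.
  have -> : (g * setcard (crosses f 0 (x i)) = \sum_(s <- sgen S) setcard (crosses f 0 (x i)))%N.
    by rewrite big_const_seq count_predT iter_addn_0 mulnC.
  by rewrite big_seq [leqRHS]big_seq; apply: leq_sum => s sS; apply/ltnW/crosses_ge.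
have l3 : (n0 <= 2 * B * (#|I| * c2))%N.
  have l4 : (2 * CD * B * n2 <= 2 * CD * B * (#|I| * c2))%N by rewrite leq_mul2l l2 orbT.
  rewrite -(leq_pmul2l CD0); move: le l1 l4; lia.
move: ltE; rewrite ltnNge => /negP; apply; apply: leq_trans l0 _.
rewrite (_ : 2 * g * B * c2 * #|I| = g * (2 * B * (#|I| * c2)))%N; last by lia.
by rewrite leq_mul2l l3 orbT.
Qed.

End FindPoint.
End Crossing.

(** * The thin side of a leaf *)

Section Leaf.
Variables (G : groupType) (S : finite_generating_set G) (e : nat).
Hypothesis hypS : hyperbolic_with S e.
Local Notation d := (word_dist S).
Local Notation gp := (dgp S).

Lemma central_mul t (A : set G) y x :
  central S t [set u | A (y * u)] x -> central S t A (y * x).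
Proof.
move=> [a [b [c [[Aa Ab Ac] abc]]]]; exists (y * a), (y * b), (y * c).
by rewrite !gp_mul2l.
Qed.

Lemma branching_mul t m (A : set G) y x :
  branching S t m [set u | A (y * u)] x -> branching S t m A (y * x).
Proof.
move=> [C [CA cross]]; exists (fun i => [seq y * a | a <- C i]); split=> [i|].
  have [uC CiA mC] := CA i; rewrite size_map map_inj_uniq //; last exact: mulgI.
  by split=> // _ /mapP[a aC ->]; exact: CiA.
move=> i j _ _ ij /mapP[a aC ->] /mapP[b bC ->].
have [ab le] := cross i j a b ij aC bC; rewrite gp_mul2l; split=> //.
by apply: contra_neq ab => /mulgI.
Qed.

(** A central point at distance more than half of [t] from [A] has three distinct witnesses, so it
    is branching with one point in each direction; the others lie in balls around [A]. *)
Lemma card_central t : exists c, forall (A F : {fset G}),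
  (forall z, z \in F -> central S t [set` A] z) -> (#|` F| <= c * #|` A|)%N.
Proof.
have [c cP] := card_branching hypS t; exists (#|` wball1 S t| + c)%N => A F FA.
pose F1 := [fset z in F | `[< branching S t 1 [set` A] z >]].
have h1 : (#|` F1| <= c * #|` A|)%N.
  have := cP A F1 1%N isT; rewrite muln1; apply=> z.
  by rewrite !inE => /andP[_ /asboolP].
have [|_ h2] := @setcard_cover _ S [set z | z \in F /\ z \notin F1] t (enum_fset A).
  move=> z [zF zF1]; apply: contrapT => far.
  have {}far a : a \in A -> (t < gp z a a)%N.
    rewrite gpxx => aA; rewrite ltnNge; apply/negP => le; apply: far.
    by exists a => //; rewrite distC; lia.
  move/negP: zF1; apply; rewrite !inE zF /=; apply/asboolP.
  have [a [b [c' [[Aa Ab Ac] [ab bc ac]]]]] := FA z zF.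
  exists (fun i : 'I_3 => [:: nth a [:: a; b; c'] i]); split.
    by case=> [[|[|[|]]]] //= ?; split=> // u; rewrite inE => /eqP->.
  have ne u v : u \in A -> (gp z u v <= t)%N -> u != v /\ (gp z u v <= t)%N.
    by move=> /far uf le; split=> //; apply/eqP => euv; move: uf; rewrite {2}euv ltnNge le.
  have ne' u v : v \in A -> (gp z v u <= t)%N -> u != v /\ (gp z u v <= t)%N.
    by move=> vA le; rewrite eq_sym gpC; exact: ne.
  by case=> [[|[|[|]]]] //= ? [[|[|[|]]]] //= ? u v //= _; rewrite !inE => /eqP-> /eqP->;
    (exact: ne || exact: ne').
rewrite mulnDl; apply: (@leq_trans (setcard [set z | z \in F /\ z \notin F1] + #|` F1|)).
  rewrite /setcard; apply: (leq_trans _ (leq_add (leqnn _) (leqnn _))).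
  rewrite -size_cat; apply: fset_le_seq => z zF; rewrite mem_cat.
  case: (boolP (z \in F1)) => zF1; rewrite ?orbT // orbF in_fset_set ?inE //.
  by apply: (@sub_finite_set _ _ [set` F]); [move=> ? []|exact: finite_fset].
by rewrite mulnC; apply: leq_add => //; rewrite mulnC.
Qed.

Lemma finite_central t (A : set G) : finite_set A -> finite_set (central S t A).
Proof.
move=> finA; pose L := enum_fset (fset_set A).
have AL a : A a -> a \in L by move=> Aa; rewrite in_fset_set ?inE.
pose R := (\sum_(a <- L) \sum_(b <- L) d a b + t)%N.
have [|//] := @setcard_cover _ S (central S t A) R L.
move=> z [a [b [c [[/AL aL /AL bL _] [ab _ _]]]]]; exists a => //.
rewrite /R (big_rem a) //= (big_rem b) //=.
by move: ab; rewrite /dgp; metric S (z, a, b); lia.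
Qed.

Section Fixed.
Variables (f : G -> G) (p : G).
Let cr u v := (gp p (f u) (f v) <= 2 * e)%N.
Let A : set G := (crosses S f (2 * e))^~ p.

(** Colours change only across crossing edges, so a path of non-crossing edges transports the colour
    of [v] to a non-central point. *)
Fixpoint reach j v : Prop :=
  if j is j'.+1 then reach j' v \/ exists s, [/\ s \in sgen S, ~~ cr v (v * s) & reach j' (v * s)]
  else ~ central S (central_bound e) A v.

Lemma reach_colour (col : G -> bool) y r :
    (forall u s, (d y u < r)%N -> s \in sgen S -> col u != col (u * s) -> cr u (u * s)) ->
  forall j v, reach j v -> (d y v + j <= r)%N ->
    exists z, [/\ (d v z <= j)%N, ~ central S (central_bound e) A z & col z = col v].
Proof.
move=> colr; elim=> [|j IHj] v /=; first by exists v; rewrite word_distxx.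
case=> [rj le|[s [sS nc rj]] le].
  by have [|z [vz ncz cz]] := IHj v rj; first lia; exists z; split=> //; lia.
have vs := dist_sgen v sS.
have [|z [vz ncz cz]] := IHj _ rj; first by metric S (y, v, v * s); lia.
exists z; split=> //; first by metric S (v, v * s, z); lia.
rewrite cz; apply/esym/eqP; apply: contraNT nc => ne; apply: (colr v s) => //.
by lia.
Qed.

Hypothesis one_ended : one_ended_graph S.
Hypothesis no_cut_pair : ~ exists a b : gromov_boundary S, cut_pair a b.

(** If both ends of the edge could leave the hull of the leaf, there would be non-central points of
    both colours near [y], which the local form of rigidity excludes when [y] is not branching. *)
Lemma thin_side J n r M m y s : (2 * e <= M)%N -> (n + J + 3 <= r)%N ->
    (forall (A : set G) (col : G -> bool) x y, (d 1 x <= J.+1)%N -> (d 1 y <= J.+1)%N ->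
      (forall u s, (d 1 u <= n)%N -> s \in sgen S -> col u != col (u * s) -> A u) ->
      ~ central S (central_bound e) A x -> ~ central S (central_bound e) A y ->
      col x != col y -> exists2 k, (k < n)%N & branching S k (m k) A 1) ->
    s \in sgen S -> gp p (f y) (f (y * s)) = 0%N -> ~ tripod S f r M y p ->
    (forall k, (k < n)%N -> ~ branching S k (m k) A y) ->
  ~ (reach J y /\ reach J (y * s)).
Proof.
move=> eM rn nP sS cys nt nb [ry rys].
(* The colour says that [p] separates [f u] from [f (y * s)]. Without a tripod near [y], [p] cannot
   also separate [f u] from [f y]; two hyperbolic inequalities then show that values of different
   colours have product at most [2 * e] at [p]. *)
pose col u := (gp p (f u) (f (y * s)) <= M)%N.
have ys := dist_sgen y sS.
have colT u : (d y u <= r)%N -> col u -> (M < gp p (f u) (f y))%N.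
  move=> yu cu; rewrite ltnNge; apply/negP => le; apply: nt.
  exists u, y, (y * s); rewrite word_distxx cys; split; split=> //.
  by apply: leq_trans ys _; lia.
have crossing u v : (d y u <= r)%N -> (d y v <= r)%N -> col u -> ~~ col v -> cr u v.
  move=> yu yv cu; rewrite /col -ltnNge => cv; have cu' := colT u yu cu.
  have h1 := hypS p (f y) (f v) (f (y * s)); have h2 := hypS p (f y) (f u) (f v).
  by move: h1 h2; rewrite cys (gpC S p (f y) (f u)) /cr; lia.
have colr u v : (d y u <= r)%N -> (d y v <= r)%N -> col u != col v -> cr u v.
  move=> yu yv; case Eu: (col u); case Ev: (col v) => // _.
    by apply: crossing; rewrite ?Ev.
  by rewrite /cr gpC; apply: crossing; rewrite ?Eu.
have colr' u t : (d y u < r)%N -> t \in sgen S -> col u != col (u * t) -> cr u (u * t).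
  move=> yu tS; apply: colr; first exact: ltnW.
  by have := dist_sgen u tS; metric S (y, u, u * t); lia.
have cy : col y by rewrite /col cys.
have cys' : ~~ col (y * s).
  apply/negP => c; apply: nt; exists (y * s), (y * s), (y * s).
  by have le : (d y (y * s) <= r)%N by lia.
have [|z1 [yz1 nc1 c1]] := reach_colour colr' ry; first by rewrite word_distxx; lia.
have [|z2 [yz2 nc2 c2]] := reach_colour colr' rys; first by lia.
have [||||||k kn br] := nP [set u | A (y * u)] (fun u => col (y * u)) (y^-1 * z1) (y^-1 * z2).
- by rewrite -(dist_mul2l S y) mulg1 mulKVg; lia.
- by rewrite -(dist_mul2l S y) mulg1 mulKVg; metric S (y, y * s, z2); lia.
- move=> u t un tS; rewrite mulgA => ne; exists t => //.
  apply: colr' => //; rewrite -[X in d X _]mulg1 dist_mul2l. apply: (leq_ltn_trans un); lia.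
- by move/central_mul; rewrite mulKVg.
- by move/central_mul; rewrite mulKVg.
- by rewrite !mulKVg c1 c2 cy (negbTE cys').
by apply: (nb k kn); have := branching_mul br; rewrite mulg1.
Qed.

End Fixed.

End Leaf.

(** * Cutting a bounded piece out of the thin side *)

Lemma geometric_sum_le (b : nat -> nat) a n :
  (forall k, (b k * 2 ^ k.+2 <= a)%N) -> (2 * \sum_(k < n) b k <= a)%N.
Proof.
move=> ba; suff h : (2 ^ n.+1 * \sum_(k < n) b k + a <= a * 2 ^ n)%N.
  have h2 : (2 ^ n * (2 * \sum_(k < n) b k) <= 2 ^ n * a)%N.
    by move: h; rewrite expnS; nia.
  by rewrite leq_pmul2l ?expn_gt0 in h2.
elim: n => [|n IHn]; first by rewrite big_ord0 muln0 muln1.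
rewrite big_ord_recr /=; have := ba n; move: IHn; rewrite !expnS.
move: (2 ^ n)%N (\sum_(i < n) b i)%N (b n) => u v w; nia.
Qed.

(** Pigeonhole; it selects a depth of the thin side from which few vertices have a non-crossing edge
    to the outside. *)
Lemma small_step (T : choiceType) (W : nat -> {fset T}) J : (0 < J)%N ->
  (forall j, W j.+1 `<=` W j) ->
  exists2 j, (j < J)%N & (J * #|` W j `\` W j.+1| <= #|` W 0%N|)%N.
Proof.
move=> J0 mono; apply: contrapT => N.
have tele K : (\sum_(j < K) #|` W j `\` W j.+1| + #|` W K| = #|` W 0%N|)%N.
  elim: K => [|K <-]; first by rewrite big_ord0.
  rewrite big_ord_recr /= -addnA; congr addn.
  by rewrite -(cardfsID (W K.+1) (W K)) (fsetIidPr (mono K)) addnC.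
have big (j : 'I_J) : (#|` W 0%N| < J * #|` W j `\` W j.+1|)%N.
  by rewrite ltnNge; apply/negP => le; apply: N; exists j.
have : (\sum_(j < J) #|` W 0%N| < \sum_(j < J) J * #|` W j `\` W j.+1|)%N.
  case: J J0 {N tele} big => // J _ big; rewrite !big_ord_recl /=.
  by rewrite -addSn; apply: leq_add; [exact: (big ord0)|apply: leq_sum => j _; apply/ltnW; exact: (big (lift ord0 j))].
by rewrite sum_nat_const card_ord -big_distrr /= ltn_pmul2l // -(tele J) ltnNge leq_addr.
Qed.

Section Piece.
Variables (G : groupType) (S : finite_generating_set G) (e : nat).
Hypothesis hypS : hyperbolic_with S e.
Hypothesis one_ended : one_ended_graph S.
Hypothesis no_cut_pair : ~ exists a b : gromov_boundary S, cut_pair a b.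
Local Notation d := (word_dist S).
Local Notation gp := (dgp S).

(** The second clause means that [f u] is at distance more than [M / 2] from [p], so that a push by
    [M / 2] does not stop short. *)
Definition good (f : G -> G) p M u : bool :=
  `[< crosses S f (2 * e) u p >] && (M < gp p (f u) (f u))%N.

(** Pushing [f] on [U] may stretch such an edge by the full depth of the push. *)
Definition loose (f : G -> G) p (U : {fset G}) u : bool :=
  has (fun s => (u * s \notin U) && ~~ (gp p (f u) (f (u * s)%g) <= 2 * e)%N) (sgen S).

Let CD := #|` wball1 S (3 * e)|.

Section FixedPoint.
Variables (f : G -> G) (p : G).
Let A : set G := (crosses S f (2 * e))^~ p.

(* The vertices not joined to the outside of the hull of A by a path of length
   at most j without crossing edges. *)
Definition thin j : set G := [set v | ~ reach S e f p j v].

Hypothesis finA : finite_set A.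

Lemma finite_thin j : finite_set (thin j).
Proof.
apply: (@sub_finite_set _ _ (central S (central_bound e) A)).
  move=> v nr; apply: contrapT => nc; apply: nr.
  by elim: j => [|j IHj] //=; left.
exact: finite_central.
Qed.

Lemma thin_in j v : (v \in fset_set (thin j)) = `[< ~ reach S e f p j v >].
Proof. by rewrite in_fset_set; [apply/idP/asboolP; rewrite inE|exact: finite_thin]. Qed.

Lemma thin_mono j : fset_set (thin j.+1) `<=` fset_set (thin j).
Proof.
apply/fsubsetP => v; rewrite !thin_in => /asboolP nr; apply/asboolP => r.
by apply: nr; left.
Qed.

Lemma thin_step j v s : s \in sgen S -> v \in fset_set (thin j) ->
  v * s \notin fset_set (thin j) -> ~~ (gp p (f v) (f (v * s)%g) <= 2 * e)%N ->
  v \in fset_set (thin j) `\` fset_set (thin j.+1).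
Proof.
move=> sS vj vsj nc; rewrite in_fsetD vj andbT thin_in; apply/asboolP => nr.
apply: nr; right; exists s; split=> //.
by move: vsj; rewrite thin_in => /asboolP /contrapT.
Qed.

Lemma card_thin C1 j : (forall (B F : {fset G}),
    (forall z, z \in F -> central S (central_bound e) [set` B] z) ->
    (#|` F| <= C1 * #|` B|)%N) ->
  (#|` fset_set (thin j)| <= C1 * setcard A)%N.
Proof.
apply=> z; rewrite thin_in => /asboolP nr; rewrite fset_setK //.
apply: contrapT => nc; apply: nr.
by elim: j => [|j IHj] //=; left.
Qed.

End FixedPoint.

(* Most points of the exact crossing set see the leaf in at most two directions
   at every scale. *)
Lemma typical_points (f : G -> G) p r M n (c : nat -> nat) :
    let A : set G := (crosses S f (2 * e))^~ p in
    let A0 : set G := (crosses S f 0)^~ p in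
    let Bad : set G := (tripod S f r M)^~ p in
    let m k := ((c k).+1 * (2 * CD) * 2 ^ k.+2)%N in
    (forall k (B F : {fset G}) m, (0 < m)%N ->
      (forall z, z \in F -> branching S k m [set` B] z) -> (#|` F| * m <= c k * #|` B|)%N) ->
    finite_set A -> finite_set A0 -> finite_set Bad ->
    (setcard A + 2 * CD * 4 * setcard Bad < 2 * CD * setcard A0)%N ->
  (setcard A0 <= 4 * setcard [set y | [/\ A0 y, ~ Bad y &
     forall k, (k < n)%N -> ~ branching S k (m k) A y]])%N.
Proof.
move=> A A0 Bad m cP finA finA0 finBad lt; set T := [set y | _].
have CD0 : (0 < CD)%N by exact: wball1_gt0.
have finT : finite_set T by apply: (sub_finite_set _ finA0) => y [].
pose F k := [fset y in fset_set A0 | `[< branching S k (m k) A y >]].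
(* The factors of [m k] compensate [c k] and the ratio of [A] to [A0]. The exceptional points of all
   scales then make up at most half of [A0], and [Bad] at most a quarter. *)
have Fk k : (#|` F k| * 2 ^ k.+2 <= setcard A0)%N.
  have m0 : (0 < m k)%N by rewrite /m muln_gt0 expn_gt0 andbT muln_gt0 /= muln_gt0 CD0.
  have := cP k (fset_set A) (F k) (m k) m0; rewrite fset_setK // => h.
  have {}h : (#|` F k| * m k <= c k * setcard A)%N.
    by apply: h => y; rewrite !inE => /andP[_ /asboolP].
  have lA : (c k * setcard A <= (c k).+1 * (2 * CD) * setcard A0)%N.
    rewrite -mulnA; apply: leq_mul; first exact: leqnSn.
    by apply: ltnW; apply: leq_ltn_trans lt; exact: leq_addr.
  have pos : (0 < (c k).+1 * (2 * CD))%N by rewrite muln_gt0 /= muln_gt0 CD0.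
  by have := leq_trans h lA; rewrite /m mulnCA leq_pmul2l.
have sumF := geometric_sum_le n Fk.
have bad4 : (4 * setcard Bad <= setcard A0)%N.
  rewrite -(leq_pmul2l (m := 2 * CD)) ?muln_gt0 //= mulnA; apply/ltnW.
  by apply: leq_ltn_trans lt; exact: leq_addl.
have : (setcard A0 <= setcard T + (setcard Bad + \sum_(k < n) #|` F k|))%N.
  have -> : (\sum_(k < n) #|` F k|)%N =
      size (flatten [seq enum_fset (F (k : 'I_n)) | k <- enum 'I_n]).
    by rewrite size_flatten /shape -map_comp sumnE big_map big_enum.
  rewrite {2 3}/setcard -!size_cat; apply: fset_le_seq => y; rewrite in_fset_set // inE => A0y.
  rewrite !mem_cat; apply/or3P.
  have [Bady|nBad] := pselect (Bad y).
    by apply: Or32; rewrite in_fset_set // inE.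
  have [[k [kn br]]|nbr] := pselect (exists k, (k < n)%N /\ branching S k (m k) A y).
    apply: Or33; apply/flattenP.
    exists (enum_fset (F k)); first by apply/mapP; exists (Ordinal kn); rewrite ?mem_enum.
    by rewrite !inE; apply/andP; split; [rewrite in_fset_set // inE|apply/asboolP].
  by apply: Or31; rewrite in_fset_set // inE; split=> // k kn br; apply: nbr; exists k.
move: bad4 sumF; lia.
Qed.

Lemma reach_le (f : G -> G) p j J v : (j <= J)%N -> reach S e f p j v -> reach S e f p J v.
Proof. by elim: J => [|J IHJ]; [rewrite leqn0 => /eqP->|rewrite leq_eqVlt => /orP[/eqP->//|/IHJ h /h]; left]. Qed.

Lemma one_ended_unbounded n : exists g : G, (n < d 1 g)%N.
Proof.
have [a [b [ra _ _]]] := opposite_rays one_ended.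
by exists (a n.+1); rewrite (is_ray_dist _ ra).
Qed.

(** Here [x] is the size of the thin side, [y] that of its loose boundary, [cg] the number of good
    vertices and [a0] the size of the exact leaf. *)
Lemma piece_arith c0 g T b1 v0 a0 cg x y J :
  (32 * b1 * c0 * g * v0 < J)%N -> (8 * b1 * c0.+1 * v0 < T)%N -> (0 < a0)%N -> (0 < b1)%N ->
  (x <= v0 * a0)%N -> (J * y <= v0 * a0)%N -> (a0 <= 4 * (cg * b1))%N ->
  (c0 * (x + 4 * g * T * y) + x < T * cg)%N.
Proof.
move=> JP TP a0P b1P xP yP cgP.
have hx : (8 * b1 * (c0.+1 * x) < T * a0)%N.
  apply: (@leq_ltn_trans (8 * b1 * c0.+1 * v0 * a0)); last by rewrite ltn_pmul2r.
  by rewrite -!mulnA !leq_mul2l xP !orbT.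
have hy : (32 * b1 * c0 * g * y <= a0)%N.
  have [v00|v0P] := posnP v0.
    have -> : y = 0%N by move: yP; rewrite v00 mul0n leqn0 muln_eq0 => /orP[/eqP J0|/eqP//]; rewrite J0 in JP.
    by rewrite muln0.
  rewrite -(leq_pmul2l v0P); apply: leq_trans yP.
  rewrite mulnA leq_mul2r; apply/orP; right; apply: leq_trans (ltnW JP).
  by rewrite mulnC.
have hy' : (32 * b1 * c0 * g * T * y <= T * a0)%N.
  rewrite (_ : 32 * b1 * c0 * g * T * y = T * (32 * b1 * c0 * g * y))%N; last by nia.
  by rewrite leq_mul2l hy orbT.
have hc : (2 * (T * a0) <= 8 * b1 * (T * cg))%N.
  have : (2 * T * a0 <= 2 * T * (4 * (cg * b1)))%N by rewrite leq_mul2l cgP orbT.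
  by lia.
rewrite -(ltn_pmul2l (m := 8 * b1)); last by rewrite muln_gt0.
apply: leq_trans hc; lia.
Qed.

(** [k0], [T] and [r] precede [M], since [M] will be twice a depth that depends on [T]. *)
Lemma bounded_piece : exists k0 T r, forall M (f : G -> G) p, (2 * e <= M)%N ->
    finite_set ((crosses S f (2 * e))^~ p) -> finite_set ((crosses S f 0)^~ p) ->
    finite_set ((tripod S f r M)^~ p) ->
    (setcard ((crosses S f (2 * e))^~ p) + 2 * CD * 4 * setcard ((tripod S f r M)^~ p) <
      2 * CD * setcard ((crosses S f 0)^~ p))%N ->
  exists z (U : {fset G}), (forall u, u \in U -> (d u z <= k0)%N) /\
    (\sum_(u <- U) (1 + 4 * #|` sgen S| * T * loose f p U u) <
      \sum_(u <- U) T * good f p M u)%N.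
Proof.
have /choice[c cP] := card_branching hypS.
have [C1 C1P] := card_central hypS (central_bound e).
pose m k := ((c k).+1 * (2 * CD) * 2 ^ k.+2)%N.
pose g := #|` sgen S|; pose b1 := #|` wball1 S 1|; pose c0 := #|` wball1 S (2 * e)|.
pose v0 := (C1 * (2 * CD))%N.
(* [J] makes the loose boundary a small fraction of the leaf; [T] makes the good vertices outweigh
   the whole thin side. *)
pose J := (32 * b1 * c0 * g * v0).+1; pose T := (8 * b1 * c0.+1 * v0).+1.
have [k0 k0P] := localize hypS one_ended_unbounded (4 * g * T).
have [n nP] := no_local_cut hypS one_ended no_cut_pair J.+1 m.
pose r := (n + J + 3)%N.
exists k0, T, r => M f p eM finA finA0 finBad lt.
set A : set G := (crosses S f (2 * e))^~ p in finA lt.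
set A0 : set G := (crosses S f 0)^~ p in finA0 lt.
set Bad : set G := (tripod S f r M)^~ p in finBad lt.
have := typical_points n cP finA finA0 finBad lt; set Ty := [set y | _] => typ.
pose W j := fset_set (thin f p j).
have [j jJ stepj] := small_step (ltn0Sn _ : 0 < J)%N (thin_mono finA).
pose V := W j; pose Dj := W j `\` W j.+1.
pose gd := good f p M.
have VgoodP : (setcard Ty <= count gd V * b1)%N.
  rewrite -size_filter; have [|_ //] := @setcard_cover _ S Ty 1 [seq v <- V | gd v].
  move=> y [[s sS cys] nBad nbr].
  have ys := dist_sgen y sS.
  have cys0 : gp p (f y) (f (y * s)) = 0%N by apply/eqP; rewrite -leqn0.
  have nclose v : (d y v <= 1)%N -> (M < gp p (f v) (f v))%N.
    move=> yv; rewrite ltnNge; apply/negP => le; apply: nBad; exists v, v, v.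
    by have yr : (d y v <= r)%N by rewrite /r; lia.
  have nreach := thin_side hypS eM (leqnn _) nP sS cys0 nBad nbr.
  have inV v : ~ reach S e f p J v -> v \in V.
    move=> nr; rewrite thin_in //; apply/asboolP => rj; apply: nr.
    exact: reach_le (ltnW jJ) rj.
  (* By [thin_side] one of [y], [y * s] stays in the thin side, and it is good; hence balls of
     radius 1 around good vertices cover [Ty]. *)
  have [ry|nry] := pselect (reach S e f p J y).
    exists (y * s); last by rewrite distC.
    rewrite mem_filter inV ?andbT; last by move=> rys; exact: nreach.
    rewrite /gd /good nclose // andbT; apply/asboolP; exists s^-1; first by rewrite sgenV.
    by rewrite mulgK gpC cys0.
  exists y; last by rewrite word_distxx.
  rewrite mem_filter inV // andbT /gd /good nclose ?word_distxx // andbT.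
  by apply/asboolP; exists s => //; rewrite cys0.
have crdA : (setcard A <= 2 * CD * setcard A0)%N.
  by apply: ltnW; apply: leq_ltn_trans lt; exact: leq_addr.
have Wle i : (#|` W i| <= v0 * setcard A0)%N.
  apply: leq_trans (card_thin finA i C1P) _.
  by rewrite /v0 -mulnA leq_mul2l crdA orbT.
have a0P : (0 < setcard A0)%N.
  rewrite lt0n; apply/eqP => a00; by move: lt; rewrite a00 muln0 ltn0.
(* A loose edge of [U] either stays in [V] and is charged by [localize], or leaves [V] without
   crossing and starts in [Dj], where [c] charges the same amount. *)
have [|z [U [UV Uz Ult]]] := k0P V (fun u => T * gd u)%N (fun u => 1 + 4 * g * T * (u \in Dj))%N.
  rewrite big_split /= -!big_distrr /= -!count_sum big_const_seq count_predT iter_addn_0 mul1n.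
  apply: (@leq_ltn_trans (c0 * (#|` V| + 4 * g * T * #|` Dj|) + #|` V|)).
    rewrite leq_add2r leq_mul2l leq_add2l leq_mul2l; apply/orP; right; apply/orP; right.
    by apply: count_le_size => [|x _]; [exact: fset_uniq|].
  apply: (@piece_arith _ _ _ b1 v0 (setcard A0) _ _ _ J) => //.
  - exact: wball1_gt0.
  - exact: Wle.
  - exact: leq_trans stepj (Wle 0%N).
  - by apply: leq_trans typ _; rewrite leq_mul2l VgoodP.
exists z, U; split=> //; apply: leq_ltn_trans Ult.
rewrite big_seq [leqRHS]big_seq; apply: leq_sum => u uU.
rewrite -addnA leq_add2l -mulnDr leq_mul2l; apply/orP; right.
rewrite /loose; case: hasP => //= -[s sS /andP[usU nc]].
case: (boolP (u * s \in V)) => usV.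
  apply: leq_trans (leq_addl _ _); rewrite lt0b; apply/hasP; exists s => //.
  by rewrite usV.
by rewrite (thin_step finA sS (UV _ uU) usV nc).
Qed.

End Piece.

(** * Decreasing the energy *)

Lemma sum_sub_seq (T : eqType) (s1 s2 : seq T) (F : T -> nat) :
  uniq s1 -> uniq s2 -> {subset s1 <= s2} -> (\sum_(x <- s1) F x <= \sum_(x <- s2) F x)%N.
Proof.
move=> u1 u2 sub; have p12 : perm_eq s1 [seq x <- s2 | x \in s1].
  apply: uniq_perm; rewrite ?filter_uniq // => x; rewrite mem_filter.
  by case: (boolP (x \in s1)) => //= /sub ->.
rewrite (perm_big _ p12) big_filter big_mkcond; apply: leq_sum => x _.
by case: ifP.
Qed.

Section Surgery.
Variables (G : groupType) (S : finite_generating_set G) (e : nat).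
Hypothesis hypS : hyperbolic_with S e.
Local Notation d := (word_dist S).
Local Notation gp := (dgp S).

Lemma push_exists m p a : exists a', d a a' = minn m (d a p) /\ d a' p = (d a p - minn m (d a p))%N.
Proof. by have [a' [h1 h2]] := dist_between (geq_minr m (d a p)); exists a'. Qed.

Variables (H : set G) (phi : G -> G) (I : finType) (x : I -> G) (f : G -> G).
Hypothesis HM : forall h h', H h -> H h' -> H (h * h').
Hypothesis HV : forall h, H h -> H h^-1.
Hypothesis phiM : forall h h', H h -> H h' -> phi (h * h') = phi h * phi h'.
Hypothesis phiI : forall h h', H h -> H h' -> phi h = phi h' -> h = h'.
Hypothesis xP : forall g, exists! i, H (g * (x i)^-1).
Hypothesis fH : forall h y, H h -> f (h * y) = phi h * f y.
Variables (k0 m : nat) (p z : G) (U : {fset G}).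
Hypothesis Hsep : forall h v, H h -> (d v (h * v) <= 2 * k0 + 4)%N -> h = 1.
Hypothesis Uz : forall u, u \in U -> (d u z <= k0)%N.

Let energy (F : G -> G) y := (\sum_(s <- sgen S) d (F y) (F (y * s)%g))%N.

Lemma energy_invariant (F : G -> G) h y : (forall h y, H h -> F (h * y) = phi h * F y) ->
  H h -> energy F (h * y) = energy F y.
Proof.
move=> FH Hh; apply: eq_bigr => s _.
by rewrite -mulgA !(FH _ _ Hh) dist_mul2l.
Qed.

(** Two steps beyond the radius of [U] contain every edge whose energy is affected, seen from either
    end. *)
Lemma orbit_inj h h' u u' : H h -> H h' -> (d u z <= k0 + 2)%N -> (d u' z <= k0 + 2)%N ->
  h * u = h' * u' -> h = h' /\ u = u'.
Proof.
move=> Hh Hh' uz uz' eq1.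
have eq2 : (h'^-1 * h) * u = u' by rewrite -mulgA eq1 mulKg.
have e1 : h'^-1 * h = 1.
  apply: (Hsep (v := u)); first by apply: HM => //; exact: HV.
  by rewrite eq2; metric S (u, u', z); lia.
split; last by rewrite -eq2 e1 mul1g.
by apply: (mulgI h'^-1); rewrite e1 mulVg.
Qed.

Lemma equivariant_extension (g : G -> G) : (forall u, u \notin U -> g u = f u) ->
  exists f' : G -> G, [/\ forall h y, H h -> f' (h * y) = phi h * f' y,
    forall w, (d w z <= k0 + 2)%N -> f' w = g w &
    forall y, (forall h u, H h -> u \in U -> y <> h * u) -> f' y = f y].
Proof.
move=> gU; have Uz2 u : u \in U -> (d u z <= k0 + 2)%N by move=> /Uz; lia.
have /choice[f' f'P] : forall y, exists v,
    (forall h u, H h -> u \in U -> y = h * u -> v = phi h * g u) /\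
    ((forall h u, H h -> u \in U -> y <> h * u) -> v = f y).
  move=> y; have [[h [u [Hh uU ey]]]|N] := pselect (exists h u, [/\ H h, u \in U & y = h * u]).
    exists (phi h * g u); split=> [h' u' Hh' uU' ey'|]; last by move/(_ h u Hh uU).
    have [-> ->] // : h = h' /\ u = u'.
    by apply: orbit_inj; rewrite -?ey -?ey' //; exact: Uz2.
  exists (f y); split=> // h u Hh uU ey; exfalso; apply: N; by exists h, u.
exists f'; split=> [h y Hh|w wz|y]; last by have [] := f'P y.
- have [[k [u [Hk uU ey]]]|N] := pselect (exists k u, [/\ H k, u \in U & y = k * u]).
    have [f1 _] := f'P y; have [f2 _] := f'P (h * y).
    rewrite (f1 k u) // (f2 (h * k) u) ?ey ?mulgA //; last exact: HM.
    by rewrite phiM.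
  have [_ ->] := f'P y; last by move=> k u Hk uU ey; apply: N; exists k, u.
  have [_ ->] := f'P (h * y); first by rewrite fH.
  move=> k u Hk uU ey; apply: N; exists (h^-1 * k), u; split=> //.
    by apply: HM => //; exact: HV.
  by rewrite -mulgA -ey mulKg.
- have subgroup1' := subgroup1 HM HV xP; have p1 := phi1 HM HV phiM xP.
  case: (boolP (w \in U)) => wU.
    by have [f1 _] := f'P w; rewrite (f1 1 w) ?mul1g ?p1 ?mul1g.
  have [_ ->] := f'P w; first by rewrite gU.
  move=> h u Hh uU ew; have [_ ewu] : 1 = h /\ w = u.
    by apply: orbit_inj; rewrite ?mul1g //; exact: Uz2.
  by rewrite ewu uU in wU.
Qed.

Let W : {fset G} := (U `|` [fset u * s | u in U, s in sgen S])%fset.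

Lemma W_z w : w \in W -> (d w z <= k0 + 1)%N.
Proof.
rewrite in_fsetU => /orP[/Uz|/imfset2P[u /Uz uz [s sS ->]]]; first by lia.
apply: leq_trans (word_dist_triangle S u _ _) _.
by rewrite addnC; apply: leq_add => //; rewrite distC; exact: dist_sgen.
Qed.

(** Only orbits of [U] and its neighbours see the change, and each such orbit meets [W] once. The
    form with sums on both sides avoids subtraction in [nat]. *)
Lemma sum_change (f' : G -> G) :
    (forall h y, H h -> f' (h * y) = phi h * f' y) ->
    (forall y, (forall h u, H h -> u \in U -> y <> h * u) -> f' y = f y) ->
  (\sum_i energy f' (x i) + \sum_(w <- W) energy f w =
   \sum_i energy f (x i) + \sum_(w <- W) energy f' w)%N.
Proof.
move=> f'H f'U; pose s := [seq idx xP w | w <- W].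
have us : uniq s.
  rewrite map_inj_in_uniq ?fset_uniq // => w w' wW wW' ei.
  have h1 := hpartK xP w; have h2 := hpartK xP w'.
  have [_ //] : (hpart xP w)^-1 = (hpart xP w')^-1 /\ w = w'.
  apply: orbit_inj.
  - by apply: HV; exact: hpartP.
  - by apply: HV; exact: hpartP.
  - by have := W_z wW; lia.
  - by have := W_z wW'; lia.
  - by rewrite -{2}h1 -{2}h2 !mulKg ei.
have toS (F : G -> G) : (forall h y, H h -> F (h * y) = phi h * F y) ->
    (\sum_(w <- W) energy F w = \sum_(i in s) energy F (x i))%N.
  move=> FH; rewrite -(big_uniq _ us) /= /s big_map; apply: eq_bigr => w _.
  by rewrite -{1}(hpartK xP w) energy_invariant //; exact: hpartP.
have out i : i \notin s -> energy f' (x i) = energy f (x i).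
  move=> nis; rewrite /energy big_seq [RHS]big_seq; apply: eq_bigr => t tS.
  have nW h w : H h -> w \in W -> x i <> h * w.
    move=> Hh wW ex; move/negP: nis; apply; apply/mapP; exists w => //.
    by rewrite -(idx_x HM HV xP i) ex idx_mul.
  have -> : f' (x i) = f (x i).
    by apply: f'U => h u Hh uU; apply: nW => //; rewrite in_fsetU uU.
  suff -> : f' (x i * t) = f (x i * t) by [].
  apply: f'U => h u Hh uU /(congr1 (fun y => y * t^-1)); rewrite mulgK -mulgA.
  apply: nW => //; rewrite in_fsetU; apply/orP; right.
  by apply: in_imfset2 => //=; rewrite sgenV.
rewrite (toS f fH) (toS f' f'H) (bigID (mem s)) /= [in RHS](bigID (mem s)) /=.
have -> : (\sum_(i | i \notin s) energy f' (x i) = \sum_(i | i \notin s) energy f (x i))%N.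
  exact: eq_bigr.
by rewrite addnAC [RHS]addnAC; congr addn; exact: addnC.
Qed.

Let cr u v := (gp p (f u) (f v) <= 2 * e)%N.

Lemma push_crossing a a' b : d a a' = minn m (d a p) ->
  d a' p = (d a p - minn m (d a p))%N -> (gp p a b <= 2 * e)%N ->
  (d a' b + minn m (d a p) <= d a b + 2 * e)%N.
Proof. by rewrite /dgp; metric S (a, a', b, p); lia. Qed.

Lemma push_lipschitz a a' b b' : d a a' = minn m (d a p) ->
  d a' p = (d a p - minn m (d a p))%N -> d b b' = minn m (d b p) ->
  d b' p = (d b p - minn m (d b p))%N -> (d a' b' <= d a b + 2 * e)%N.
Proof.
move=> a1 a2 b1 b2; have h1 := hypS p a' a b; have h2 := hypS p a' b b'.
by move: a1 a2 b1 b2 h1 h2; rewrite /dgp; metric S (a, a', b, b', p); lia.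
Qed.

(** A good vertex saves about [m] on a crossing edge, a loose vertex loses at most about [m] per
    edge, and every edge costs a multiple of [e]; the depth [m] dominates the last cost even after
    division by [T]. *)
Lemma surgery T : (T * (#|` sgen S| * (6 * e)) <= m)%N -> (0 < m)%N ->
    (\sum_(u <- U) (1 + 4 * #|` sgen S| * T * loose S e f p U u) <
      \sum_(u <- U) T * good S e f p (2 * m) u)%N ->
  exists2 f' : G -> G, (forall h y, H h -> f' (h * y) = phi h * f' y) &
    (\sum_i energy f' (x i) < \sum_i energy f (x i))%N.
Proof.
move=> Tm m0 gain; set c := #|` sgen S| in Tm gain.
have /choice[psh pshP] := push_exists m p.
pose g u := if u \in U then psh (f u) else f u.
have gU u : u \notin U -> g u = f u by rewrite /g => /negbTE->.
have gI u : u \in U -> g u = psh (f u) by rewrite /g => ->.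
have [f' [f'H f'g f'f]] := equivariant_extension gU.
exists f' => //.
have change := sum_change f'H f'f.
suff lt : (\sum_(w <- W) energy f' w < \sum_(w <- W) energy f w)%N by move: change lt; lia.
have eg (w : G) : w \in W -> energy f' w = energy g w.
  move=> wW; rewrite /energy big_seq [RHS]big_seq; apply: eq_bigr => s sS.
  have := W_z wW; have := dist_sgen w sS => h1 h2.
  have ws : (d (w * s) z <= k0 + 2)%N by metric S (w, w * s, z); lia.
  have wz : (d w z <= k0 + 2)%N by lia.
  by rewrite !f'g.
rewrite big_seq (eq_bigr _ eg) -big_seq.
pose nc u v := (v \notin U) && ~~ cr u v.
pose far u := (2 * m < gp p (f u) (f u))%N.
have inner (u v : G) : u \in U ->
    (d (g u) (g v) + m * (cr u v && far u) <= d (f u) (f v) + (4 * e + m * nc u v))%N.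
  move=> uU; rewrite (gI u uU); have [p1 p2] := pshP (f u).
  have farm : far u -> minn m (d (f u) p) = m.
    by rewrite /far gpxx (distC S p) => lt; apply/minn_idPl; lia.
  rewrite /nc; case: (boolP (v \in U)) => vU /=.
    rewrite (gI _ vU); have [q1 q2] := pshP (f v).
    have lip := push_lipschitz p1 p2 q1 q2.
    case: (boolP (cr u v)) => c1; rewrite ?muln0 ?addn0 /=; last by lia.
    case: (boolP (far u)) => [/farm mE|_]; rewrite ?muln0 ?muln1 ?addn0; last by lia.
    have : (d (psh (f v)) p <= d (f v) p)%N by rewrite q2 leq_subr.
    move: c1 p1 p2; rewrite /cr /dgp mE.
    by metric S (f u, psh (f u), f v, psh (f v), p); lia.
  rewrite (gU _ vU); case: (boolP (cr u v)) => c1; rewrite ?muln0 ?muln1 ?addn0 /=.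
    have := push_crossing p1 p2 c1; case: (boolP (far u)) => [/farm->|_];
      rewrite ?muln0 ?muln1; lia.
  have : (d (f u) (psh (f u)) <= m)%N by rewrite p1 geq_minl.
  by metric S (f u, psh (f u), f v); lia.
have outer (w v : G) : w \notin U ->
    (d (g w) (g v) <= d (f w) (f v) + (v \in U) * (2 * e + m * nc v w))%N.
  move=> wU; rewrite (gU w wU) /nc wU; case: (boolP (v \in U)) => vU /=; last first.
    by rewrite gU // mul0n addn0.
  rewrite gI // mul1n; have [p1 p2] := pshP (f v).
  case: (boolP (cr v w)) => c1; rewrite ?muln0 ?muln1 ?addn0 /=.
    by have := push_crossing p1 p2 c1; metric S (psh (f v), f v, f w); lia.
  have : (d (f v) (psh (f v)) <= m)%N by rewrite p1 geq_minl.
  by metric S (f w, psh (f v), f v); lia.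
pose h (u s : G) := ((u * s \notin U)%g * (2 * e + m * nc u (u * s)%g))%N.
pose h' (w s : G) := ((w * s \in U)%g * (2 * e + m * nc (w * s)%g w))%N.
(* The energy counts every edge from both ends; the edges entering [U] from [W] are reindexed as
   edges leaving [U]. *)
have reverse : (\sum_(w <- W | w \notin U) \sum_(s <- sgen S)
      h' w s <=
    \sum_(u <- U) \sum_(s <- sgen S) h u s)%N.
  rewrite exchange_big /= [leqRHS]exchange_big /=.
  have pV : perm_eq [seq s^-1 | s <- sgen S] (sgen S).
    apply: uniq_perm; rewrite ?fset_uniq ?map_inj_uniq ?fset_uniq //; first exact: invg_inj.
    move=> s; apply/mapP/idP => [[t tS ->]|sS]; first by rewrite sgenV.
    by exists s^-1; rewrite ?sgenV ?invgK.
  have -> : (\sum_(s <- sgen S) \sum_(u <- U) h u s =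
      \sum_(s <- sgen S) \sum_(u <- U) h u s^-1)%N.
    by rewrite -(perm_big _ pV) big_map.
  apply: leq_sum => s _.
  pose mul_s (w : G) := w * s.
  apply: (@leq_trans (\sum_(v <- [seq mul_s w | w <- W & (w \notin U) && (mul_s w \in U)])
    h v s^-1)).
    rewrite big_map big_filter big_mkcond [leqRHS]big_mkcond; apply: leq_sum => w _ /=.
    rewrite /h /h' /mul_s mulgK; case: (boolP (w \in U)) => //= wU.
    by case: (_ \in U); rewrite ?mul1n ?mul0n.
  apply: sum_sub_seq; rewrite ?fset_uniq //.
    by rewrite map_inj_in_uniq ?filter_uniq ?fset_uniq // => a b _ _; exact: mulIg.
  by move=> v /mapP[w + ->]; rewrite mem_filter => /andP[/andP[_ ]].
have split (F : G -> nat) : (\sum_(w <- W) F w = \sum_(u <- U) F u + \sum_(w <- W | w \notin U) F w)%N.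
  rewrite (bigID (mem U)) /=; congr addn; rewrite -big_filter; apply: perm_big.
  apply: uniq_perm; rewrite ?filter_uniq ?fset_uniq // => w; rewrite mem_filter.
  by case: (boolP (w \in U)) => //= wU; rewrite in_fsetU wU.
(* The 6 is 4 from [inner] plus 2 from the reversed edges. *)
move Ec6 : (6 * e)%N Tm => c6 Tm.
rewrite !split; set c5 := (c * c6)%N in Tm.
pose gd u := good S e f p (2 * m) u; pose ls u := loose S e f p U u.
have perU (u : G) : u \in U -> (energy g u + m * gd u + \sum_(s <- sgen S) h u s <=
    energy f u + c5 + 2 * m * c * ls u)%N.
  move=> uU.
  have hg : (m * gd u <= \sum_(s <- sgen S) m * (cr u (u * s)%g && far u))%N.
    rewrite /gd /good -/(far u); case: (boolP (far u)) => fu; last by rewrite andbF muln0.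
    case: asboolP => [[s sS c1]|_]; rewrite ?muln0 //.
    by rewrite (big_rem s) //= (_ : cr u (u * s)) // leq_addr.
  have hs (s : G) : s \in sgen S -> (d (g u) (g (u * s)%g) + m * (cr u (u * s)%g && far u) + h u s <=
      d (f u) (f (u * s)%g) + c6 + 2 * m * ls u)%N.
    move=> sS; have := inner u (u * s) uU; rewrite /h.
    have le : (m * nc u (u * s)%g <= m * ls u)%N.
      rewrite leq_mul2l; apply/orP; right.
      rewrite /ls /loose /nc; case: hasP => // N; first by case: (_ && _).
      rewrite leqn0; apply/eqP; case: (boolP (_ && _)) => // us.
      by exfalso; apply: N; exists s.
    by move: le; case: (u * s \notin U); rewrite ?mul1n ?mul0n; lia.
  have {}hs : (\sum_(s <- sgen S) (d (g u) (g (u * s)%g) + m * (cr u (u * s)%g && far u) + h u s) <=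
      \sum_(s <- sgen S) (d (f u) (f (u * s)%g) + c6 + 2 * m * ls u))%N.
    by rewrite big_seq [leqRHS]big_seq; apply: leq_sum => s sS; exact: hs.
  move: hs; rewrite !big_split /= !(big_const_seq _ _ (sgen S)) !count_predT !iter_addn_0 -/c => hs.
  rewrite (_ : 2 * m * c * ls u = 2 * m * ls u * c)%N; last by lia.
  rewrite /c5 [(c * _)%N]mulnC; apply: (leq_trans _ hs); rewrite leq_add2r.
  by rewrite leq_add2l.
have inU : (\sum_(u <- U) energy g u + m * \sum_(u <- U) gd u + \sum_(u <- U) \sum_(s <- sgen S) h u s <=
    \sum_(u <- U) energy f u + c5 * #|` U| + 2 * m * c * \sum_(u <- U) ls u)%N.
  have -> : (c5 * #|` U| = \sum_(u <- U) c5)%N.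
    by rewrite big_const_seq count_predT iter_addn_0.
  rewrite !big_distrr -!big_split /= big_seq [leqRHS]big_seq; apply: leq_sum => u uU.
  exact: perU.
have perW (w : G) : w \notin U ->
    (energy g w <= energy f w + \sum_(s <- sgen S) h' w s)%N.
  move=> wU; rewrite -big_split /= /energy; apply: leq_sum => s _.
  exact: (outer w (w * s) wU).
have offU : (\sum_(w <- W | w \notin U) energy g w <= \sum_(w <- W | w \notin U) energy f w +
    \sum_(u <- U) \sum_(s <- sgen S) h u s)%N.
  apply: leq_trans (leq_add (leqnn _) reverse); rewrite -big_split /=.
  by apply: leq_sum => w wU; exact: perW.
have key : (c5 * #|` U| + 2 * m * c * \sum_(u <- U) ls u < m * \sum_(u <- U) gd u)%N.
  move: gain; rewrite big_split /= -!big_distrr /= big_const_seq count_predT iter_addn_0 mul1n.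
  rewrite -/gd -/ls; move: (\sum_(u <- U) ls u)%N (\sum_(u <- U) gd u)%N #|` U| => L D u gain.
  have T0 : (0 < T)%N by case: (T) gain => //; rewrite mul0n ltn0.
  rewrite -(ltn_pmul2l T0) (_ : T * (m * D) = m * (T * D))%N; last by lia.
  apply: (@leq_ltn_trans (m * (u + 4 * c * T * L))); last by rewrite ltn_pmul2l.
  rewrite !mulnDr; apply: leq_add; last by nia.
  by rewrite mulnA leq_mul2r Tm orbT.
have := leq_add inU offU.
move: key; lia.
Qed.

End Surgery.

Section EnergyBound.
Variables (G : groupType) (S : finite_generating_set G) (e : nat).
Hypothesis hypS : hyperbolic_with S e.
Hypothesis one_ended : one_ended_graph S.
Hypothesis no_cut_pair : ~ exists a b : gromov_boundary S, cut_pair a b.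
Local Notation d := (word_dist S).

Lemma energy_bound : exists k K, forall (H : set G) (phi : G -> G) (I : finType) (x : I -> G),
    (forall h h', H h -> H h' -> H (h * h')) -> (forall h, H h -> H h^-1) ->
    (forall h h', H h -> H h' -> phi (h * h') = phi h * phi h') ->
    (forall h h', H h -> H h' -> phi h = phi h' -> h = h') ->
    (forall g, exists! i, H (g * (x i)^-1)) ->
    (forall h v, H h -> (d v (h * v) <= k)%N -> h = 1) ->
  exists2 f : G -> G, forall h y, H h -> f (h * y) = phi h * f y &
    (\sum_i \sum_(s <- sgen S) d (f (x i)) (f (x i * s)%g) <= K * #|I|)%N.
Proof.
have [k0 [T [r pieceP]]] := bounded_piece hypS one_ended no_cut_pair.
(* The summand [e] ensures [2 * e <= M], and the successor makes [m] positive. *)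
pose m := (T * (#|` sgen S| * (6 * e)) + e).+1; pose M := (2 * m)%N.
exists (2 * k0 + 4)%N.
exists (2 * #|` sgen S| * 4 * (#|` wball1 S r| ^ 3 * #|` wball1 S (M + e)|))%N.
move=> H phi I x HM HV phiM phiI xP Hsep.
pose E (f : G -> G) := (\sum_i \sum_(s <- sgen S) d (f (x i)) (f (x i * s)%g))%N.
pose P n := `[< exists2 f : G -> G, forall h y, H h -> f (h * y) = phi h * f y & E f = n >].
have exP : exists n, P n.
  (* Any equivariant map starts the minimisation; this one sends each coset representative to 1. *)
  pose f y := phi (hpart xP y); exists (E f); apply/asboolP; exists f => // h y Hh.
  have [Hy e1] := (hpartP xP y, idx_mul HM xP y Hh).
  by rewrite /f {1}/hpart e1 -mulgA phiM.
case: (ex_minnP exP) => n /asboolP[f fH Ef] minE.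
exists f => //; rewrite -/(E f) leqNgt; apply/negP => ltE.
have [p pP] := find_point hypS HM HV phiM phiI xP fH (2 * e) ltE.
have eM : (2 * e <= M)%N by rewrite /M /m; lia.
have e3 : (2 * e + e = 3 * e)%N by lia.
rewrite /= e3 in pP.
have fin := finite_fiber_crosses S HM HV phiM phiI xP fH.
have [z [U [Uz gain]]] := pieceP M f p eM (fin _ p) (fin _ p)
  (finite_fiber_tripod hypS HM HV phiM phiI xP fH r M p) pP.
have Tm : (T * (#|` sgen S| * (6 * e)) <= m)%N by rewrite /m; lia.
have [f' f'H ltE'] := surgery hypS HM HV phiM xP fH Hsep Uz Tm (ltn0Sn _) gain.
have : P (E f') by apply/asboolP; exists f'.
by move/minE; rewrite -Ef leqNgt ltE'.
Qed.

End EnergyBound.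

(** * Stable lengths *)

Section Fekete.
Local Open Scope ring_scope.
Variables (R : realType) (u : nat -> nat).
Hypothesis u0 : u 0%N = 0%N.
Hypothesis uD : forall m n, (u (m + n) <= u m + u n)%N.

Lemma subadditive_mul m n : (u (m * n) <= m * u n)%N.
Proof.
elim: m => [|m IH]; first by rewrite !mul0n u0.
by rewrite !mulSn; apply: leq_trans (uD _ _) _; rewrite leq_add2l.
Qed.

Let v n : R := (u n)%:R / n%:R.

Lemma subadditive_quotient_le m n : (0 < m)%N -> (0 < n)%N -> v n <= v m + (m * u 1)%:R / n%:R.
Proof.
move=> m0 n0; have le : (u n * m <= n * u m + m * u 1 * m)%N.
  have u1 : (u n <= n %/ m * u m + n %% m * u 1)%N.
    rewrite {1}(divn_eq n m); apply: leq_trans (uD _ _) _.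
    by apply: leq_add; [exact: subadditive_mul|rewrite -{1}[(n %% m)%N]muln1; exact: subadditive_mul].
  apply: (@leq_trans ((n %/ m * u m + n %% m * u 1) * m)); first by rewrite leq_mul2r u1 orbT.
  rewrite mulnDl; apply: leq_add; first by rewrite mulnAC leq_mul2r leq_trunc_div orbT.
  by rewrite !leq_mul2r (ltnW (ltn_pmod _ _)) ?orbT.
have mR : 0 < m%:R :> R by rewrite ltr0n.
have nR : 0 < n%:R :> R by rewrite ltr0n.
rewrite /v -(ler_pM2r nR) mulrDl !divfK ?gt_eqF // -(ler_pM2r mR) mulrDl.
rewrite mulrAC divfK ?gt_eqF // -!natrM -natrD ler_nat.
by rewrite [(u m * n)%N]mulnC.
Qed.

Lemma fekete : (forall n, (0 < n)%N -> limn v <= v n) /\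
  (forall eps, 0 < eps -> exists N, forall n, (N <= n)%N -> v n <= limn v + eps).
Proof.
pose A := [set v n.+1 | n in [set: nat]].
have A0 : A !=set0 by exists (v 1); exists 0%N.
have lbA : lbound A 0 by move=> _ [n _ <-]; rewrite divr_ge0.
have infA : has_inf A by split=> //; exists 0.
have le_inf n : (0 < n)%N -> inf A <= v n.
  by case: n => // n _; apply: inf_lbound; [case: infA|exists n].
have ev eps : 0 < eps -> exists N, forall n, (N <= n)%N -> v n <= inf A + eps.
  move=> eps0; have e2 : 0 < eps / 2 by rewrite divr_gt0.
  have [_ [m _ <-] lt1] := inf_adherent e2 infA.
  pose c : R := (m.+1 * u 1)%:R; exists (Num.bound (c / (eps / 2))).+1 => n le_n.
  have n0 : (0 < n)%N by apply: leq_trans le_n.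
  have := subadditive_quotient_le (ltn0Sn m) n0; rewrite -/c.
  suff : c / n%:R <= eps / 2 by move: lt1; lra.
  rewrite ler_pdivrMr ?ltr0n // mulrC -ler_pdivrMr //.
  apply: ltW; apply: lt_le_trans (archi_boundP _) _; first by rewrite divr_ge0 // ltW.
  by rewrite ler_nat ltnW.
have -> : limn v = inf A.
  apply/cvg_lim => //; apply/cvgrPdist_le => eps eps0.
  have [N NP] := ev _ eps0; exists N.+1 => // n /= le_n.
  have := NP n (ltnW le_n); have := le_inf n (leq_trans (ltn0Sn N) le_n).
  by rewrite ler_distl => h1 h2; apply/andP; split; lra.
by split.
Qed.

End Fekete.

Section StableLength.
Local Open Scope ring_scope.
Variables (R : realType) (G : groupType) (S : finite_generating_set G) (a : G).

Let uD m n : (word_norm S (a ^+ (m + n))%g <= word_norm S (a ^+ m)%g + word_norm S (a ^+ n)%g)%N.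
Proof. by rewrite expgnDr; exact: word_normM. Qed.

Lemma stable_length_le n : (0 < n)%N -> stable_length R S a * n%:R <= (word_norm S (a ^+ n)%g)%:R.
Proof.
move=> n0; rewrite -ler_pdivlMr ?ltr0n //.
by apply: (fekete R _ uD).1 => //; exact: word_norm1.
Qed.

Lemma stable_length_approx eps : 0 < eps -> exists N, forall n, (N <= n)%N ->
  (word_norm S (a ^+ n)%g)%:R <= (stable_length R S a + eps) * n%:R.
Proof.
move=> eps0; have [N NP] := (fekete R (word_norm1 S) uD).2 _ eps0.
exists N.+1 => n le_n; rewrite -ler_pdivrMr ?ltr0n; last exact: leq_trans le_n.
exact/NP/ltnW.
Qed.

End StableLength.

(* Instead of a finite quotient group, a map to a finite type whose fibres form
   a congruence: products of such maps need no group structure on the target. *)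
Lemma residual_congruence (G : groupType) : residually_finite G -> forall s : seq G,
  exists (Q : finType) (pi : G -> Q),
    (forall x y z, pi x = pi y -> pi (z * x) = pi (z * y) /\ pi (x * z) = pi (y * z)) /\
    (forall g, g \in s -> pi g = pi 1 -> g = 1).
Proof.
move=> resG; elim=> [|g s [Q [pi [piM piP]]]].
  by exists unit, (fun=> tt); split.
have [->|/eqP/resG[Q' [f fg]]] := eqVneq g 1.
  by exists Q, pi; split=> // h; rewrite inE => /predU1P[->|/piP].
exists (Q * Q')%type, (fun x => (pi x, f x)); split.
  move=> x y z [e1 e2]; have [e3 e4] := piM x y z e1.
  by rewrite !gmulfM e2 e3 e4.
move=> h; rewrite inE => /predU1P[->|hs] [e1 e2]; last exact: piP.
case: fg; rewrite e2; apply: (mulgI (f 1)); by rewrite -gmulfM !mulg1.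
Qed.

Section EnergyLipschitz.
Variables (G : groupType) (S : finite_generating_set G).
Variables (H : set G) (phi : G -> G) (I : finType) (x : I -> G) (f : G -> G).
Hypothesis HV : forall h, H h -> H h^-1.
Hypothesis xP : forall g, exists! i, H (g * (x i)^-1).
Hypothesis fH : forall h y, H h -> f (h * y) = phi h * f y.
Local Notation d := (word_dist S).

Lemma energy_lipschitz g :
  (\sum_i d (f (x i)) (f (x i * g)%g) <=
   word_norm S g * \sum_i \sum_(s <- sgen S) d (f (x i)) (f (x i * s)%g))%N.
Proof.
have [n] := ubnP (word_norm S g); elim: n g => // n IH g.
rewrite ltnS; case en: (word_norm S g) => [|m] lt_m.
  rewrite (word_norm_eq0 en) mul0n leqn0 sum_nat_eq0; apply/forallP => i.
  by rewrite mulg1 word_distxx.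
have [s [h [sS hm ->]]] := norm_ltS en.
pose F y := d (f y) (f (y * h)).
have FH k y : H k -> F (k * y) = F y by move=> Hk; rewrite /F -mulgA !(fH _ Hk) dist_mul2l.
apply: (@leq_trans (\sum_i d (f (x i)) (f (x i * s)%g) + \sum_i F (x i * s)%g)%N).
  rewrite -big_split /=; apply: leq_sum => i _.
  by rewrite mulgA; exact: word_dist_triangle.
rewrite (sum_invariant HV xP s FH) mulSn; apply: leq_add.
  apply: leq_sum => i _; rewrite (big_fsetD1 s sS) /=; exact: leq_addr.
by rewrite -hm; apply: IH; rewrite hm.
Qed.

End EnergyLipschitz.

Lemma congruence_power (G : groupType) (Q : finType) (pi : G -> Q) :
    (forall x y z, pi x = pi y -> pi (z * x) = pi (z * y) /\ pi (x * z) = pi (y * z)) ->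
  exists2 p, (0 < p)%N & forall x r, pi (x ^+ (p * r)) = pi 1.
Proof.
(* By pigeonhole every element has a positive power of exponent at most [#|Q|] in the class of 1;
   the factorial is a common multiple of these exponents. *)
move=> piM; exists (#|Q|)`!; first exact: fact_gt0.
have mul a b : pi a = pi 1 -> pi b = pi 1 -> pi (a * b) = pi 1.
  by move=> ea eb; have [_ ->] := piM _ _ b ea; rewrite mul1g.
have pow a k : pi a = pi 1 -> pi (a ^+ k) = pi 1.
  by move=> ea; elim: k => [|k IH]; rewrite ?expgS //; exact: mul.
move=> x r; rewrite expgnA; apply: (pow).
have /injectivePn [a [b nab eab]] : ~~ injectiveb (fun k : 'I_(#|Q|).+1 => pi (x ^+ k)).
  by apply/negP => /injectiveP /leq_card; rewrite card_ord ltnn.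
wlog ltab : a b nab eab / (a < b)%N.
  move=> W; case: (ltngtP a b) => [ab|ba|/val_inj e]; first exact: (W a b).
    by apply: (W b a) => //; rewrite eq_sym.
  by rewrite e eqxx in nab.
have /dvdnP[q ->] : (b - a)%N %| (#|Q|)`!.
  apply: dvdn_fact; rewrite subn_gt0 ltab /=.
  by apply: leq_trans (leq_subr _ _) _; rewrite -ltnS.
rewrite mulnC expgnA; apply: (pow).
have [e1 _] := piM _ _ (x ^+ a)^-1 eab.
by move: e1; rewrite mulVg -{1}(subnKC (ltnW ltab)) expgnDr mulKg => <-.
Qed.

(** The additive constant [b] disappears in the limit. Only multiples of [M] are tested, since only
    those powers of [g] can be compared through the subgroup. *)
Lemma limit_slope_le (R : realType) (a c b l : R) (F : nat -> R) M :
    (0 < M)%N -> (0 <= c)%R ->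
    (forall r, (0 < r)%N -> (a * (M * r)%:R <= c * F (M * r)%N + b)%R) ->
    (forall eps, (0 < eps)%R -> exists N, forall n, (N <= n)%N -> (F n <= (l + eps) * n%:R)%R) ->
  (a <= c * l)%R.
Proof.
move=> M0 c0 le_aF le_F; rewrite leNgt; apply/negP => lt_la.
pose g := (a - c * l)%R; have g0 : (0 < g)%R by rewrite subr_gt0.
pose eps := (g / (2 * (c + 1)))%R.
have c1 : (0 < 2 * (c + 1))%R by rewrite mulr_gt0 // ltr_wpDl.
have eps0 : (0 < eps)%R by rewrite divr_gt0.
have [N NP] := le_F _ eps0.
pose r := (maxn N (Num.bound (`|b| / (g / 2)))).+1.
have g2 : (0 < g / 2)%R by rewrite divr_gt0.
have le_r : (r <= M * r)%N by rewrite leq_pmull.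
have F1 := NP (M * r)%N (leq_trans (leq_trans (leq_maxl _ _) (leqnSn _)) le_r).
have a1 := le_aF r (ltn0Sn _).
have b1 : (`|b| < g / 2 * (M * r)%:R)%R.
  rewrite mulrC -ltr_pdivrMr //; apply: lt_le_trans (archi_boundP _) _.
    by rewrite divr_ge0 // ltW.
  by rewrite ler_nat (leq_trans _ le_r) // ltnW // ltnS leq_maxr.
set n : R := (M * r)%:R%R in F1 a1 b1.
have n0 : (0 <= n)%R by rewrite ler0n.
have ce : (c * eps <= g / 2)%R.
  by rewrite /eps mulrA ler_pdivrMr //; move: g0; lra.
have h1 : (c * F (M * r)%N <= c * ((l + eps) * n))%R by rewrite ler_wpM2l.
have h2 : (c * eps * n <= g / 2 * n)%R by rewrite ler_wpM2r.
have h3 : (b <= `|b|)%R by exact: ler_norm.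
have h4 : (a * n = g * n + c * l * n)%R by rewrite /g; lra.
have h5 : (c * ((l + eps) * n) = c * l * n + c * eps * n)%R by lra.
have h6 : (g * n = g / 2 * n + g / 2 * n)%R by lra.
lra.
Qed.

(** Inverses turn left cosets of [H] into right cosets, and [J], the set of classes met by [H],
    indexes the cosets in [H] of its congruence subgroup. *)
Lemma congruence_representatives (G : groupType) (H : groupClosed G) n (t : 'I_n -> G) (Q : finType)
    (pi : G -> Q) : left_coset_representatives H t ->
    (forall x y z, pi x = pi y -> pi (z * x) = pi (z * y) /\ pi (x * z) = pi (y * z)) ->
  exists (J : finType) (u : J -> G), [/\ (0 < #|J|)%N, forall j, u j \in H &
    forall g, exists! i : 'I_n * J,
      g * (u i.2 * (t i.1)^-1)^-1 \in H /\ pi (g * (u i.2 * (t i.1)^-1)^-1) = pi 1].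
Proof.
move=> tP piM; pose im q := `[< exists2 v, v \in H & pi v = q >]; pose J := {q : Q | im q}.
have /choice[u uP] : forall q : J, exists v, v \in H /\ pi v = sval q.
  by move=> [q qP]; move/asboolP: (qP) => [v vH vq]; exists v.
exists J, u; split=> [|j|g]; last 1 first.
- have inH i : ((t i)^-1 * g^-1 \in H) = (g * t i \in H) by rewrite -[RHS]gpredV invgM.
  have [i [Hi ui]] := tP g^-1; rewrite inH in Hi.
  have qP : im (pi (g * t i)) by apply/asboolP; exists (g * t i).
  pose q : J := exist (fun q => im q) _ qP; have [uH uq] := uP q.
  exists (i, q); split=> [|[j q'] /= []].
    rewrite /= invgM invgK mulgA; split; first exact: gpredF.
    by have [_ ->] := piM _ (u q) (u q)^-1 (esym uq); rewrite mulgV.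
  have [uH' uq'] := uP q'; rewrite invgM invgK mulgA => Hj ej.
  have gj : g * t j \in H by move: Hj; rewrite gpredFr.
  have eij : i = j by apply: ui; rewrite inH.
  rewrite -eij in ej *; congr pair; apply: val_inj; rewrite /= -uq'.
  by have [_ e1] := piM _ _ (u q') ej; move: e1; rewrite mulgVK mul1g.
- apply/card_gt0P; have qP : im (pi 1).
    by apply/asboolP; exists 1 => //; exact: gpred1.
  by exists (exist (fun q => im q) _ qP).
by have [] := uP j.
Qed.

Lemma expgJ (G : groupType) (t g : G) n : (t^-1 * g * t) ^+ n = t^-1 * g ^+ n * t.
Proof.
elim: n => [|n IH]; first by rewrite !expg0 mulg1 mulVg.
by rewrite !expgS IH !mulgA mulgK.
Qed.

Lemma norm_le_displacement (G : groupType) (T : finite_generating_set G) (v w z : G) :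
  (word_norm T w <= word_dist T z (v * w * v^-1 * z) + 2 * word_norm T (v^-1 * z))%N.
Proof.
have -> : word_dist T z (v * w * v^-1 * z) = word_dist T (v^-1 * z) (w * (v^-1 * z)).
  by rewrite -(dist_mul2l _ v^-1) !mulgA mulVg mul1g.
set y := v^-1 * z.
have := word_dist_triangle T y 1 w; have := word_dist_triangle T (w * y) y w.
rewrite !dist1g [word_dist T (w * y) w]distC dist_mulr; lia.
Qed.

Theorem corollary1p5 (R : realType) (G : groupType)
    (S : finite_generating_set G)
    (G_hyperbolic : hyperbolic_group G)
    (G_rigid : geometrically_rigid G)
    (G_residually_finite : residually_finite G) :
  exists C : R,
    forall (H : groupClosed G) (n : nat) (t : 'I_n -> G),
      left_coset_representatives H t ->
    forall phi : {multiplicative subgroup_type H -> G},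
      injective phi ->
    forall g : G,
      (average_stable_length R S phi t g <= C * stable_length R S g)%R.
Proof.
have [S1 /hyperbolic_metricP[e1 hyp1]] := G_hyperbolic.
have [T [oneT ncpT]] := G_rigid.
have [e hypT] := hyp_change_generators T hyp1.
have [k [K energy_le]] := energy_bound hypT oneT ncpT.
have [l lP] := dist_lipschitz S T; have [l' l'P] := dist_lipschitz T S.
have [Q [pi [piM piK]]] := residual_congruence G_residually_finite (wball1 T k).
have [P P0 piP] := congruence_power piM.
exists (l * K * l')%:R%R => H n t tP phi phiI g.
have [J [u [J0 uH xP]]] := congruence_representatives tP piM.
pose ph z := phi (insubd (1 : subgroup_type H) z).
have phM a b : a \in H -> b \in H -> ph (a * b) = ph a * ph b.
  move=> aH bH; rewrite /ph -gmulfM; congr (phi _); apply: val_inj.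
  by rewrite /= !val_insubd gpredM // aH bH.
have phI a b : a \in H -> b \in H -> ph a = ph b -> a = b.
  by move=> aH bH /phiI/(congr1 val); rewrite !val_insubd aH bH.
have phX a c : a \in H -> ph (a ^+ c) = ph a ^+ c.
  move=> aH; elim: c => [|c IH]; last by rewrite !expgS phM ?IH // gpredXn.
  by apply: (mulgI (ph 1)); rewrite !expg0 -phM ?mulg1 ?gpred1.
pose HK : set G := [set h | h \in H /\ pi h = pi 1].
pose x (i : 'I_n * J) := u i.2 * (t i.1)^-1.
have HM a b : HK a -> HK b -> HK (a * b).
  move=> [aH ea] [bH eb]; split; first exact: gpredM.
  by have [_ ->] := piM _ _ b ea; rewrite mul1g.
have HV a : HK a -> HK a^-1.
  move=> [aH ea]; split; first by rewrite gpredV.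
  by have [_] := piM _ _ a^-1 ea; rewrite mulgV mul1g.
have Hsep h v : HK h -> (word_dist T v (h * v) <= k)%N -> h = 1.
  move=> [hH eh] le_k; have e2 : v^-1 * h * v = 1.
    apply: piK; first by rewrite wball1P -mulgA.
    have [e2 _] := piM _ _ v^-1 eh; have [_ e3] := piM _ _ v e2.
    by rewrite e3 mulg1 mulVg.
  apply: (mulIg v); apply: (mulgI v^-1); by rewrite mulgA e2 mul1g mulVg.
have [f fH fE] := energy_le HK ph _ x HM HV (fun a b aH bH => phM a b aH.1 bH.1)
  (fun a b aH bH => phI a b aH.1 bH.1) xP Hsep.
pose m j := min_power_in H ((t j)^-1 * g * t j).
have mP j : (0 < m j)%N /\ ((t j)^-1 * g * t j) ^+ m j \in H by exact: min_power_inP tP.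
(* For exponents divisible by [M], all conjugates of the power of [g] by the [t j] lie in [H] and
   are trivial in [Q]. *)
pose M := (P * \prod_j m j)%N.
have M0 : (0 < M)%N by rewrite muln_gt0 P0 prodn_gt0 // => j; have [] := mP j.
pose L j := stable_length_along R S phi ((t j)^-1 * g * t j).
pose B i := word_norm T ((ph (u i.2))^-1 * f (x i)).
have L_le i r : (0 < r)%N -> (L i.1 * (M * r)%:R <=
    (l * (word_dist T (f (x i)) (f (x i * g ^+ (M * r))%g) + 2 * B i))%:R)%R.
  case: i => j q r0 /=; have [mj0 aH] := mP j; set a := _ ^+ m j in aH.
  pose c := (\prod_(j' | j' != j) m j' * r)%N.
  have eN : (M * r = m j * (P * c))%N.
    by rewrite /M (bigD1 j) //= /c; ring.
  have Pc0 : (0 < P * c)%N.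
    by have := muln_gt0 M r; rewrite eN muln_gt0 M0 r0 => /andP[].
  have -> : (L j * (M * r)%:R = stable_length R S (ph a) * (P * c)%:R)%R.
    by rewrite /L /stable_length_along -/(m j) eN natrM mulrA divfK // pnatr_eq0 -lt0n.
  apply: le_trans (stable_length_le _ _ _ Pc0) _; rewrite ler_nat.
  rewrite -dist1g; apply: leq_trans (lP _ _) _; rewrite leq_mul2l dist1g; apply/orP; right.
  apply: leq_trans (norm_le_displacement T (ph (u q)) _ (f (x (j, q)))) _.
  rewrite leq_add2r; pose b := u q * a ^+ (P * c) * (u q)^-1.
  have acH : a ^+ (P * c) \in H by exact: gpredXn.
  have Hb : HK b.
    split; first by rewrite gpredF ?gpredM.
    have [e2 _] := piM _ _ (u q) (piP a c); have [_ e3] := piM _ _ (u q)^-1 e2.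
    by rewrite /b e3 mulg1 mulgV.
  (* On this representative, right multiplication by the power of [g] is left multiplication by [b],
     on which [f] is equivariant; the displacement of [f] thus sees the norm of a power of [ph a],
     up to [2 * B]. *)
  have -> : x (j, q) * g ^+ (M * r) = b * x (j, q).
    by rewrite /b /x /a -expgnA -eN expgJ /= !mulgA mulgVK mulgK.
  rewrite (fH _ _ Hb) /b phM ?gpredM ?gpredV // phM // (phX a _ aH).
  suff -> : ph (u q)^-1 = (ph (u q))^-1 by [].
  have ph1 : ph 1 = 1 by rewrite -[1](expg0 a) phX.
  by apply: (mulgI (ph (u q))); rewrite -phM ?gpredV // !mulgV.
pose I := ('I_n * J)%type.
have sum_le r : (0 < r)%N -> ((\sum_(i : I) L i.1) * (M * r)%:R <=
    (l * K * l' * #|{: I}|)%:R * (word_norm S (g ^+ (M * r))%g)%:R + (l * \sum_(i : I) 2 * B i)%:R)%R.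
  move=> r0; rewrite mulr_suml; apply: (@le_trans _ _ (\sum_(i : I)
    (l * (word_dist T (f (x i)) (f (x i * g ^+ (M * r))%g) + 2 * B i))%:R)%R).
    by apply: ler_sum => i _; exact: L_le.
  rewrite -natr_sum -natrM -natrD ler_nat -(big_distrr l) /= big_split /= mulnDr leq_add2r.
  have le1 := energy_lipschitz T HV xP fH (g ^+ (M * r)).
  have le2 := l'P 1 (g ^+ (M * r)); rewrite !dist1g in le2.
  set w := word_norm S _ in le2 *.
  have -> : (l * K * l' * #|{: I}| * w = l * (l' * w * (K * #|{: I}|)))%N by ring.
  rewrite leq_mul2l; apply/orP; right; apply: leq_trans le1 _.
  exact: leq_mul.
have C0 : (0 <= (l * K * l' * #|{: I}|)%:R :> R)%R by [].
have := limit_slope_le M0 C0 sum_le (stable_length_approx S g).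
(* [L] does not depend on the second index, so [#|J|] occurs on both sides and cancels: the constant
   is independent of the congruence subgroup. *)
rewrite -(pair_bigA _ (fun j (_ : J) => L j)) /= exchange_big sumr_const.
rewrite card_prod card_ord mulnA natrM.
have n0 : (0 < n)%N by have [[j lt_j] _] := tP 1; exact: leq_trans lt_j.
rewrite -[X in (X <= _)%R]mulr_natr [X in (_ <= X)%R]mulrAC => le_sum.
have {}le_sum : ((\sum_(j < n) L j) * #|J|%:R <=
  (l * K * l' * n)%:R * stable_length R S g * #|J|%:R)%R by [].
rewrite ler_pM2r ?ltr0n // in le_sum.
rewrite /average_stable_length ler_pdivrMr ?ltr0n //.
by apply: le_trans le_sum _; rewrite natrM mulrAC.
Qed.
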